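(* There are a positive constant $\bar C$ and, for each $K\ge1$, a positive constant $\underline C(K)$ such that for all $t>0$, \[\sup_x\bigl(V^\infty(t,x)-V^\lambda(t,x)\bigr)\le \bar C\,t^{-\frac12-\lambda_0}\lambda^{-(2\lambda_0-1)}\quad\forall\lambda>0,\] and \[\underline C(K)\,t^{-\frac12-\lambda_0}\lambda^{-(2\lambda_0-1)}\le\inf_{|x|\le K\sqrt t}\bigl(V^\infty(t,x)-V^\lambda(t,x)\bigr)\quad\forall\lambda\ge t^{-1/2}.\]
   Context: For $\lambda>0$, $V^\lambda(t,x)$ is the unique solution, $C^{1,2}$ on $[0,\infty)\times\mathbb{R}\setminus\{(0,0)\}$, of $\partial_tV=\frac12\partial_x^2V-\frac12V^2$ with $V(0,\cdot)=\lambda\delta_0$. $V^\lambda$ is nondecreasing in $\lambda$ and $V^\infty(t,x)=\lim_{\lambda\to\infty}V^\lambda(t,x)$ (finite, with $V^\infty(t,x)\le2/t$). Let $F(x)=V^\infty(1,x)$, a positive symmetric $C^2$ function vanishing at infinity. Let $m$ be the standard normal law and $Lh=\frac12h''-\frac x2h'$. The operator $L^Fh=Lh-Fh$ (the $L^2(m)$-generator of the Ornstein–Uhlenbeck semigroup killed at rate $F$) has a complete orthonormal system in $L^2(m)$ of $C^2$ eigenfunctions $\psi_n$ with $L^F\psi_n=-\lambda_n\psi_n$, $0\le\lambda_0\le\lambda_1\le\dots\to\infty$, $\lambda_0$ simple with positive eigenfunction; $\lambda_0$ denotes this lowest value (it satisfies $1/2<\lambda_0<1$). *)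

(* Defs.v *)
From Stdlib Require Import Reals Lra.
From Coquelicot Require Import Coquelicot.
Open Scope R_scope.

Definition jcont (f : R -> R -> R) (t x : R) : Prop :=
  filterlim (fun p : R * R => f (fst p) (snd p)) (locally (t, x)) (locally (f t x)).

Definition dt (V : R -> R -> R) (t x : R) : R := Derive (fun s => V s x) t.
Definition dx (V : R -> R -> R) (t x : R) : R := Derive (fun y => V t y) x.
Definition dxx (V : R -> R -> R) (t x : R) : R := Derive (fun y => dx V t y) x.

Definition classical_solution (V : R -> R -> R) : Prop :=
  forall t x, 0 < t ->
    0 <= V t x /\
    ex_derive (fun s => V s x) t /\
    ex_derive (fun y => V t y) x /\
    ex_derive (fun y => dx V t y) x /\
    jcont V t x /\ jcont (dt V) t x /\ jcont (dx V) t x /\ jcont (dxx V) t x /\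
    dt V t x = / 2 * dxx V t x - / 2 * (V t x) ^ 2.

(* Initial trace V(0,.) = lam * delta_0, tested against continuous compactly
   supported test functions: int V(t,x) phi(x) dx -> lam * phi(0) as t -> 0+. *)
Definition initial_trace_delta (V : R -> R -> R) (lam : R) : Prop :=
  forall (phi : R -> R) (Rs : R),
    (forall x, continuous phi x) ->
    (forall x, Rs < Rabs x -> phi x = 0) ->
    filterlim (fun t => RInt (fun x => V t x * phi x) (- Rs) Rs) (at_right 0)
      (locally (lam * phi 0)).

Definition is_V_lambda (V : R -> R -> R) (lam : R) : Prop :=
  classical_solution V /\ initial_trace_delta V lam.

Definition gauss (x : R) : R := exp (- x ^ 2 / 2) / sqrt (2 * PI).

Definition in_L2m (h : R -> R) : Prop :=
  ex_RInt_gen (fun x => h x ^ 2 * gauss x) (Rbar_locally m_infty) (Rbar_locally p_infty).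

Definition C2 (h : R -> R) : Prop :=
  forall x, ex_derive h x /\ ex_derive (Derive h) x /\ continuous (Derive_n h 2) x.

Definition LF (F h : R -> R) (x : R) : R :=
  / 2 * Derive_n h 2 x - x / 2 * Derive h x - F x * h x.

Definition is_eigenvalue_LF (F : R -> R) (mu : R) : Prop :=
  exists h : R -> R, C2 h /\ in_L2m h /\ (exists x, h x <> 0) /\
    forall x, LF F h x = - mu * h x.

Definition lowest_eigenvalue_LF (F : R -> R) (lam0 : R) : Prop :=
  is_eigenvalue_LF F lam0 /\ (forall mu, is_eigenvalue_LF F mu -> lam0 <= mu).

(* Main.v *)
Require Import Defs.
From Stdlib Require Import Reals Lra Psatz Lia IndefiniteDescription.
From Coquelicot Require Import Coquelicot.
Open Scope R_scope.

(** The gap [W = Vinf - V lam] solves [W_t = W_xx/2 - Vinf W + W^2/2].  Since [Vinf] is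
    self-similar with profile [F], a positive eigenfunction [h] of [L^F] for [lam0] gives the
    self-similar solution [H = t^(-1/2-lam0) psi (x/sqrt t)], [psi = exp(-y^2/2) h], of the
    linearised equation [U_t = U_xx/2 - Vinf U], and by scaling only the mass [1] matters.

    Upper bound: if [U > 0] is a supersolution of the linearised equation, then
    [Vinf^2/(Vinf+U)] is a subsolution of the nonlinear one; it lies below [V 1] at time [1] as
    soon as [U] has fat enough tails, which a perturbation [N] of [H], Gaussian with a smaller
    rate and decaying faster in time, provides.  Lower bound: a small multiple of [H - th N] is a
    subsolution of the linearised equation that lies below the gap at a small time.

    Comparison needs no growth condition: the absorption term [-V^2/2] beats the error of a
    polynomial cut-off, uniformly as the cut-off is removed.  At time [0] it works because
    [0 <= lam heat - V] turns weak convergence of the traces into convergence in [L^1].  This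
    yields uniqueness, hence scaling and evenness, and monotonicity and concavity in [lam]; the
    last two control the [lam]-derivative and make [F] a [C^2] solution of the profile equation.

    The positive eigenfunction comes from shooting: the supremum of the parameters for which the
    even solution stays positive is an eigenvalue, and no positive solution exists above
    [lam0]. *)

(* Coquelicot states equations in the carrier of an algebraic structure, where [ring], [field]
   and [lra] do not recognise the type [R]. *)
Ltac in_R := cbv beta; match goal with |- @eq _ ?a ?b => change (@eq R a b) end.

(** * Calculus on the real line *)

Lemma continuous_Rplus (f g : R -> R) x :
  continuous f x -> continuous g x -> continuous (fun y => f y + g y) x.
Proof. apply (continuous_plus (V := R_NormedModule) f g). Qed.

Lemma continuous_Ropp (f : R -> R) x : continuous f x -> continuous (fun y => - f y) x.
Proof. apply (continuous_opp (V := R_NormedModule) f). Qed.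

Lemma continuous_Rminus (f g : R -> R) x :
  continuous f x -> continuous g x -> continuous (fun y => f y - g y) x.
Proof. apply (continuous_minus (V := R_NormedModule) f g). Qed.

Lemma continuous_Rmult (f g : R -> R) x :
  continuous f x -> continuous g x -> continuous (fun y => f y * g y) x.
Proof. apply (continuous_mult (K := R_AbsRing) f g). Qed.

Lemma continuous_Rdiv (f g : R -> R) x :
  continuous f x -> continuous g x -> g x <> 0 -> continuous (fun y => f y / g y) x.
Proof. intros; apply continuous_Rmult, continuous_Rinv_comp; assumption. Qed.

Lemma continuous_ex_derive (f : R -> R) x : ex_derive f x -> continuous f x.
Proof. apply (ex_derive_continuous (K := R_AbsRing) (V := R_NormedModule)). Qed.

Lemma continuous_is_derive (f : R -> R) x l : is_derive f x l -> continuous f x.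
Proof. intros H; apply continuous_ex_derive; exists l; exact H. Qed.

Lemma continuous_Rpow (f : R -> R) n x : continuous f x -> continuous (fun y => f y ^ n) x.
Proof.
  intros H; apply (continuous_comp f (fun z => z ^ n)); [exact H|].
  apply continuous_ex_derive; auto_derive; exact I.
Qed.

Lemma continuous_comp_R (f g : R -> R) x :
  continuous f x -> continuous g (f x) -> continuous (fun y => g (f y)) x.
Proof. apply (continuous_comp f g). Qed.

Lemma continuous_Rid (x : R) : continuous (fun y : R => y) x.
Proof. apply continuous_id. Qed.

Lemma continuous_Rconst (c x : R) : continuous (fun _ : R => c) x.
Proof. apply continuous_const. Qed.

Lemma is_derive_Rplus (f g : R -> R) x l m :
  is_derive f x l -> is_derive g x m -> is_derive (fun y => f y + g y) x (l + m).
Proof. apply (is_derive_plus (V := R_NormedModule) f g). Qed.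

Lemma is_derive_Ropp (f : R -> R) x l : is_derive f x l -> is_derive (fun y => - f y) x (- l).
Proof. apply (is_derive_opp (V := R_NormedModule) f). Qed.

Lemma is_derive_Rminus (f g : R -> R) x l m :
  is_derive f x l -> is_derive g x m -> is_derive (fun y => f y - g y) x (l - m).
Proof. apply (is_derive_minus (V := R_NormedModule) f g). Qed.

Lemma is_derive_Rmult (f g : R -> R) x l m :
  is_derive f x l -> is_derive g x m -> is_derive (fun y => f y * g y) x (l * g x + f x * m).
Proof. intros Hf Hg; apply (is_derive_mult (K := R_AbsRing) f g); auto; apply Rmult_comm. Qed.

Lemma is_derive_Rid (x : R) : is_derive (fun y : R => y) x 1.
Proof. apply (is_derive_id (K := R_AbsRing)). Qed.

Lemma is_derive_Rconst (c x : R) : is_derive (fun _ : R => c) x 0.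
Proof. apply (is_derive_const (V := R_NormedModule)). Qed.

Lemma is_derive_Rcomp (f g : R -> R) x l m :
  is_derive g (f x) l -> is_derive f x m -> is_derive (fun y => g (f y)) x (l * m).
Proof.
  intros Hg Hf; rewrite Rmult_comm.
  apply (is_derive_comp (K := R_AbsRing) (V := R_NormedModule) g f); assumption.
Qed.

Lemma is_derive_Rexp (f : R -> R) x l :
  is_derive f x l -> is_derive (fun y => exp (f y)) x (exp (f x) * l).
Proof. apply is_derive_Rcomp, is_derive_exp. Qed.

Lemma is_derive_reflect (f : R -> R) x l :
  is_derive f (- x) l -> is_derive (fun y => f (- y)) x (- l).
Proof.
  intros H; replace (- l) with (l * - 1) by ring.
  apply (is_derive_Rcomp (fun y => - y) f); [exact H|apply is_derive_Ropp, is_derive_Rid].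
Qed.

Create HintDb calc.
#[local] Hint Resolve continuous_Rplus continuous_Ropp continuous_Rminus continuous_Rmult
  continuous_Rdiv continuous_Rpow continuous_exp_comp continuous_Rid continuous_Rconst : calc.
#[local] Hint Resolve is_derive_Rplus is_derive_Ropp is_derive_Rminus is_derive_Rmult
  is_derive_scal is_derive_Rexp is_derive_pow is_derive_Rid is_derive_Rconst : calc.

Ltac is_derive_calc := evar_last; [solve [eauto 20 with calc]|in_R].

Lemma continuous_is_derive_fun (f f' : R -> R) : (forall x, is_derive f x (f' x)) ->
  forall x, continuous f x.
Proof. intros H x; exact (continuous_is_derive f x _ (H x)). Qed.

Lemma continuous_Rabs_lt (f : R -> R) x e : continuous f x -> 0 < e ->
  exists d, 0 < d /\ forall y, Rabs (y - x) < d -> Rabs (f y - f x) < e.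
Proof.
  intros c He; destruct (proj1 (filterlim_locally f (f x)) c (mkposreal e He)) as [d Hd].
  exists d; split; [apply cond_pos|exact Hd].
Qed.

Lemma at_right_0_Rlt (P : R -> Prop) :
  at_right 0 P <-> exists d, 0 < d /\ forall s, 0 < s < d -> P s.
Proof.
  split.
  - intros [d Hd]; exists d; split; [apply cond_pos|intros s Hs; apply Hd; [|apply Hs]].
    change (Rabs (s - 0) < d); rewrite Rminus_0_r, Rabs_pos_eq; lra.
  - intros (d & Hd & H); exists (mkposreal d Hd); intros s Hs Hs0; apply H; split; [exact Hs0|].
    change (Rabs (s - 0) < d) in Hs; rewrite Rminus_0_r, Rabs_pos_eq in Hs; lra.
Qed.

Lemma exp_le_exp u v : u <= v -> exp u <= exp v.
Proof. intros [h| ->]; [left; apply exp_increasing; exact h|apply Rle_refl]. Qed.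

Lemma exp_le_1 u : u <= 0 -> exp u <= 1.
Proof. intros H; rewrite <- exp_0; apply exp_le_exp, H. Qed.

Lemma one_le_exp u : 0 <= u -> 1 <= exp u.
Proof. intros H; rewrite <- exp_0; apply exp_le_exp, H. Qed.

Lemma ex_RInt_Rcontinuous (f : R -> R) a b : (forall x, continuous f x) -> ex_RInt f a b.
Proof. intros H; apply (ex_RInt_continuous (V := R_CompleteNormedModule)); intros; apply H. Qed.
#[local] Hint Resolve ex_RInt_Rcontinuous : calc.

Lemma RInt_Rconst (c a b : R) : RInt (fun _ => c) a b = c * (b - a).
Proof. rewrite RInt_const; apply Rmult_comm. Qed.

Lemma RInt_Rscal (f : R -> R) (k a b : R) : ex_RInt f a b ->
  RInt (fun x => k * f x) a b = k * RInt f a b.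
Proof. apply (RInt_scal (V := R_CompleteNormedModule) f a b k). Qed.

Lemma RInt_Rplus (f g : R -> R) (a b : R) : ex_RInt f a b -> ex_RInt g a b ->
  RInt (fun x => f x + g x) a b = RInt f a b + RInt g a b.
Proof. apply (RInt_plus (V := R_CompleteNormedModule) f g). Qed.

Lemma RInt_Rminus (f g : R -> R) (a b : R) : ex_RInt f a b -> ex_RInt g a b ->
  RInt (fun x => f x - g x) a b = RInt f a b - RInt g a b.
Proof. apply (RInt_minus (V := R_CompleteNormedModule) f g). Qed.

Lemma RInt_RChasles (f : R -> R) a b c : (forall x, continuous f x) ->
  RInt f a c = RInt f a b + RInt f b c.
Proof.
  intros H; symmetry; apply (RInt_Chasles (V := R_CompleteNormedModule) f a b c);
    apply ex_RInt_Rcontinuous, H.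
Qed.

Lemma RInt_point_0 (f : R -> R) a : RInt f a a = 0.
Proof. exact (RInt_point (V := R_CompleteNormedModule) a f). Qed.

Lemma RInt_nonneg (f : R -> R) a b : a <= b -> (forall x, continuous f x) ->
  (forall x, a < x < b -> 0 <= f x) -> 0 <= RInt f a b.
Proof. intros Hab c Hf; apply RInt_ge_0; auto with calc. Qed.

Lemma RInt_le_subinterval (f : R -> R) a b c d : a <= b <= c -> c <= d ->
  (forall x, continuous f x) -> (forall x, a < x < d -> 0 <= f x) -> RInt f b c <= RInt f a d.
Proof.
  intros Hab Hcd cf Hf.
  rewrite (RInt_RChasles f a b d), (RInt_RChasles f b c d) by exact cf.
  assert (0 <= RInt f a b) by (apply RInt_nonneg; [lra|exact cf|intros; apply Hf; lra]).
  assert (0 <= RInt f c d) by (apply RInt_nonneg; [lra|exact cf|intros; apply Hf; lra]).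
  lra.
Qed.

Lemma RInt_Rswap (f : R -> R) a b : (forall x, continuous f x) -> RInt f b a = - RInt f a b.
Proof.
  intros cf; symmetry.
  apply (opp_RInt_swap (V := R_CompleteNormedModule) f), ex_RInt_Rcontinuous, cf.
Qed.

Lemma RInt_reflect (f : R -> R) a b : (forall x, continuous f x) ->
  RInt (fun x => f (- x)) a b = RInt f (- b) (- a).
Proof.
  intros cf.
  assert (cf' : forall x, continuous (fun y => f (- y)) x)
    by (intros; apply (continuous_comp_R (fun y => - y)); auto with calc).
  rewrite (RInt_Rswap f (- a) (- b)) by exact cf.
  rewrite <- (is_RInt_unique _ _ _ _ (is_RInt_comp_opp f a b _
    (RInt_correct (V := R_CompleteNormedModule) f (- a) (- b) (ex_RInt_Rcontinuous f _ _ cf)))).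
  rewrite (RInt_ext (fun y => opp (f (- y))) (fun y => -1 * f (- y)))
    by (intros; unfold opp; simpl; in_R; ring).
  rewrite RInt_Rscal by auto with calc; in_R; lra.
Qed.

Lemma is_derive_RInt_from_0 (f : R -> R) x : (forall y, continuous f y) ->
  is_derive (fun y => RInt f 0 y) x (f x).
Proof.
  intros c; apply (is_derive_RInt (V := R_NormedModule) f (fun y => RInt f 0 y) 0 x); [|apply c].
  exists (mkposreal 1 Rlt_0_1); intros y _.
  apply (RInt_correct (V := R_CompleteNormedModule)), ex_RInt_Rcontinuous, c.
Qed.
#[local] Hint Resolve is_derive_RInt_from_0 : calc.

Lemma RInt_is_derive (f f' : R -> R) a b : (forall x, is_derive f x (f' x)) ->
  (forall x, continuous f' x) -> RInt f' a b = f b - f a.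
Proof.
  intros Hf c; apply is_RInt_unique.
  apply (is_RInt_derive (V := R_CompleteNormedModule) f f'); intros; [apply Hf|apply c].
Qed.

Lemma RInt_green (u u' u'' q q' q'' : R -> R) (l r : R) :
  (forall x, is_derive u x (u' x)) -> (forall x, is_derive u' x (u'' x)) ->
  (forall x, is_derive q x (q' x)) -> (forall x, is_derive q' x (q'' x)) ->
  (forall x, continuous u'' x) -> (forall x, continuous q'' x) ->
  q l = 0 -> q r = 0 -> q' l = 0 -> q' r = 0 ->
  RInt (fun x => u'' x * q x) l r = RInt (fun x => u x * q'' x) l r.
Proof.
  intros Hu Hu' Hq Hq' cu'' cq'' ql qr q'l q'r.
  pose proof (continuous_is_derive_fun _ _ Hu); pose proof (continuous_is_derive_fun _ _ Hq).
  assert (E : RInt (fun x => u'' x * q x - u x * q'' x) l r = 0).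
  { rewrite (RInt_is_derive (fun x => u' x * q x - u x * q' x)).
    - rewrite ql, qr, q'l, q'r; in_R; ring.
    - intros x; is_derive_calc; ring.
    - auto 20 with calc. }
  rewrite RInt_Rminus in E by auto 20 with calc; lra.
Qed.

Lemma is_derive_RInt_open (I : R -> Prop) (g gt : R -> R -> R) (a b t : R) : open I -> I t ->
  (forall s x, I s -> is_derive (fun r => g r x) s (gt s x)) ->
  (forall s x, I s -> continuity_2d_pt gt s x) ->
  (forall s x, I s -> continuous (fun y => g s y) x) ->
  is_derive (fun s => RInt (fun x => g s x) a b) t (RInt (fun x => gt t x) a b).
Proof.
  intros HI Ht Hd Hc Hx.
  rewrite (RInt_ext (gt t) (fun x => Derive (fun u => g u x) t))
    by (intros; symmetry; apply is_derive_unique, Hd, Ht).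
  destruct (HI t Ht) as [d Hball].
  apply (is_derive_RInt_param g).
  - exists d; intros s Hs x _; eexists; apply Hd, Hball, Hs.
  - intros x _; apply (continuity_2d_pt_ext_loc gt); [|apply Hc, Ht].
    exists d; intros u v Hu _; symmetry; apply is_derive_unique, Hd, Hball, Hu.
  - exists d; intros s Hs; apply ex_RInt_Rcontinuous; intros x; apply Hx, Hball, Hs.
Qed.

Lemma derive_le_affine (f f' : R -> R) (a b K : R) : a <= b ->
  (forall x, a <= x <= b -> is_derive f x (f' x)) ->
  (forall x, a <= x <= b -> f' x <= K) ->
  f b <= f a + K * (b - a).
Proof.
  intros Hab Hd HK.
  destruct (MVT_gen f a b f') as [c [Hc E]]; rewrite Rmin_left, Rmax_right in * by lra.
  - intros x Hx; apply Hd; lra.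
  - intros x Hx; apply continuity_pt_filterlim; eapply continuous_is_derive; apply Hd; lra.
  - assert (f' c * (b - a) <= K * (b - a)) by (apply Rmult_le_compat_r; [lra|apply HK; lra]).
    lra.
Qed.

Lemma derive_nonneg_le (f f' : R -> R) (a b : R) : a <= b ->
  (forall x, a <= x <= b -> is_derive f x (f' x)) ->
  (forall x, a <= x <= b -> 0 <= f' x) -> f a <= f b.
Proof.
  intros Hab Hd Hf'; enough (- f b <= - f a + 0 * (b - a)) by lra.
  apply (derive_le_affine (fun x => - f x) (fun x => - f' x)); auto with calc.
  intros x Hx; specialize (Hf' x Hx); lra.
Qed.

Lemma derive_bounded_lipschitz (f f' : R -> R) (a b K : R) :
  (forall x, a <= x <= b -> is_derive f x (f' x)) ->
  (forall x, a <= x <= b -> Rabs (f' x) <= K) ->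
  forall x y, a <= x <= b -> a <= y <= b -> Rabs (f y - f x) <= K * Rabs (y - x).
Proof.
  intros Hd HK x y Hx Hy.
  assert (Hin : forall c, Rmin x y <= c <= Rmax x y -> a <= c <= b).
  { intros c; unfold Rmin, Rmax; destruct (Rle_dec x y); lra. }
  destruct (MVT_abs f f' x y) as (c & -> & Hc).
  - intros c Hc; apply is_derive_Reals, Hd, Hin, Hc.
  - apply Rmult_le_compat_r; [apply Rabs_pos|apply HK, Hin, Hc].
Qed.

Lemma derive_bounded_from_0 (p p' : R -> R) (X K : R) : p 0 = 0 ->
  (forall x, Rabs x <= X -> is_derive p x (p' x)) ->
  (forall x, Rabs x <= X -> Rabs (p' x) <= K) ->
  forall x, Rabs x <= X -> Rabs (p x) <= K * X.
Proof.
  intros p0 Hd HK x Hx; pose proof (Rabs_pos x).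
  assert (HK0 : 0 <= K) by (eapply Rle_trans; [apply Rabs_pos|apply (HK x Hx)]).
  assert (Habs : forall y, - X <= y <= X -> Rabs y <= X) by (intros; apply Rabs_le; assumption).
  apply Rabs_le_between in Hx as Hx'.
  pose proof (derive_bounded_lipschitz p p' (- X) X K (fun y Hy => Hd y (Habs y Hy))
    (fun y Hy => HK y (Habs y Hy)) 0 x ltac:(lra) Hx') as Hp.
  rewrite p0, !Rminus_0_r in Hp; nra.
Qed.

Lemma derive_at_minimum (f : R -> R) x l :
  is_derive f x l -> (forall y, f x <= f y) -> l = 0.
Proof.
  intros Hd Hmin; apply is_derive_Reals in Hd.
  pose (pr := exist (derivable_pt_abs f x) l Hd).
  exact (deriv_minimum f (x - 1) (x + 1) x pr ltac:(lra) ltac:(lra) (fun y _ _ => Hmin y)).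
Qed.

Lemma derive_right_nonneg (f : R -> R) a l : is_derive f a l ->
  (forall s, a <= s -> f a <= f s) -> 0 <= l.
Proof.
  intros Hd Hm; apply Rnot_lt_le; intros Hl.
  apply is_derive_Reals in Hd; destruct (Hd (- l) ltac:(lra)) as [d H].
  pose proof (cond_pos d).
  specialize (H (d / 2) ltac:(lra) ltac:(rewrite Rabs_pos_eq; lra)).
  apply Rabs_def2 in H; specialize (Hm (a + d / 2) ltac:(lra)).
  assert (0 <= (f (a + d / 2) - f a) / (d / 2)) by (apply Rdiv_le_0_compat; lra).
  lra.
Qed.

Lemma continuous_bounded_on (f : R -> R) a b : a <= b -> (forall x, continuous f x) ->
  exists M, 0 < M /\ forall x, a <= x <= b -> Rabs (f x) <= M.
Proof.
  intros Hab c.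
  destruct (continuity_ab_maj (fun x => Rabs (f x)) a b Hab) as [m [Hm _]].
  { intros x _; apply continuity_pt_filterlim, continuous_Rabs_comp, c. }
  exists (Rabs (f m) + 1); split; [pose proof (Rabs_pos (f m)); lra|].
  intros x Hx; specialize (Hm x Hx); lra.
Qed.

Lemma continuous_positive_on (f : R -> R) a b : a <= b -> (forall x, continuous f x) ->
  (forall x, a <= x <= b -> 0 < f x) -> exists c, 0 < c /\ forall x, a <= x <= b -> c <= f x.
Proof.
  intros Hab c Hp; destruct (continuity_ab_min f a b Hab) as [m [Hm Hmab]].
  { intros x _; apply continuity_pt_filterlim, c. }
  exists (f m); auto.
Qed.

Lemma first_zero (f : R -> R) a b : (forall x, continuous f x) -> a <= b ->
  0 < f a -> f b <= 0 -> exists c, a < c <= b /\ f c = 0 /\ forall x, a <= x < c -> 0 < f x.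
Proof.
  intros cf Hab Ha Hb.
  assert (Hnear : forall x, f x <> 0 -> exists d, 0 < d /\
    forall y, Rabs (y - x) < d -> Rabs (f y - f x) < Rabs (f x))
    by (intros x Hx; apply continuous_Rabs_lt; [apply cf|apply Rabs_pos_lt, Hx]).
  pose (E := fun x => a <= x <= b /\ forall y, a <= y <= x -> 0 < f y).
  assert (Ea : E a) by (split; [lra|]; intros y Hy; replace y with a by lra; exact Ha).
  destruct (completeness E) as [m [Hub Hlub]]; [exists b; intros x [Hx _]; lra|exists a; exact Ea|].
  assert (Ham : a <= m) by apply Hub, Ea.
  assert (Hmb : m <= b) by (apply Hlub; intros x [Hx _]; lra).
  assert (Hbefore : forall x, a <= x < m -> 0 < f x).
  { intros x Hx; apply Rnot_le_lt; intros h; enough (m <= x) by lra.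
    apply Hlub; intros y [Hy Hpos]; apply Rnot_lt_le; intros hy.
    specialize (Hpos x ltac:(lra)); lra. }
  assert (Hm : f m = 0).
  { destruct (Req_dec (f m) 0) as [h|h]; [exact h|exfalso].
    destruct (Hnear m h) as (d & Hd & H); destruct (Rlt_dec 0 (f m)) as [hp|hp].
    - assert (Hafter : forall y, m <= y < m + d -> 0 < f y).
      { intros y Hy; specialize (H y ltac:(rewrite Rabs_pos_eq; lra)).
        rewrite (Rabs_pos_eq (f m)) in H by lra; apply Rabs_def2 in H; lra. }
      destruct (Rlt_dec b (m + d)) as [hb|hb]; [specialize (Hafter b); lra|].
      enough (m + d / 2 <= m) by lra.
      apply Hub; split; [lra|]; intros y Hy.
      destruct (Rlt_dec y m); [apply Hbefore; lra|apply Hafter; lra].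
    - assert (a < m) by (destruct Ham as [h'|h']; [exact h'|subst m; lra]).
      pose proof (Rmax_l a (m - d / 2)); pose proof (Rmax_r a (m - d / 2)).
      assert (Rmax a (m - d / 2) < m) by (apply Rmax_lub_lt; lra).
      specialize (Hbefore (Rmax a (m - d / 2)) ltac:(lra)).
      specialize (H (Rmax a (m - d / 2)) ltac:(apply Rabs_def1; lra)).
      rewrite (Rabs_left (f m)) in H by lra; apply Rabs_def2 in H; lra. }
  exists m; split; [|auto].
  split; [|exact Hmb]; destruct Ham as [h|h]; [exact h|subst m; lra].
Qed.

Lemma nondecreasing_bounded_lim (f : R -> R) (M : R) :
  (forall x y, 0 <= x <= y -> f x <= f y) -> (forall x, 0 <= x -> f x <= M) ->
  exists l : R, is_lim f p_infty l /\ forall x, 0 <= x -> f x <= l.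
Proof.
  intros Hmono HM.
  destruct (completeness (fun v => exists x, 0 <= x /\ v = f x)) as [l [Hub Hlub]].
  { exists M; intros v (x & Hx & ->); auto. }
  { exists (f 0), 0; split; [lra|reflexivity]. }
  assert (Hl : forall x, 0 <= x -> f x <= l) by (intros x Hx; apply Hub; eauto).
  exists l; split; [|exact Hl]; apply is_lim_spec; intros [e He]; simpl.
  assert (Hex : exists x, 0 <= x /\ l - e < f x).
  { apply Classical_Prop.NNPP; intros N; enough (l <= l - e) by lra.
    apply Hlub; intros v (x & Hx & ->); apply Rnot_lt_le; intros h; apply N; eauto. }
  destruct Hex as (x & Hx & Hlx); exists x; intros y Hy.
  specialize (Hmono x y ltac:(lra)); specialize (Hl y ltac:(lra)); apply Rabs_def1; lra.
Qed.

Lemma continuity_2d_comp2 (f u v : R -> R -> R) t x :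
  continuity_2d_pt f (u t x) (v t x) -> continuity_2d_pt u t x -> continuity_2d_pt v t x ->
  continuity_2d_pt (fun s y => f (u s y) (v s y)) t x.
Proof.
  rewrite !continuity_2d_pt_filterlim; intros Hf Hu Hv.
  apply (continuous_comp_2 (U := prod_UniformSpace R_UniformSpace R_UniformSpace)
    (fun p => u (fst p) (snd p)) (fun p => v (fst p) (snd p)) f (t, x)); assumption.
Qed.

Lemma continuity_2d_comp (g : R -> R) (f : R -> R -> R) t x :
  continuous g (f t x) -> continuity_2d_pt f t x ->
  continuity_2d_pt (fun s y => g (f s y)) t x.
Proof.
  intros Hg Hf; apply continuity_1d_2d_pt_comp; [|exact Hf].
  apply continuity_pt_filterlim, Hg.
Qed.

Lemma continuity_2d_time (w : R -> R) t x :
  continuous w t -> continuity_2d_pt (fun s _ => w s) t x.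
Proof.
  intros H; apply (continuity_2d_comp w (fun s _ => s)); [exact H|apply continuity_2d_pt_id1].
Qed.

Lemma continuity_2d_space (q : R -> R) t x :
  continuous q x -> continuity_2d_pt (fun _ y => q y) t x.
Proof.
  intros H; apply (continuity_2d_comp q (fun _ y => y)); [exact H|apply continuity_2d_pt_id2].
Qed.

Lemma continuity_2d_pow (f : R -> R -> R) n t x :
  continuity_2d_pt f t x -> continuity_2d_pt (fun s y => f s y ^ n) t x.
Proof. intros H; apply (continuity_2d_comp (fun z => z ^ n) f); auto with calc. Qed.

Lemma continuity_2d_slice (f : R -> R -> R) t x :
  continuity_2d_pt f t x -> continuous (fun y => f t y) x.
Proof.
  rewrite continuity_2d_pt_filterlim; intros H.
  apply (continuous_comp_2 (fun _ => t) (fun y => y) f x);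
    [apply continuous_const|apply continuous_id|exact H].
Qed.

#[local] Hint Resolve continuity_2d_pt_plus continuity_2d_pt_minus continuity_2d_pt_mult
  continuity_2d_pt_opp continuity_2d_pt_const continuity_2d_pt_id1 continuity_2d_pt_id2
  continuity_2d_pow : calc.

(** * Functions of class [C^{1,2}] and sub- and supersolutions *)

Record is_C12 (I : R -> Prop) (f ft fx fxx : R -> R -> R) : Prop := {
  C12_t : forall t x, I t -> is_derive (fun s => f s x) t (ft t x);
  C12_x : forall t x, I t -> is_derive (fun y => f t y) x (fx t x);
  C12_xx : forall t x, I t -> is_derive (fun y => fx t y) x (fxx t x);
  C12_continuity : forall t x, I t -> continuity_2d_pt f t x;
  C12_continuity_t : forall t x, I t -> continuity_2d_pt ft t x;
  C12_continuous_xx : forall t x, I t -> continuous (fun y => fxx t y) x }.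

Arguments C12_t {I f ft fx fxx}.
Arguments C12_x {I f ft fx fxx}.
Arguments C12_xx {I f ft fx fxx}.
Arguments C12_continuity {I f ft fx fxx}.
Arguments C12_continuity_t {I f ft fx fxx}.
Arguments C12_continuous_xx {I f ft fx fxx}.

Lemma is_C12_slices I f ft fx fxx t : is_C12 I f ft fx fxx -> I t ->
  (forall x, continuous (fun y => f t y) x) /\ (forall x, continuous (fun y => ft t y) x) /\
  (forall x, continuous (fun y => fx t y) x) /\ (forall x, continuous (fun y => fxx t y) x).
Proof.
  intros H Ht; repeat split; intros x.
  - eapply continuous_is_derive, (C12_x H); exact Ht.
  - apply continuity_2d_slice, (C12_continuity_t H), Ht.
  - eapply continuous_is_derive, (C12_xx H); exact Ht.
  - apply (C12_continuous_xx H), Ht.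
Qed.

Lemma is_C12_subset (I J : R -> Prop) f ft fx fxx : (forall t, J t -> I t) ->
  is_C12 I f ft fx fxx -> is_C12 J f ft fx fxx.
Proof. intros HIJ []; split; auto. Qed.

Lemma is_C12_ext (I : R -> Prop) f g ft fx fxx : open I ->
  (forall t x, I t -> f t x = g t x) -> is_C12 I f ft fx fxx -> is_C12 I g ft fx fxx.
Proof.
  intros HI E []; split; intros t x Ht; auto; destruct (HI t Ht) as [d Hd].
  - apply (is_derive_ext_loc (fun s => f s x)); auto.
    exists d; intros s Hs; apply E, Hd, Hs.
  - apply (is_derive_ext (fun y => f t y)); auto.
  - apply (continuity_2d_pt_ext_loc f); auto.
    exists d; intros s y Hs _; apply E, Hd, Hs.
Qed.

Lemma is_C12_time (I : R -> Prop) (w w' : R -> R) :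
  (forall t, I t -> is_derive w t (w' t)) -> (forall t, I t -> continuous w' t) ->
  is_C12 I (fun t _ => w t) (fun t _ => w' t) (fun _ _ => 0) (fun _ _ => 0).
Proof.
  intros Hw cw'; split; intros; auto with calc; apply continuity_2d_time; auto.
  eapply continuous_is_derive; auto.
Qed.

Lemma is_C12_space (I : R -> Prop) (q q' q'' : R -> R) :
  (forall x, is_derive q x (q' x)) -> (forall x, is_derive q' x (q'' x)) ->
  (forall x, continuous q'' x) ->
  is_C12 I (fun _ x => q x) (fun _ _ => 0) (fun _ x => q' x) (fun _ x => q'' x).
Proof.
  intros Hq Hq' cq''; split; intros; auto with calc.
  apply continuity_2d_space, (continuous_is_derive_fun _ _ Hq).
Qed.

Lemma is_C12_scal k I f ft fx fxx : is_C12 I f ft fx fxx ->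
  is_C12 I (fun t x => k * f t x) (fun t x => k * ft t x) (fun t x => k * fx t x)
    (fun t x => k * fxx t x).
Proof. intros []; split; intros; auto with calc. Qed.

Lemma is_C12_plus I f ft fx fxx g gt gx gxx :
  is_C12 I f ft fx fxx -> is_C12 I g gt gx gxx ->
  is_C12 I (fun t x => f t x + g t x) (fun t x => ft t x + gt t x)
    (fun t x => fx t x + gx t x) (fun t x => fxx t x + gxx t x).
Proof. intros [] []; split; intros; auto with calc. Qed.

Lemma is_C12_minus I f ft fx fxx g gt gx gxx :
  is_C12 I f ft fx fxx -> is_C12 I g gt gx gxx ->
  is_C12 I (fun t x => f t x - g t x) (fun t x => ft t x - gt t x)
    (fun t x => fx t x - gx t x) (fun t x => fxx t x - gxx t x).
Proof. intros [] []; split; intros; auto with calc. Qed.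

Lemma is_C12_mult I f ft fx fxx g gt gx gxx :
  is_C12 I f ft fx fxx -> is_C12 I g gt gx gxx ->
  is_C12 I (fun t x => f t x * g t x) (fun t x => ft t x * g t x + f t x * gt t x)
    (fun t x => fx t x * g t x + f t x * gx t x)
    (fun t x => fxx t x * g t x + 2 * (fx t x * gx t x) + f t x * gxx t x).
Proof.
  intros Hf Hg; split; intros t x Ht;
    destruct (is_C12_slices _ _ _ _ _ t Hf Ht) as (? & ? & ? & ?);
    destruct (is_C12_slices _ _ _ _ _ t Hg Ht) as (? & ? & ? & ?);
    destruct Hf, Hg; auto with calc; is_derive_calc; ring.
Qed.

Lemma is_C12_comp (g g' g'' : R -> R) I f ft fx fxx : is_C12 I f ft fx fxx ->
  (forall t x, I t -> is_derive g (f t x) (g' (f t x))) ->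
  (forall t x, I t -> is_derive g' (f t x) (g'' (f t x))) ->
  (forall t x, I t -> continuous g'' (f t x)) ->
  is_C12 I (fun t x => g (f t x)) (fun t x => g' (f t x) * ft t x)
    (fun t x => g' (f t x) * fx t x)
    (fun t x => g'' (f t x) * fx t x ^ 2 + g' (f t x) * fxx t x).
Proof.
  intros Hf Hg Hg' cg''.
  assert (cg : forall t x, I t -> continuous g (f t x))
    by (intros; eapply continuous_is_derive; auto).
  assert (cg' : forall t x, I t -> continuous g' (f t x))
    by (intros; eapply continuous_is_derive; auto).
  split; intros t x Ht; destruct (is_C12_slices _ _ _ _ _ t Hf Ht) as (? & ? & ? & ?);
    destruct Hf.
  - apply (is_derive_Rcomp (fun s => f s x) g); auto.
  - apply (is_derive_Rcomp (fun y => f t y) g); auto.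
  - evar_last; [apply is_derive_Rmult; [apply (is_derive_Rcomp (fun y => f t y) g')|]; auto|].
    in_R; ring.
  - apply continuity_2d_comp; auto.
  - apply continuity_2d_pt_mult; [apply continuity_2d_comp|]; auto.
  - apply continuous_Rplus; apply continuous_Rmult; auto with calc;
      [apply (continuous_comp_R (fun y => f t y) g'')|
       apply (continuous_comp_R (fun y => f t y) g')];
      auto.
Qed.

Lemma is_C12_inv I f ft fx fxx : is_C12 I f ft fx fxx -> (forall t x, I t -> f t x <> 0) ->
  is_C12 I (fun t x => / f t x) (fun t x => - / f t x ^ 2 * ft t x)
    (fun t x => - / f t x ^ 2 * fx t x)
    (fun t x => 2 / f t x ^ 3 * fx t x ^ 2 + - / f t x ^ 2 * fxx t x).
Proof.
  intros Hf Hn.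
  apply (is_C12_comp Rinv (fun z => - / z ^ 2) (fun z => 2 / z ^ 3) _ _ _ _ _ Hf);
    intros t x Ht; specialize (Hn t x Ht).
  - auto_derive; [exact Hn|field; exact Hn].
  - auto_derive; [repeat apply Rmult_integral_contrapositive_currified; auto with real|].
    field; exact Hn.
  - apply continuous_Rdiv; auto using pow_nonzero with calc.
Qed.

Lemma is_C12_affine (tau xi : R -> R) (a b : R) I f ft fx fxx :
  (forall t, is_derive tau t a) -> (forall x, is_derive xi x b) -> is_C12 I f ft fx fxx ->
  is_C12 (fun t => I (tau t)) (fun t x => f (tau t) (xi x)) (fun t x => a * ft (tau t) (xi x))
    (fun t x => b * fx (tau t) (xi x)) (fun t x => b ^ 2 * fxx (tau t) (xi x)).
Proof.
  intros Htau Hxi [].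
  assert (c2 : forall (g : R -> R -> R) t x, continuity_2d_pt g (tau t) (xi x) ->
    continuity_2d_pt (fun s y => g (tau s) (xi y)) t x).
  { intros g t x Hg; apply (continuity_2d_comp2 g (fun s _ => tau s) (fun _ y => xi y));
      [exact Hg|apply continuity_2d_time|apply continuity_2d_space];
      eapply continuous_is_derive; auto. }
  split; intros t x Ht; auto with calc.
  - rewrite Rmult_comm; apply (is_derive_Rcomp tau (fun s => f s (xi x))); auto.
  - rewrite Rmult_comm; apply (is_derive_Rcomp xi (fun y => f (tau t) y)); auto.
  - evar_last; [apply is_derive_Rmult; [apply is_derive_Rconst|]|].
    + apply (is_derive_Rcomp xi (fun y => fx (tau t) y)); auto.
    + in_R; ring.
  - apply continuous_Rmult; [auto with calc|].
    apply (continuous_comp_R xi (fun y => fxx (tau t) y)); [eapply continuous_is_derive|]; auto.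
Qed.

Definition subsolution (I : R -> Prop) (c u : R -> R -> R) : Prop :=
  exists ut ux uxx, is_C12 I u ut ux uxx /\
    forall t x, I t -> ut t x <= / 2 * uxx t x - c t x * u t x.

Definition supersolution (I : R -> Prop) (c u : R -> R -> R) : Prop :=
  exists ut ux uxx, is_C12 I u ut ux uxx /\
    forall t x, I t -> / 2 * uxx t x - c t x * u t x <= ut t x.

Definition solution (I : R -> Prop) (c u : R -> R -> R) : Prop :=
  exists ut ux uxx, is_C12 I u ut ux uxx /\
    forall t x, I t -> ut t x = / 2 * uxx t x - c t x * u t x.

(* Solutions of [u_t = u_xx / 2 - u^2 / 2] are solutions for the potential [half u]. *)
Definition half (u : R -> R -> R) (t x : R) : R := / 2 * u t x.

Lemma solution_sub I c u : solution I c u -> subsolution I c u.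
Proof.
  intros (ut & ux & uxx & H & E); exists ut, ux, uxx; split; [exact H|].
  intros; rewrite E; auto with real.
Qed.

Lemma solution_super I c u : solution I c u -> supersolution I c u.
Proof.
  intros (ut & ux & uxx & H & E); exists ut, ux, uxx; split; [exact H|].
  intros; rewrite E; auto with real.
Qed.

Lemma solution_ext (I : R -> Prop) c c' u u' : open I ->
  (forall t x, I t -> c t x = c' t x) -> (forall t x, I t -> u t x = u' t x) ->
  solution I c u -> solution I c' u'.
Proof.
  intros HI Ec Eu (ut & ux & uxx & H & E); exists ut, ux, uxx; split;
    [apply (is_C12_ext I u); assumption|].
  intros t x Ht; rewrite <- Ec, <- Eu by exact Ht; auto.
Qed.

Lemma subsolution_subset (I J : R -> Prop) c u : (forall t, J t -> I t) ->
  subsolution I c u -> subsolution J c u.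
Proof.
  intros HIJ (ut & ux & uxx & H & E); exists ut, ux, uxx; split; [apply (is_C12_subset I)|]; auto.
Qed.

Lemma supersolution_subset (I J : R -> Prop) c u : (forall t, J t -> I t) ->
  supersolution I c u -> supersolution J c u.
Proof.
  intros HIJ (ut & ux & uxx & H & E); exists ut, ux, uxx; split; [apply (is_C12_subset I)|]; auto.
Qed.

Lemma subsolution_scal I c u k : 0 <= k -> subsolution I c u ->
  subsolution I c (fun t x => k * u t x).
Proof.
  intros Hk (ut & ux & uxx & H & E); do 3 eexists; split; [apply is_C12_scal, H|].
  intros t x Ht; specialize (E t x Ht); apply (Rmult_le_compat_l k) in E; [lra|exact Hk].
Qed.

Lemma supersolution_scal I c u k : 0 <= k -> supersolution I c u ->
  supersolution I c (fun t x => k * u t x).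
Proof.
  intros Hk (ut & ux & uxx & H & E); do 3 eexists; split; [apply is_C12_scal, H|].
  intros t x Ht; specialize (E t x Ht); apply (Rmult_le_compat_l k) in E; [lra|exact Hk].
Qed.

Lemma supersolution_plus I c u v : supersolution I c u -> supersolution I c v ->
  supersolution I c (fun t x => u t x + v t x).
Proof.
  intros (ut & ux & uxx & Hu & Eu) (vt & vx & vxx & Hv & Ev); do 3 eexists; split;
    [apply (is_C12_plus _ _ _ _ _ _ _ _ _ Hu Hv)|].
  intros t x Ht; specialize (Eu t x Ht); specialize (Ev t x Ht); lra.
Qed.

Lemma subsolution_minus I c u v : subsolution I c u -> supersolution I c v ->
  subsolution I c (fun t x => u t x - v t x).
Proof.
  intros (ut & ux & uxx & Hu & Eu) (vt & vx & vxx & Hv & Ev); do 3 eexists; split;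
    [apply (is_C12_minus _ _ _ _ _ _ _ _ _ Hu Hv)|].
  intros t x Ht; specialize (Eu t x Ht); specialize (Ev t x Ht); lra.
Qed.

Lemma supersolution_half_minus I u v : solution I (half u) u -> solution I (half v) v ->
  supersolution I u (fun t x => u t x - v t x).
Proof.
  intros (ut & ux & uxx & Hu & Eu) (vt & vx & vxx & Hv & Ev); do 3 eexists; split;
    [apply (is_C12_minus _ _ _ _ _ _ _ _ _ Hu Hv)|].
  intros t x Ht; specialize (Eu t x Ht); specialize (Ev t x Ht); unfold half in *.
  pose proof (pow2_ge_0 (u t x - v t x)); cbv beta; nra.
Qed.

Lemma subsolution_potential_le I c c' u : (forall t x, I t -> c' t x * u t x <= c t x * u t x) ->
  subsolution I c u -> subsolution I c' u.
Proof.
  intros Hc (ut & ux & uxx & H & E); exists ut, ux, uxx; split; [exact H|].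
  intros t x Ht; specialize (E t x Ht); specialize (Hc t x Ht); lra.
Qed.

Lemma subsolution_mult_time I c u (w g : R -> R) :
  (forall t, I t -> 0 < w t) -> (forall t, I t -> is_derive w t (- g t * w t)) ->
  (forall t, I t -> continuous g t) ->
  subsolution I c u -> subsolution I (fun t x => c t x + g t) (fun t x => w t * u t x).
Proof.
  intros Hw Dw cg (ut & ux & uxx & H & E); do 3 eexists; split.
  - apply (is_C12_mult _ _ _ _ _ _ _ _ _ (is_C12_time I w _ Dw ltac:(
      intros t Ht; pose proof (continuous_is_derive _ _ _ (Dw t Ht)); auto with calc)) H).
  - intros t x Ht; specialize (E t x Ht); specialize (Hw t Ht); simpl; nra.
Qed.

(* The Hessian of [a^2 / (a + b)] is nonnegative, and the reaction terms cancel exactly. *)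
Lemma subsolution_sqr_div_plus I a b :
  (forall t x, I t -> 0 < a t x) -> (forall t x, I t -> 0 < b t x) ->
  subsolution I (half a) a -> supersolution I a b ->
  let s t x := a t x ^ 2 / (a t x + b t x) in subsolution I (half s) s.
Proof.
  intros Ha Hb (at' & ax & axx & Da & Ea) (bt & bx & bxx & Db & Eb) s.
  assert (Hab : forall t x, I t -> a t x + b t x <> 0).
  { intros t x Ht; specialize (Ha t x Ht); specialize (Hb t x Ht); lra. }
  pose proof (is_C12_comp (fun z => z ^ 2) (fun z => 2 * z) (fun _ => 2) _ _ _ _ _ Da
    ltac:(intros; is_derive_calc; simpl; ring) ltac:(intros; is_derive_calc; ring)
    ltac:(auto with calc)) as Dsqr.
  pose proof (is_C12_inv _ _ _ _ _ (is_C12_plus _ _ _ _ _ _ _ _ _ Da Db) Hab) as Dinv.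
  do 3 eexists; split; [exact (is_C12_mult _ _ _ _ _ _ _ _ _ Dsqr Dinv)|].
  intros t x Ht; specialize (Ea t x Ht); specialize (Eb t x Ht); specialize (Ha t x Ht);
    specialize (Hb t x Ht); unfold half, s in *; cbv beta.
  apply Rminus_le_0.
  replace (_ - _) with
    (((a t x ^ 2 + 2 * a t x * b t x) * (/ 2 * axx t x - / 2 * a t x * a t x - at' t x)
       + a t x ^ 2 * (bt t x - (/ 2 * bxx t x - a t x * b t x))) / (a t x + b t x) ^ 2
     + (b t x * ax t x - a t x * bx t x) ^ 2 / (a t x + b t x) ^ 3) by (field; lra).
  apply Rplus_le_le_0_compat; apply Rdiv_le_0_compat; try (apply pow_lt; lra).
  - apply Rplus_le_le_0_compat; apply Rmult_le_pos; nra.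
  - apply pow2_ge_0.
Qed.

(** * Self-similar functions *)

Definition selfsim (b : R) (q : R -> R) (t x : R) : R := Rpower t (- b) * q (x / sqrt t).
Definition selfsim_t (b : R) (q q' : R -> R) (t x : R) : R :=
  Rpower t (- b) * (- b * q (x / sqrt t) - / 2 * (x / sqrt t) * q' (x / sqrt t)) / t.
Definition selfsim_x (b : R) (q' : R -> R) (t x : R) : R :=
  Rpower t (- b) * q' (x / sqrt t) / sqrt t.
Definition selfsim_xx (b : R) (q'' : R -> R) (t x : R) : R :=
  Rpower t (- b) * q'' (x / sqrt t) / t.

Lemma Rpower_pos t a : 0 < Rpower t a.
Proof. apply exp_pos. Qed.

Lemma Rpower_opp_half t : 0 < t -> Rpower t (- / 2) = / sqrt t.
Proof. intros; rewrite Rpower_Ropp, Rpower_sqrt; auto. Qed.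

Lemma Rpower_opp_1 t : 0 < t -> Rpower t (- (1)) = / t.
Proof. intros; rewrite Rpower_Ropp, Rpower_1; auto. Qed.

Lemma Rpower_opp_succ t b : 0 < t -> Rpower t (- (b + 1)) = Rpower t (- b) / t.
Proof.
  intros Ht; replace (- (b + 1)) with (- b + - (1)) by ring.
  rewrite Rpower_plus, Rpower_opp_1 by exact Ht; reflexivity.
Qed.

Lemma Rpower_opp_le s t b : 0 < s <= t -> 0 <= b -> Rpower t (- b) <= Rpower s (- b).
Proof.
  intros Hst Hb; apply exp_le_exp.
  assert (ln s <= ln t) by (destruct (proj2 Hst) as [h| ->]; [left; apply ln_increasing; lra|lra]).
  nra.
Qed.

Lemma is_C12_selfsim b (q q' q'' : R -> R) : (forall y, is_derive q y (q' y)) ->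
  (forall y, is_derive q' y (q'' y)) -> (forall y, continuous q'' y) ->
  is_C12 (Rlt 0) (selfsim b q) (selfsim_t b q q') (selfsim_x b q') (selfsim_xx b q'').
Proof.
  intros Hq Hq' cq''.
  pose proof (continuous_is_derive_fun _ _ Hq) as cq.
  pose proof (continuous_is_derive_fun _ _ Hq') as cq'.
  assert (Dq : forall y, Derive (fun z => q z) y = q' y) by (intros; apply is_derive_unique, Hq).
  assert (Dq' : forall y, Derive (fun z => q' z) y = q'' y)
    by (intros; apply is_derive_unique, Hq').
  assert (cpow : forall t x, 0 < t -> continuity_2d_pt (fun s _ => Rpower s (- b)) t x).
  { intros t x Ht; apply continuity_2d_time, continuous_ex_derive; unfold Rpower; auto_derive.
    exact Ht. }
  assert (csim : forall t x, 0 < t -> continuity_2d_pt (fun s y => y / sqrt s) t x).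
  { intros t x Ht; pose proof (sqrt_lt_R0 t Ht).
    apply (continuity_2d_pt_mult (fun _ y => y) (fun s _ => / sqrt s)); [auto with calc|].
    apply (continuity_2d_time (fun s => / sqrt s)), continuous_ex_derive; auto_derive.
    repeat split; lra. }
  assert (cprof : forall (g : R -> R) t x, (forall y, continuous g y) -> 0 < t ->
    continuity_2d_pt (fun s y => g (y / sqrt s)) t x).
  { intros g t x cg Ht; apply (continuity_2d_comp g); auto. }
  split; intros t x Ht; pose proof (sqrt_lt_R0 t Ht) as Hs;
    pose proof (sqrt_sqrt t (Rlt_le _ _ Ht)) as Et.
  - unfold selfsim, selfsim_t, Rpower; auto_derive.
    { repeat split; auto; try lra; eexists; apply Hq. }
    change (x * / sqrt t) with (x / sqrt t); rewrite Dq.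
    set (w := sqrt t) in *; set (E := exp _); rewrite <- Et; field; lra.
  - unfold selfsim, selfsim_x; auto_derive; [repeat split; auto; eexists; apply Hq|].
    change (x * / sqrt t) with (x / sqrt t); rewrite Dq; field; lra.
  - unfold selfsim_x, selfsim_xx; auto_derive; [repeat split; auto; eexists; apply Hq'|].
    change (x * / sqrt t) with (x / sqrt t); rewrite Dq'.
    set (w := sqrt t) in *; set (E := Rpower _ _); rewrite <- Et; field; lra.
  - apply continuity_2d_pt_mult; auto.
  - unfold selfsim_t; apply continuity_2d_pt_mult; [auto 10 with calc|].
    apply (continuity_2d_time Rinv), continuous_Rinv; lra.
  - apply continuous_Rmult; [|auto with calc]; apply continuous_Rmult; [auto with calc|].
    apply (continuous_comp_R (fun y => y / sqrt t) q''); [|auto].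
    apply continuous_Rmult; auto with calc.
Qed.

(* In self-similar variables [u_t - u_xx / 2 + c u] becomes [- t^(-b-1)] times this operator. *)
Definition profile_op (b : R) (G q q' q'' : R -> R) (y : R) : R :=
  / 2 * q'' y + / 2 * y * q' y + b * q y - G y * q y.

Lemma selfsim_residual b (G q q' q'' : R -> R) t x : 0 < t ->
  selfsim_t b q q' t x - (/ 2 * selfsim_xx b q'' t x - G (x / sqrt t) / t * selfsim b q t x)
  = - (Rpower t (- b) / t * profile_op b G q q' q'' (x / sqrt t)).
Proof.
  intros Ht; unfold selfsim_t, selfsim_xx, selfsim, profile_op.
  set (y := x / sqrt t); field; lra.
Qed.

Section SelfSimilar.
Variables (b : R) (c : R -> R -> R) (G q q' q'' : R -> R).
Hypothesis Hc : forall t x, 0 < t -> c t x = G (x / sqrt t) / t.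
Hypothesis (Hq : forall y, is_derive q y (q' y)) (Hq' : forall y, is_derive q' y (q'' y))
  (cq'' : forall y, continuous q'' y).

Lemma selfsim_solution : (forall y, profile_op b G q q' q'' y = 0) ->
  solution (Rlt 0) c (selfsim b q).
Proof.
  intros H; do 3 eexists; split; [apply (is_C12_selfsim b q q' q''); assumption|].
  intros t x Ht; pose proof (selfsim_residual b G q q' q'' t x Ht) as E.
  rewrite H, <- Hc in E by exact Ht; lra.
Qed.

Lemma selfsim_supersolution : (forall y, profile_op b G q q' q'' y <= 0) ->
  supersolution (Rlt 0) c (selfsim b q).
Proof.
  intros H; do 3 eexists; split; [apply (is_C12_selfsim b q q' q''); assumption|].
  intros t x Ht; pose proof (selfsim_residual b G q q' q'' t x Ht) as E.
  rewrite <- Hc in E by exact Ht; specialize (H (x / sqrt t)).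
  assert (0 < Rpower t (- b) / t) by (apply Rdiv_lt_0_compat; [apply Rpower_pos|exact Ht]).
  nra.
Qed.
End SelfSimilar.

Definition gaussian (c a y : R) : R := c * exp (- a * y ^ 2).
Definition gaussian' (c a y : R) : R := - 2 * a * y * gaussian c a y.
Definition gaussian'' (c a y : R) : R := (4 * a ^ 2 * y ^ 2 - 2 * a) * gaussian c a y.

Lemma is_derive_gaussian c a y : is_derive (gaussian c a) y (gaussian' c a y).
Proof. unfold gaussian', gaussian; auto_derive; [exact I|simpl; ring]. Qed.

Lemma is_derive_gaussian' c a y : is_derive (gaussian' c a) y (gaussian'' c a y).
Proof. unfold gaussian'', gaussian', gaussian; auto_derive; [exact I|simpl; ring]. Qed.

Lemma continuous_gaussian c a y : continuous (gaussian c a) y.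
Proof. eapply continuous_is_derive, is_derive_gaussian. Qed.

Lemma continuous_gaussian'' c a y : continuous (gaussian'' c a) y.
Proof. unfold gaussian''; auto using continuous_gaussian with calc. Qed.

Lemma gaussian_pos c a y : 0 < c -> 0 < gaussian c a y.
Proof. intros Hc; apply Rmult_lt_0_compat; [exact Hc|apply exp_pos]. Qed.

Lemma gaussian_le c a y : 0 <= c -> 0 <= a -> gaussian c a y <= c.
Proof.
  intros Hc Ha; rewrite <- (Rmult_1_r c) at 2; apply Rmult_le_compat_l; [exact Hc|].
  apply exp_le_1; pose proof (pow2_ge_0 y); nra.
Qed.
#[local] Hint Resolve is_derive_gaussian is_derive_gaussian' continuous_gaussian
  continuous_gaussian'' : calc.

Lemma RInt_selfsim_half (q : R -> R) t x0 a b : 0 < t -> (forall y, continuous q y) ->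
  RInt (fun x => selfsim (/ 2) q t (x - x0)) (x0 + sqrt t * a) (x0 + sqrt t * b) = RInt q a b.
Proof.
  intros Ht cq; pose proof (sqrt_lt_R0 t Ht) as Hs.
  pose proof (RInt_comp_lin (V := R_CompleteNormedModule) q (/ sqrt t) (- x0 / sqrt t)
    (x0 + sqrt t * a) (x0 + sqrt t * b)) as E.
  replace (/ sqrt t * (x0 + sqrt t * a) + - x0 / sqrt t) with a in E by (field; lra).
  replace (/ sqrt t * (x0 + sqrt t * b) + - x0 / sqrt t) with b in E by (field; lra).
  rewrite <- E by (apply ex_RInt_Rcontinuous, cq).
  apply RInt_ext; intros x _; unfold selfsim; rewrite Rpower_opp_half by exact Ht.
  change (/ sqrt t * q ((x - x0) / sqrt t) = / sqrt t * q (/ sqrt t * x + - x0 / sqrt t)).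
  do 2 f_equal; field; lra.
Qed.

(** * A smooth positive part and a cut-off *)

Lemma is_derive_piecewise (f f' g g' : R -> R) :
  (forall r, r <= 0 -> is_derive f r (f' r)) -> (forall r, 0 <= r -> is_derive g r (g' r)) ->
  f 0 = g 0 -> f' 0 = g' 0 ->
  forall r, is_derive (fun r => if Rle_dec r 0 then f r else g r) r
                      (if Rle_dec r 0 then f' r else g' r).
Proof.
  intros Hf Hg E E' r; destruct (Rtotal_order r 0) as [Hr|[->|Hr]].
  - destruct (Rle_dec r 0); [|lra].
    apply (is_derive_ext_loc f); [|apply Hf; lra].
    apply (locally_interval _ r m_infty 0); simpl; auto.
    intros y _ Hy; destruct (Rle_dec y 0); [reflexivity|lra].
  - destruct (Rle_dec 0 0); [|lra].
    assert (Df := proj1 (is_derive_Reals _ _ _) (Hf 0 (Rle_refl 0))).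
    assert (Dg := proj1 (is_derive_Reals _ _ _) (Hg 0 (Rle_refl 0))).
    apply is_derive_Reals; intros eps Heps.
    destruct (Df eps Heps) as [d1 Hd1]; destruct (Dg eps Heps) as [d2 Hd2].
    exists (mkposreal _ (Rmin_pos d1 d2 (cond_pos d1) (cond_pos d2))); simpl; intros h h0 Hh.
    pose proof (Rmin_l d1 d2); pose proof (Rmin_r d1 d2).
    destruct (Rle_dec 0 0); [|lra]; destruct (Rle_dec (0 + h) 0).
    + apply Hd1; lra.
    + rewrite E, E'; apply Hd2; lra.
  - destruct (Rle_dec r 0); [lra|].
    apply (is_derive_ext_loc g); [|apply Hg; lra].
    apply (locally_interval _ r 0 p_infty); simpl; auto.
    intros y Hy _; destruct (Rle_dec y 0); [lra|reflexivity].
Qed.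

Definition smooth_pos (r : R) : R := if Rle_dec r 0 then 0 else r ^ 3 / (1 + r) ^ 2.
Definition smooth_pos' (r : R) : R := if Rle_dec r 0 then 0 else r ^ 2 * (r + 3) / (1 + r) ^ 3.
Definition smooth_pos'' (r : R) : R := if Rle_dec r 0 then 0 else 6 * r / (1 + r) ^ 4.

Lemma is_derive_smooth_pos r : is_derive smooth_pos r (smooth_pos' r).
Proof.
  apply (is_derive_piecewise (fun _ => 0) (fun _ => 0)
    (fun r => r ^ 3 / (1 + r) ^ 2) (fun r => r ^ 2 * (r + 3) / (1 + r) ^ 3)); try field.
  - auto with calc.
  - intros s Hs; auto_derive; [nra|field; lra].
Qed.

Lemma is_derive_smooth_pos' r : is_derive smooth_pos' r (smooth_pos'' r).
Proof.
  apply (is_derive_piecewise (fun _ => 0) (fun _ => 0)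
    (fun r => r ^ 2 * (r + 3) / (1 + r) ^ 3) (fun r => 6 * r / (1 + r) ^ 4)); try field.
  - auto with calc.
  - intros s Hs; auto_derive; [|field; lra].
    assert (0 < (1 + s) ^ 3) by (apply pow_lt; lra); simpl in *; lra.
Qed.

Lemma continuous_Rmax_0 (f : R -> R) x : continuous f x -> continuous (fun y => Rmax 0 (f y)) x.
Proof.
  intros c; apply (continuous_ext (fun y => (f y + Rabs (f y)) / 2)).
  - intros y; unfold Rmax; destruct (Rle_dec 0 (f y)); [rewrite Rabs_pos_eq|rewrite Rabs_left];
      try in_R; lra.
  - apply continuous_Rmult; [|auto with calc]; apply continuous_Rplus; [exact c|].
    apply continuous_Rabs_comp, c.
Qed.

Lemma continuous_smooth_pos'' r : continuous smooth_pos'' r.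
Proof.
  apply (continuous_ext (fun r => 6 * Rmax 0 r / (1 + Rmax 0 r) ^ 4)).
  - intros x; unfold smooth_pos''; destruct (Rle_dec x 0).
    + rewrite Rmax_left by lra; in_R; field.
    + rewrite Rmax_right by lra; reflexivity.
  - pose proof (Rmax_l 0 r); apply continuous_Rdiv; [| |apply pow_nonzero; lra];
      auto using continuous_Rmax_0 with calc.
Qed.

Lemma smooth_pos_nonpos r : r <= 0 -> smooth_pos r = 0.
Proof. intros; unfold smooth_pos; destruct (Rle_dec r 0); lra. Qed.

Lemma smooth_pos_pos r : 0 < r -> 0 < smooth_pos r.
Proof.
  intros; unfold smooth_pos; destruct (Rle_dec r 0); [lra|].
  apply Rdiv_lt_0_compat; apply pow_lt; lra.
Qed.

Lemma smooth_pos_nonneg r : 0 <= smooth_pos r.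
Proof.
  destruct (Rle_dec r 0); [rewrite smooth_pos_nonpos; lra|apply Rlt_le, smooth_pos_pos; lra].
Qed.

Lemma smooth_pos_le r d : 0 <= d -> r <= d -> smooth_pos r <= d.
Proof.
  intros Hd H; unfold smooth_pos; destruct (Rle_dec r 0); [lra|].
  apply Rle_div_l; [apply pow_lt; lra|]; nra.
Qed.

Lemma smooth_pos'_nonpos r : r <= 0 -> smooth_pos' r = 0.
Proof. intros; unfold smooth_pos'; destruct (Rle_dec r 0); lra. Qed.

Lemma smooth_pos'_nonneg r : 0 <= smooth_pos' r.
Proof.
  unfold smooth_pos'; destruct (Rle_dec r 0); [lra|].
  apply Rdiv_le_0_compat; [nra|apply pow_lt; lra].
Qed.

Lemma smooth_pos''_nonneg r : 0 <= smooth_pos'' r.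
Proof.
  unfold smooth_pos''; destruct (Rle_dec r 0); [lra|].
  apply Rdiv_le_0_compat; [nra|apply pow_lt; lra].
Qed.

Lemma smooth_pos_sqr_le r : smooth_pos r ^ 2 <= smooth_pos' r * r ^ 2.
Proof.
  unfold smooth_pos, smooth_pos'; destruct (Rle_dec r 0); [nra|]; apply Rminus_le_0.
  replace (_ - _) with (r ^ 4 * (4 * r + 3) / (1 + r) ^ 4) by (field; lra).
  apply Rdiv_le_0_compat; [|apply pow_lt; lra].
  apply Rmult_le_pos; [apply pow_le; lra|lra].
Qed.

Definition cutoff (R0 x : R) : R := (1 - (x / R0) ^ 2) ^ 4.
Definition cutoff' (R0 x : R) : R := - 8 * (x / R0 ^ 2) * (1 - (x / R0) ^ 2) ^ 3.
Definition cutoff'' (R0 x : R) : R :=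
  (1 - (x / R0) ^ 2) ^ 2 * (48 * (x / R0) ^ 2 - 8 * (1 - (x / R0) ^ 2)) / R0 ^ 2.

Lemma is_C12_cutoff (I : R -> Prop) R0 : 0 < R0 -> is_C12 I (fun _ x => cutoff R0 x) (fun _ _ => 0)
  (fun _ x => cutoff' R0 x) (fun _ x => cutoff'' R0 x).
Proof.
  intros HR; apply is_C12_space; intros x.
  - unfold cutoff, cutoff'; auto_derive; [exact Logic.I|field; lra].
  - unfold cutoff', cutoff''; auto_derive; [exact Logic.I|field; lra].
  - apply continuous_ex_derive; unfold cutoff''; auto_derive; exact Logic.I.
Qed.

Lemma continuous_cutoff R0 x : continuous (cutoff R0) x.
Proof. apply continuous_ex_derive; unfold cutoff; auto_derive; exact I. Qed.
#[local] Hint Resolve continuous_cutoff : calc.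

Lemma Rdiv_sqr_le_1 R0 x : 0 < R0 -> - R0 <= x <= R0 -> 0 <= (x / R0) ^ 2 <= 1.
Proof.
  intros HR Hx; split; [apply pow2_ge_0|].
  assert (-1 <= x / R0) by (apply Rle_div_r; lra).
  assert (x / R0 <= 1) by (apply Rle_div_l; lra).
  nra.
Qed.

Lemma cutoff_bounds R0 x : 0 < R0 -> - R0 <= x <= R0 -> 0 <= cutoff R0 x <= 1.
Proof.
  intros HR Hx; pose proof (Rdiv_sqr_le_1 R0 x HR Hx); unfold cutoff; split.
  - apply pow_le; lra.
  - rewrite <- (pow1 4); apply pow_incr; lra.
Qed.

Lemma cutoff_lower R0 B x : 0 < R0 -> - B <= x <= B -> B <= R0 ->
  1 - 4 * (B / R0) ^ 2 <= cutoff R0 x.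
Proof.
  intros HR Hx HB; pose proof (Rdiv_sqr_le_1 R0 x HR ltac:(lra)).
  assert ((x / R0) ^ 2 <= (B / R0) ^ 2).
  { rewrite <- (pow2_abs (x / R0)), Rabs_div, (Rabs_pos_eq R0) by lra.
    apply pow_incr; split; [apply Rdiv_le_0_compat; [apply Rabs_pos|exact HR]|].
    apply Rmult_le_compat_r; [auto with real|apply Rabs_le; lra]. }
  unfold cutoff; set (z := (x / R0) ^ 2) in *.
  assert (1 - 4 * z <= (1 - z) ^ 4); [|lra].
  pose proof (pow2_ge_0 z); nra.
Qed.

Lemma cutoff_ends R0 : 0 < R0 -> cutoff R0 R0 = 0 /\ cutoff R0 (- R0) = 0 /\
  cutoff' R0 R0 = 0 /\ cutoff' R0 (- R0) = 0.
Proof. intros; unfold cutoff, cutoff'; repeat split; field; lra. Qed.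

(** * Comparison without growth conditions *)

Lemma absorption_young (j m q L : R) : 0 <= q -> 0 <= L -> m ^ 2 <= 2 * L * q ->
  j * m - / 2 * j ^ 2 * q <= L.
Proof.
  intros Hq HL Hm; destruct Hq as [Hq|<-]; [|nra].
  apply Rmult_le_reg_r with q; [exact Hq|]; pose proof (pow2_ge_0 (m - j * q)); nra.
Qed.

Lemma weighted_mass_growth I u q qt qx qxx l r L s t : open I ->
  subsolution I (half u) u -> is_C12 I q qt qx qxx ->
  l <= r -> 0 <= L -> s <= t -> (forall tau, s <= tau <= t -> I tau /\
    q tau l = 0 /\ q tau r = 0 /\ qx tau l = 0 /\ qx tau r = 0 /\
    forall x, l <= x <= r -> 0 <= q tau x /\ (qt tau x + / 2 * qxx tau x) ^ 2 <= 2 * L * q tau x) ->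
  RInt (fun x => u t x * q t x) l r <= RInt (fun x => u s x * q s x) l r + L * (r - l) * (t - s).
Proof.
  intros HI (ut & ux & uxx & Hu & Eu) Hq Hlr HL Hst Hw.
  apply (derive_le_affine (fun tau => RInt (fun x => u tau x * q tau x) l r)
    (fun tau => RInt (fun x => ut tau x * q tau x + u tau x * qt tau x) l r)); [exact Hst| |].
  - intros tau Htau; pose proof (is_C12_mult _ _ _ _ _ _ _ _ _ Hu Hq) as Huq.
    apply (is_derive_RInt_open I (fun tau x => u tau x * q tau x)
      (fun tau x => ut tau x * q tau x + u tau x * qt tau x)); [exact HI|apply Hw, Htau|..].
    + apply (C12_t Huq).
    + apply (C12_continuity_t Huq).
    + intros tau0 x Htau0; apply (proj1 (is_C12_slices _ _ _ _ _ tau0 Huq Htau0)).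
  - intros tau Htau; destruct (Hw tau Htau) as (Itau & ql & qr & qxl & qxr & Hqx).
    destruct (is_C12_slices _ _ _ _ _ tau Hu Itau) as (cu & cut & cux & cuxx).
    destruct (is_C12_slices _ _ _ _ _ tau Hq Itau) as (cq & cqt & cqx & cqxx).
    pose proof (RInt_green (u tau) (ux tau) (uxx tau) (q tau) (qx tau) (qxx tau) l r
      (fun x => C12_x Hu tau x Itau) (fun x => C12_xx Hu tau x Itau)
      (fun x => C12_x Hq tau x Itau) (fun x => C12_xx Hq tau x Itau) cuxx cqxx ql qr qxl qxr) as G.
    apply Rle_trans with
      (RInt (fun x => / 2 * (uxx tau x * q tau x) - / 2 * (u tau x * qxx tau x) + L) l r).
    + apply RInt_le; auto 20 with calc.
      intros x Hx; specialize (Eu tau x Itau); destruct (Hqx x) as [q0 qL]; [lra|].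
      pose proof (absorption_young (u tau x) _ _ _ q0 HL qL).
      apply (Rmult_le_compat_r (q tau x)) in Eu; [unfold half in Eu; lra|exact q0].
    + rewrite RInt_Rplus, RInt_Rminus, !RInt_Rscal, RInt_Rconst by auto 20 with calc.
      rewrite G; lra.
Qed.

Definition subsolution_where_positive (I : R -> Prop) (c u : R -> R -> R) : Prop :=
  exists ut ux uxx, is_C12 I u ut ux uxx /\
    forall t x, I t -> 0 < u t x -> ut t x <= / 2 * uxx t x - c t x * u t x.

Lemma subsolution_smooth_pos I u : subsolution_where_positive I (half u) u ->
  let j t x := smooth_pos (u t x) in subsolution I (half j) j.
Proof.
  intros (ut & ux & uxx & Hu & Eu) j; do 3 eexists; split.
  - apply (is_C12_comp smooth_pos smooth_pos' smooth_pos'' _ _ _ _ _ Hu); intros;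
      [apply is_derive_smooth_pos|apply is_derive_smooth_pos'|apply continuous_smooth_pos''].
  - intros t x Ht; cbv beta; unfold half, j in *.
    pose proof (smooth_pos_sqr_le (u t x)).
    assert (0 <= smooth_pos'' (u t x) * ux t x ^ 2)
      by (apply Rmult_le_pos; [apply smooth_pos''_nonneg|apply pow2_ge_0]).
    assert (smooth_pos' (u t x) * ut t x <=
      smooth_pos' (u t x) * (/ 2 * uxx t x - / 2 * u t x * u t x)).
    { destruct (Rle_dec (u t x) 0) as [h|h]; [rewrite smooth_pos'_nonpos by exact h; lra|].
      apply Rmult_le_compat_l; [apply smooth_pos'_nonneg|apply Eu; [exact Ht|lra]]. }
    lra.
Qed.

Lemma cutoff_mass_growth I u R0 s t : open I -> subsolution I (half u) u -> 0 < R0 -> s <= t ->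
  (forall tau, s <= tau <= t -> I tau) ->
  RInt (fun x => u t x * cutoff R0 x) (- R0) R0
    <= RInt (fun x => u s x * cutoff R0 x) (- R0) R0 + 576 / R0 ^ 3 * (t - s).
Proof.
  intros HI Hu HR Hst Hin.
  assert (0 < R0 ^ 4) by (apply pow_lt; exact HR).
  replace (576 / R0 ^ 3) with (288 / R0 ^ 4 * (R0 - - R0)) by (field; lra).
  apply (weighted_mass_growth I u _ _ _ _ _ _ _ _ _ HI Hu (is_C12_cutoff I R0 HR)); [lra| |lra|].
  - apply Rdiv_le_0_compat; lra.
  - intros tau Htau; destruct (cutoff_ends R0 HR) as (? & ? & ? & ?).
    do 5 (split; [auto|]); intros x Hx; split; [apply cutoff_bounds; assumption|].
    pose proof (Rdiv_sqr_le_1 R0 x HR Hx); unfold cutoff'', cutoff; set (z := (x / R0) ^ 2) in *.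
    replace ((0 + / 2 * ((1 - z) ^ 2 * (48 * z - 8 * (1 - z)) / R0 ^ 2)) ^ 2)
      with ((28 * z - 4) ^ 2 * ((1 - z) ^ 4 / R0 ^ 4)) by (field; lra).
    replace (2 * (288 / R0 ^ 4) * (1 - z) ^ 4) with (24 ^ 2 * ((1 - z) ^ 4 / R0 ^ 4))
      by (field; lra).
    apply Rmult_le_compat_r; [|nra].
    apply Rdiv_le_0_compat; [apply pow_le|]; lra.
Qed.

Lemma cutoff_mass_lower (f : R -> R) x : (forall y, continuous f y) -> (forall y, 0 <= f y) ->
  0 < f x -> exists c R1, 0 < c /\ 0 < R1 /\
    forall R0, R1 <= R0 -> c <= RInt (fun y => f y * cutoff R0 y) (- R0) R0.
Proof.
  intros cf Hf Hx; destruct (continuous_Rabs_lt f x (f x / 2) (cf x)) as (d & Hd & Hnear); [lra|].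
  set (B := Rabs x + d); pose proof (Rabs_pos x).
  assert (Hxb : - Rabs x <= x <= Rabs x) by (apply Rabs_le_between; lra).
  exists (f x / 2 * (3 / 4) * (d / 2)), (4 * B); unfold B in *.
  split; [repeat apply Rmult_lt_0_compat; lra|split; [lra|]]; intros R0 HR.
  apply Rle_trans with (RInt (fun y => f y * cutoff R0 y) x (x + d / 2)).
  - replace (f x / 2 * (3 / 4) * (d / 2)) with (RInt (fun _ => f x / 2 * (3 / 4)) x (x + d / 2))
      by (rewrite RInt_Rconst; in_R; field).
    apply RInt_le; auto with calc; [lra|]; intros y Hy; apply Rmult_le_compat; try lra.
    + specialize (Hnear y ltac:(rewrite Rabs_pos_eq; lra)); apply Rabs_def2 in Hnear; lra.
    + eapply Rle_trans; [|apply (cutoff_lower R0 (Rabs x + d)); lra].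
      assert (0 <= (Rabs x + d) / R0 <= / 4).
      { split; [apply Rdiv_le_0_compat; lra|apply Rle_div_l; lra]. }
      nra.
  - apply RInt_le_subinterval; auto with calc; try lra.
    intros y Hy; apply Rmult_le_pos; [apply Hf|apply cutoff_bounds; lra].
Qed.

Lemma nonpositive_of_vanishing_mass t0 u t :
  subsolution_where_positive (Rlt t0) (half u) u -> t0 < t ->
  (forall R0 eta, 0 < R0 -> 0 < eta -> exists s, t0 < s <= t /\
     RInt (fun x => smooth_pos (u s x) * cutoff R0 x) (- R0) R0 <= eta) ->
  forall x, u t x <= 0.
Proof.
  intros Hu Ht Hmass x; apply Rnot_lt_le; intros Hx.
  pose proof (subsolution_smooth_pos _ _ Hu) as Hj.
  destruct (Hj) as (jt & jx & jxx & Dj & _).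
  destruct (cutoff_mass_lower (fun x => smooth_pos (u t x)) x) as (c & R1 & Hc & HR1 & Hlow);
    [apply (is_C12_slices _ _ _ _ _ t Dj Ht)|intros; apply smooth_pos_nonneg|
     apply smooth_pos_pos, Hx|].
  set (R0 := Rmax R1 (Rmax 1 (1152 * (t - t0) / c + 1))).
  assert (HR1' : R1 <= R0) by apply Rmax_l.
  assert (Hone : 1 <= R0) by (eapply Rle_trans; [apply Rmax_l|apply Rmax_r]).
  assert (Hlarge : 1152 * (t - t0) / c + 1 <= R0)
    by (eapply Rle_trans; [apply Rmax_r|apply Rmax_r]).
  destruct (Hmass R0 (c / 4)) as (s & Hst & Hs); [lra|lra|].
  pose proof (cutoff_mass_growth (Rlt t0) _ R0 s t (open_gt t0) Hj ltac:(lra) ltac:(lra)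
    ltac:(intros; lra)) as Hg; cbv beta in Hg.
  specialize (Hlow R0 HR1').
  assert (576 / R0 ^ 3 * (t - s) <= c / 2); [|lra].
  apply Rle_trans with (576 / R0 * (t - t0)).
  - apply Rmult_le_compat; try lra; [apply Rdiv_le_0_compat; [lra|apply pow_lt; lra]|].
    apply Rmult_le_compat_l; [lra|]; apply Rinv_le_contravar; [lra|].
    assert (1 <= R0 ^ 2) by nra; simpl; nra.
  - assert (1152 * (t - t0) / c * c <= R0 * c) by (apply Rmult_le_compat_r; lra).
    replace (1152 * (t - t0) / c * c) with (1152 * (t - t0)) in * by (field; lra).
    replace (576 / R0 * (t - t0)) with (576 * (t - t0) / R0) by (field; lra).
    apply Rle_div_l; lra.
Qed.

Lemma nonpositive_of_initially_nonpositive t0 u s t :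
  subsolution_where_positive (Rlt t0) (half u) u -> t0 < s <= t ->
  (forall x, u s x <= 0) -> forall x, u t x <= 0.
Proof.
  intros Hu Hst Hs; apply (nonpositive_of_vanishing_mass t0 u t Hu); [lra|].
  intros R0 eta HR Heta; exists s; split; [lra|].
  rewrite (RInt_ext _ (fun _ => 0)); [rewrite RInt_Rconst; lra|].
  intros x _; rewrite smooth_pos_nonpos by apply Hs; in_R; ring.
Qed.

Lemma subsolution_where_positive_minus I u v : subsolution I (half u) u ->
  supersolution I (half v) v -> (forall t x, I t -> 0 <= v t x) ->
  let w t x := u t x - v t x in subsolution_where_positive I (half w) w.
Proof.
  intros (ut & ux & uxx & Hu & Eu) (vt & vx & vxx & Hv & Ev) Hv0 w; do 3 eexists; split;
    [apply (is_C12_minus _ _ _ _ _ _ _ _ _ Hu Hv)|].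
  intros t x Ht Hw; specialize (Eu t x Ht); specialize (Ev t x Ht); specialize (Hv0 t x Ht).
  unfold half, w in *; nra.
Qed.

Theorem absorption_comparison t0 u v s t : subsolution (Rlt t0) (half u) u ->
  supersolution (Rlt t0) (half v) v -> (forall t x, t0 < t -> 0 <= v t x) -> t0 < s <= t ->
  (forall x, u s x <= v s x) -> forall x, u t x <= v t x.
Proof.
  intros Hu Hv Hv0 Hst Hs x; apply Rminus_le.
  pose proof (subsolution_where_positive_minus _ _ _ Hu Hv Hv0) as Hw.
  apply (nonpositive_of_initially_nonpositive t0 _ s t Hw Hst); intros y; specialize (Hs y); lra.
Qed.

(* Multiplying by [exp (- B t / 2)] manufactures the absorption term. *)
Theorem linear_comparison t0 c u v B s t : 0 <= t0 -> 0 <= B ->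
  subsolution (Rlt t0) c u -> supersolution (Rlt t0) c v -> (forall t x, t0 < t -> 0 <= c t x) ->
  (forall t x, t0 < t -> u t x - v t x <= B) -> t0 < s <= t ->
  (forall x, u s x <= v s x) -> forall x, u t x <= v t x.
Proof.
  intros Ht0 HB Hu Hv Hc Hb Hst Hs x; apply Rminus_le.
  pose (w := fun t => exp (- (B / 2) * t)).
  assert (Hw : forall t, t0 < t -> 0 < w t <= 1).
  { intros r Hr; split; [apply exp_pos|apply exp_le_1].
    assert (0 <= B / 2 * r) by (apply Rmult_le_pos; lra); lra. }
  destruct (subsolution_mult_time _ _ _ w (fun _ => B / 2) (fun r Hr => proj1 (Hw r Hr))
    ltac:(intros; unfold w; is_derive_calc; ring) ltac:(auto with calc)
    (subsolution_minus _ _ _ _ Hu Hv)) as (dt & dx & dxx & D & E).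
  pose proof (Hw t ltac:(lra)) as [wt _].
  apply Rmult_le_reg_l with (w t); [exact wt|rewrite Rmult_0_r].
  apply (nonpositive_of_initially_nonpositive t0 (fun t x => w t * (u t x - v t x)) s t);
    [|exact Hst|intros y; specialize (Hs y); pose proof (Hw s ltac:(lra)); nra].
  exists dt, dx, dxx; split; [exact D|]; intros r y Hr Hpos; specialize (E r y Hr).
  specialize (Hc r y Hr); specialize (Hb r y Hr); specialize (Hw r Hr).
  assert (0 <= c r y * (w r * (u r y - v r y))) by (apply Rmult_le_pos; lra).
  assert (w r * (u r y - v r y) <= B).
  { apply Rle_trans with (1 * (u r y - v r y)); [|lra].
    apply Rmult_le_compat_r; [|lra]; nra. }
  unfold half; nra.
Qed.

(** * The heat kernel *)

Definition gaussian_integral (A : R) : R := RInt (gaussian 1 (/ 2)) (- A) A.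

(* Equal to [sqrt (2 * PI)], but only its being the limit matters. *)
Definition gaussian_mass : R := real (Lim gaussian_integral p_infty).

Lemma gaussian_integral_le A B : 0 <= A <= B -> gaussian_integral A <= gaussian_integral B.
Proof.
  intros H; apply RInt_le_subinterval; auto with calc; try lra.
  intros; apply Rlt_le, gaussian_pos; lra.
Qed.

Lemma gaussian_integral_bounded A : 0 <= A -> gaussian_integral A <= 2 * PI.
Proof.
  intros HA; apply Rle_trans with (RInt (fun z => 2 * / (1 + z ^ 2)) (- A) A).
  - apply RInt_le; [lra|auto with calc| |].
    + apply ex_RInt_Rcontinuous; intros z; pose proof (pow2_ge_0 z).
      apply continuous_Rmult; [auto with calc|]; apply continuous_Rinv_comp; [auto with calc|lra].
    + intros z _; unfold gaussian; rewrite Rmult_1_l.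
      replace (- / 2 * z ^ 2) with (- (z ^ 2 / 2)) by field; rewrite exp_Ropp.
      pose proof (pow2_ge_0 z); pose proof (exp_ineq1_le (z ^ 2 / 2)).
      replace (2 * / (1 + z ^ 2)) with (/ ((1 + z ^ 2) / 2)) by (field; lra).
      apply Rinv_le_contravar; lra.
  - rewrite (RInt_is_derive (fun z => 2 * atan z)).
    + pose proof (atan_bound A); pose proof (atan_bound (- A)); lra.
    + intros z; pose proof (pow2_ge_0 z); auto_derive; [exact I|field; nra].
    + intros z; pose proof (pow2_ge_0 z).
      apply continuous_Rmult; [auto with calc|]; apply continuous_Rinv_comp; [auto with calc|lra].
Qed.

Lemma gaussian_mass_spec : is_lim gaussian_integral p_infty gaussian_mass /\
  forall A, 0 <= A -> gaussian_integral A <= gaussian_mass.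
Proof.
  destruct (nondecreasing_bounded_lim gaussian_integral (2 * PI) gaussian_integral_le
    gaussian_integral_bounded) as (l & Hl & Hle).
  unfold gaussian_mass; rewrite (is_lim_unique _ _ _ Hl); auto.
Qed.

Lemma gaussian_mass_pos : 0 < gaussian_mass.
Proof.
  apply Rlt_le_trans with (gaussian_integral 1); [|apply gaussian_mass_spec; lra].
  apply RInt_gt_0; [lra|intros; apply gaussian_pos; lra|auto with calc].
Qed.

Lemma inv_gaussian_mass_pos : 0 < / gaussian_mass.
Proof. apply Rinv_0_lt_compat, gaussian_mass_pos. Qed.

Definition heat : R -> R -> R := selfsim (/ 2) (gaussian (/ gaussian_mass) (/ 2)).

Definition heat_t : R -> R -> R :=
  selfsim_t (/ 2) (gaussian (/ gaussian_mass) (/ 2)) (gaussian' (/ gaussian_mass) (/ 2)).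
Definition heat_x : R -> R -> R := selfsim_x (/ 2) (gaussian' (/ gaussian_mass) (/ 2)).
Definition heat_xx : R -> R -> R := selfsim_xx (/ 2) (gaussian'' (/ gaussian_mass) (/ 2)).

Lemma is_C12_heat : is_C12 (Rlt 0) heat heat_t heat_x heat_xx.
Proof. apply is_C12_selfsim; auto with calc. Qed.

Lemma heat_equation t x : 0 < t -> heat_t t x = / 2 * heat_xx t x.
Proof.
  intros Ht; unfold heat_t, heat_xx, selfsim_t, selfsim_xx, gaussian'', gaussian'.
  set (y := x / sqrt t); field; lra.
Qed.

Lemma heat_solution : solution (Rlt 0) (fun _ _ => 0) heat.
Proof.
  exists heat_t, heat_x, heat_xx; split; [exact is_C12_heat|].
  intros t x Ht; rewrite heat_equation by exact Ht; ring.
Qed.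

Lemma heat_eq t x : 0 < t -> heat t x = exp (- x ^ 2 / (2 * t)) / (gaussian_mass * sqrt t).
Proof.
  intros Ht; pose proof (sqrt_lt_R0 t Ht); pose proof gaussian_mass_pos.
  unfold heat, selfsim, gaussian; rewrite Rpower_opp_half by exact Ht.
  replace (- / 2 * (x / sqrt t) ^ 2) with (- x ^ 2 / (2 * t)).
  - field; lra.
  - rewrite <- (sqrt_sqrt t) at 1 by lra; field; lra.
Qed.

Lemma heat_x_eq t x : 0 < t -> heat_x t x = - (x / t) * heat t x.
Proof.
  intros Ht; pose proof (sqrt_lt_R0 t Ht); unfold heat_x, heat, selfsim_x, selfsim, gaussian'.
  assert (E : x / t = x / sqrt t / sqrt t)
    by (unfold Rdiv; rewrite Rmult_assoc, <- Rinv_mult, sqrt_sqrt by lra; reflexivity).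
  rewrite E; field; lra.
Qed.

Lemma heat_pos t x : 0 < heat t x.
Proof.
  apply Rmult_lt_0_compat; [apply Rpower_pos|apply gaussian_pos, inv_gaussian_mass_pos].
Qed.

Lemma heat_even t x : heat t (- x) = heat t x.
Proof. unfold heat, selfsim, gaussian; do 4 f_equal; unfold Rdiv; ring. Qed.

Lemma heat_le t x : 0 < t -> heat t x <= / (gaussian_mass * sqrt t).
Proof.
  intros Ht; rewrite heat_eq by exact Ht; rewrite <- (Rmult_1_l (/ _)).
  apply Rmult_le_compat_r.
  - left; apply Rinv_0_lt_compat, Rmult_lt_0_compat; [apply gaussian_mass_pos|apply sqrt_lt_R0, Ht].
  - apply exp_le_1; unfold Rdiv; rewrite Ropp_mult_distr_l_reverse.
    assert (0 <= x ^ 2 * / (2 * t)); [|lra].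
    apply Rmult_le_pos; [apply pow2_ge_0|left; apply Rinv_0_lt_compat; lra].
Qed.

Lemma continuous_heat t x0 x : continuous (fun y => heat t (y - x0)) x.
Proof.
  apply continuous_Rmult; [auto with calc|].
  apply (continuous_comp_R (fun y => (y - x0) / sqrt t)); [|auto with calc].
  apply continuous_Rmult; auto with calc.
Qed.
#[local] Hint Resolve continuous_heat : calc.

Lemma RInt_heat t x0 d : 0 < t ->
  RInt (fun x => heat t (x - x0)) (x0 - d) (x0 + d)
    = gaussian_integral (d / sqrt t) / gaussian_mass.
Proof.
  intros Ht; pose proof (sqrt_lt_R0 t Ht); pose proof gaussian_mass_pos.
  replace (x0 - d) with (x0 + sqrt t * - (d / sqrt t)) by (field; lra).
  replace (x0 + d) with (x0 + sqrt t * (d / sqrt t)) by (field; lra).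
  unfold heat; rewrite RInt_selfsim_half by auto with calc.
  rewrite (RInt_ext _ (fun y => / gaussian_mass * gaussian 1 (/ 2) y))
    by (intros; unfold gaussian; in_R; ring).
  rewrite RInt_Rscal by auto with calc; apply Rmult_comm.
Qed.

Lemma RInt_heat_cutoff_le t R0 : 0 < t -> 0 < R0 ->
  RInt (fun x => heat t x * cutoff R0 x) (- R0) R0 <= 1.
Proof.
  intros Ht HR; pose proof (sqrt_lt_R0 t Ht); pose proof gaussian_mass_pos.
  assert (c0 : forall x, continuous (heat t) x).
  { intros x; apply (continuous_ext (fun y => heat t (y - 0)));
      [intros; rewrite Rminus_0_r; reflexivity|apply continuous_heat]. }
  apply Rle_trans with (RInt (fun x => heat t (x - 0)) (0 - R0) (0 + R0)).
  - rewrite Rminus_0_l, Rplus_0_l; apply RInt_le; auto with calc; [lra|].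
    intros x Hx; rewrite Rminus_0_r.
    pose proof (heat_pos t x); pose proof (cutoff_bounds R0 x HR ltac:(lra)); nra.
  - rewrite RInt_heat by exact Ht; apply Rle_div_l; [lra|].
    rewrite Rmult_1_l; apply gaussian_mass_spec, Rdiv_le_0_compat; lra.
Qed.

Lemma RInt_heat_lim d : 0 < d ->
  filterlim (fun t => gaussian_integral (d / sqrt t) / gaussian_mass) (at_right 0) (locally 1).
Proof.
  intros Hd; pose proof gaussian_mass_pos.
  replace 1 with (gaussian_mass * / gaussian_mass) by (field; lra).
  apply (filterlim_comp _ _ _ (fun t => gaussian_integral (d / sqrt t))
    (fun v => v * / gaussian_mass)
    (at_right 0) (locally gaussian_mass));
    [|apply (continuous_Rmult (fun v => v) (fun _ => / gaussian_mass)); auto with calc].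
  apply (filterlim_comp _ _ _ (fun t => d / sqrt t) gaussian_integral _ (Rbar_locally p_infty));
    [|exact (proj1 gaussian_mass_spec)].
  intros P [M HM]; apply at_right_0_Rlt.
  set (K := Rmax M 1); pose proof (Rmax_l M 1 : M <= K); pose proof (Rmax_r M 1 : 1 <= K).
  exists ((d / K) ^ 2); split; [apply pow_lt, Rdiv_lt_0_compat; lra|]; intros s [Hs0 Hs].
  apply HM, Rle_lt_trans with K; [assumption|].
  assert (Hsq : sqrt s < d / K).
  { rewrite <- (sqrt_pow2 (d / K)) by (apply Rdiv_le_0_compat; lra).
    apply sqrt_lt_1_alt; lra. }
  apply Rlt_div_r in Hsq; [|lra]; apply Rlt_div_r; [apply sqrt_lt_R0, Hs0|lra].
Qed.

(** * Solutions issued from a point mass *)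

Definition source_solution (V : R -> R -> R) (lam : R) : Prop :=
  solution (Rlt 0) (half V) V /\ (forall t x, 0 < t -> 0 <= V t x) /\ initial_trace_delta V lam.

Lemma source_solution_of_is_V_lambda V lam : is_V_lambda V lam -> source_solution V lam.
Proof.
  intros [HC Htr]; split; [exists (dt V), (dx V), (dxx V); split; [split|]|split; [|exact Htr]];
    intros t x Ht; destruct (HC t x Ht) as (Vpos & Dt & Dx & Dxx & cV & cVt & _ & cVxx & E).
  - apply Derive_correct, Dt.
  - apply Derive_correct, Dx.
  - apply Derive_correct, Dxx.
  - apply continuity_2d_pt_filterlim, cV.
  - apply continuity_2d_pt_filterlim, cVt.
  - apply continuity_2d_slice, continuity_2d_pt_filterlim, cVxx.
  - rewrite E; unfold half; ring.
  - exact Vpos.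
Qed.

Lemma continuous_source V lam t x : source_solution V lam -> 0 < t -> continuous (fun y => V t y) x.
Proof. intros [(Vt & Vx & Vxx & H & _) _] Ht; apply (is_C12_slices _ _ _ _ _ t H Ht). Qed.

Definition cutoff_extended (R0 x : R) : R := Rmax 0 (1 - (x / R0) ^ 2) ^ 4.

Lemma cutoff_extended_eq R0 x : 0 < R0 -> - R0 <= x <= R0 -> cutoff_extended R0 x = cutoff R0 x.
Proof.
  intros HR Hx; pose proof (Rdiv_sqr_le_1 R0 x HR Hx).
  unfold cutoff_extended, cutoff; rewrite Rmax_right by lra; reflexivity.
Qed.

Lemma cutoff_extended_outside R0 x : 0 < R0 -> R0 < Rabs x -> cutoff_extended R0 x = 0.
Proof.
  intros HR Hx; unfold cutoff_extended; rewrite Rmax_left; [ring|].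
  assert (1 < Rabs (x / R0)).
  { rewrite Rabs_div, (Rabs_pos_eq R0) by lra; apply Rlt_div_r; lra. }
  rewrite <- (pow2_abs (x / R0)); nra.
Qed.

Lemma continuous_cutoff_extended R0 x : continuous (cutoff_extended R0) x.
Proof.
  apply continuous_Rpow, (continuous_Rmax_0 (fun x => 1 - (x / R0) ^ 2)).
  apply continuous_ex_derive; auto_derive; exact I.
Qed.

Lemma source_cutoff_trace V lam q R0 : initial_trace_delta V lam -> 0 < R0 ->
  (forall x, continuous q x) ->
  filterlim (fun t => RInt (fun x => V t x * (q x * cutoff R0 x)) (- R0) R0) (at_right 0)
    (locally (lam * q 0)).
Proof.
  intros HV HR cq.
  replace (lam * q 0) with (lam * (q 0 * cutoff_extended R0 0))
    by (rewrite cutoff_extended_eq by lra; unfold cutoff; field; lra).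
  eapply filterlim_ext; [|apply (HV (fun x => q x * cutoff_extended R0 x) R0)].
  - intros t; apply RInt_ext; rewrite Rmin_left, Rmax_right by lra; intros x Hx.
    rewrite cutoff_extended_eq by lra; reflexivity.
  - auto using continuous_cutoff_extended with calc.
  - intros x Hx; rewrite cutoff_extended_outside by lra; ring.
Qed.

Lemma heat_drift_le x0 eps t y p : 0 < eps <= t -> 0 <= p <= 1 ->
  Rabs (8 * (y * (y - x0)) / t * p) <= 16 * ((y - x0) ^ 2 / t) + 8 * x0 ^ 2 / eps.
Proof.
  intros Ht Hp; set (z := y - x0).
  assert (Hyz : Rabs (y * z) <= 2 * z ^ 2 + x0 ^ 2).
  { replace y with (z + x0) by (unfold z; ring); pose proof (pow2_ge_0 (z + x0));
    pose proof (pow2_ge_0 (z - x0)); pose proof (pow2_ge_0 z); pose proof (pow2_ge_0 x0);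
    apply Rabs_le; lra. }
  rewrite Rabs_mult, (Rabs_pos_eq p), Rabs_div, Rabs_mult, (Rabs_pos_eq 8), (Rabs_pos_eq t) by lra.
  apply Rle_trans with (8 * (2 * z ^ 2 + x0 ^ 2) / t * 1).
  - apply Rmult_le_compat; try lra.
    + apply Rdiv_le_0_compat; [pose proof (Rabs_pos (y * z))|]; lra.
    + apply Rmult_le_compat_r; [left; apply Rinv_0_lt_compat|]; lra.
  - assert (8 * x0 ^ 2 * / t <= 8 * x0 ^ 2 * / eps).
    { apply Rmult_le_compat_l; [pose proof (pow2_ge_0 x0); lra|apply Rinv_le_contravar; lra]. }
    unfold Rdiv in *; lra.
Qed.

Lemma heat_mult_sqr_le eps t z m K : 0 < eps <= t ->
  Rabs m <= K * exp (z ^ 2 / t / 4) -> heat t z * m ^ 2 <= K ^ 2 * / (gaussian_mass * sqrt eps).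
Proof.
  intros Ht Hm; pose proof gaussian_mass_pos; set (w := exp (z ^ 2 / t / 4)) in *.
  assert (Hw : 0 < w) by apply exp_pos.
  assert (Hse : 0 < sqrt eps) by (apply sqrt_lt_R0; lra).
  assert (Hst : sqrt eps <= sqrt t) by (apply sqrt_le_1_alt; lra).
  assert (Eheat : heat t z = / w ^ 2 * / (gaussian_mass * sqrt t)).
  { rewrite heat_eq by lra; unfold Rdiv at 1, w; f_equal.
    replace (- z ^ 2 / (2 * t)) with (- (z ^ 2 / t / 4 + z ^ 2 / t / 4)) by (field; lra).
    rewrite exp_Ropp, exp_plus; f_equal; ring. }
  apply Rle_trans with (heat t z * (K * w) ^ 2).
  { apply Rmult_le_compat_l; [left; apply heat_pos|apply pow_maj_Rabs, Hm]. }
  rewrite Eheat; replace (/ w ^ 2 * / (gaussian_mass * sqrt t) * (K * w) ^ 2)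
    with (K ^ 2 * / (gaussian_mass * sqrt t)) by (field; lra).
  apply Rmult_le_compat_l; [apply pow2_ge_0|]; apply Rinv_le_contravar; nra.
Qed.

(* Lets [weighted_mass_growth] be applied to the product of the backward heat kernel and the
   cut-off. *)
Lemma heat_cutoff_young x0 eps : 0 < eps -> exists C, 0 <= C /\ forall R0 t y, 0 < R0 ->
  - R0 <= y <= R0 -> eps <= t ->
  (heat_x t (y - x0) * cutoff' R0 y + / 2 * (heat t (y - x0) * cutoff'' R0 y)) ^ 2
    <= 2 * (C / R0 ^ 4) * (heat t (y - x0) * cutoff R0 y).
Proof.
  intros Heps; pose proof gaussian_mass_pos as Hg; pose proof (sqrt_lt_R0 eps Heps) as Hse.
  set (K := 64 + 8 * x0 ^ 2 / eps).
  assert (HK : 64 <= K).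
  { assert (0 <= 8 * x0 ^ 2 / eps); [|unfold K; lra].
    apply Rdiv_le_0_compat; [pose proof (pow2_ge_0 x0); lra|exact Heps]. }
  exists (/ 2 * (K ^ 2 * / (gaussian_mass * sqrt eps))); split.
  { assert (0 < / (gaussian_mass * sqrt eps)) by (apply Rinv_0_lt_compat, Rmult_lt_0_compat; lra).
    pose proof (pow2_ge_0 K); nra. }
  intros R0 t y HR Hy Ht; pose proof (Rdiv_sqr_le_1 R0 y HR Hy).
  rewrite heat_x_eq by lra; pose proof (heat_pos t (y - x0)).
  set (h := heat t (y - x0)) in *; set (z := y - x0) in *; set (p := 1 - (y / R0) ^ 2).
  set (m := 8 * (y * z) / t * p + (24 * (y / R0) ^ 2 - 4 * p)); set (v := z ^ 2 / t).
  assert (Hm : Rabs m <= K * exp (v / 4)).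
  { pose proof (heat_drift_le x0 eps t y p ltac:(lra) ltac:(unfold p; lra)) as Hdrift.
    fold z v in Hdrift.
    assert (Hflat : Rabs (24 * (y / R0) ^ 2 - 4 * p) <= 24) by (apply Rabs_le; unfold p; lra).
    pose proof (Rabs_triang (8 * (y * z) / t * p) (24 * (y / R0) ^ 2 - 4 * p)) as Htri.
    fold m in Htri.
    assert (0 <= v) by (apply Rdiv_le_0_compat; [apply pow2_ge_0|lra]).
    pose proof (exp_ineq1_le (v / 4)).
    assert (K * (1 + v / 4) <= K * exp (v / 4)) by (apply Rmult_le_compat_l; lra).
    unfold K in *; nra. }
  replace ((- (z / t) * h * cutoff' R0 y + / 2 * (h * cutoff'' R0 y)) ^ 2)
    with (h * m ^ 2 * (h * p ^ 4 / R0 ^ 4))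
    by (unfold cutoff', cutoff'', m, p; field; lra).
  replace (2 * (/ 2 * (K ^ 2 * / (gaussian_mass * sqrt eps)) / R0 ^ 4) * (h * cutoff R0 y))
    with (K ^ 2 * / (gaussian_mass * sqrt eps) * (h * p ^ 4 / R0 ^ 4))
    by (unfold cutoff, p; field; lra).
  apply Rmult_le_compat_r; [|apply heat_mult_sqr_le; [lra|exact Hm]].
  apply Rdiv_le_0_compat; [apply Rmult_le_pos; [lra|apply pow_le; unfold p; lra]|apply pow_lt, HR].
Qed.

Lemma heat_time_le s t x : 0 < s <= t -> heat s x <= sqrt (t / s) * heat t x.
Proof.
  intros Hst; pose proof gaussian_mass_pos; rewrite !heat_eq, sqrt_div_alt by lra.
  assert (0 < sqrt s) by (apply sqrt_lt_R0; lra).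
  assert (0 < sqrt t) by (apply sqrt_lt_R0; lra).
  replace (sqrt t / sqrt s * (exp (- x ^ 2 / (2 * t)) / (gaussian_mass * sqrt t)))
    with (exp (- x ^ 2 / (2 * t)) / (gaussian_mass * sqrt s)) by (field; lra).
  apply Rmult_le_compat_r; [left; apply Rinv_0_lt_compat; nra|apply exp_le_exp].
  assert (/ (2 * t) <= / (2 * s)) by (apply Rinv_le_contravar; lra).
  pose proof (pow2_ge_0 x); unfold Rdiv; nra.
Qed.

Lemma at_right_continuous (f : R -> R) a : continuous f a ->
  filterlim f (at_right a) (locally (f a)).
Proof.
  intros c; apply (filterlim_filter_le_1 (F := locally a) (G := at_right a)); [|exact c].
  apply filter_le_within.
Qed.

Section HeatBound.
Variables (V : R -> R -> R) (lam : R).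
Hypothesis HV : source_solution V lam.

Let pairing (x0 T R0 s : R) : R :=
  RInt (fun y => V s y * (heat (T - s) (y - x0) * cutoff R0 y)) (- R0) R0.

Lemma heat_pairing_growth x0 eps : 0 < eps -> exists C, 0 <= C /\ forall T R0 s t, 0 < R0 ->
  0 < s <= t -> t + eps <= T -> pairing x0 T R0 t <= pairing x0 T R0 s + C / R0 ^ 3 * (t - s).
Proof.
  intros Heps; destruct (heat_cutoff_young x0 eps Heps) as (C & HC & Hyoung).
  exists (2 * C); split; [lra|]; intros T R0 s t HR Hst HT.
  assert (0 < R0 ^ 4) by (apply pow_lt, HR).
  set (I := fun s => 0 < s /\ 0 < T - s).
  assert (HI : open I).
  { apply open_and; [apply open_gt|]; apply (open_ext (fun s => s < T));
      [intros; lra|apply open_lt]. }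
  assert (Dk := is_C12_mult _ _ _ _ _ _ _ _ _
    (is_C12_subset _ I _ _ _ _ (fun s Hs => proj2 Hs)
      (is_C12_affine (fun s => T - s) (fun y => y - x0) (- 1) 1 (Rlt 0) _ _ _ _
        ltac:(intros; is_derive_calc; ring) ltac:(intros; is_derive_calc; ring) is_C12_heat))
    (is_C12_cutoff I R0 HR)).
  replace (2 * C / R0 ^ 3) with (C / R0 ^ 4 * (R0 - - R0)) by (field; lra).
  apply (weighted_mass_growth I V _ _ _ _ _ _ _ _ _ HI
    (subsolution_subset _ _ _ _ (fun s Hs => proj1 Hs) (solution_sub _ _ _ (proj1 HV))) Dk);
    [lra|apply Rdiv_le_0_compat; lra|lra|].
  intros tau Htau; destruct (cutoff_ends R0 HR) as (Er & El & Er' & El').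
  rewrite Er, El, Er', El'; repeat split; try ring; try lra.
  - apply Rmult_le_pos; [left; apply heat_pos|apply cutoff_bounds; lra].
  - rewrite heat_equation by lra.
    match goal with |- ?a ^ 2 <= _ => replace a with
      (heat_x (T - tau) (x - x0) * cutoff' R0 x + / 2 * (heat (T - tau) (x - x0) * cutoff'' R0 x))
      by field end.
    apply Hyoung; lra.
Qed.

Lemma heat_pairing_le x0 t eps : 0 < t -> 0 < eps -> exists C, 0 <= C /\ forall R0, 0 < R0 ->
  RInt (fun y => V t y * (heat eps (y - x0) * cutoff R0 y)) (- R0) R0
    <= lam * heat (t + eps) x0 + C / R0 ^ 3.
Proof.
  intros Ht Heps; destruct (heat_pairing_growth x0 eps Heps) as (C & HC & Hgrowth).
  exists (C * t); split; [nra|]; intros R0 HR; set (T := t + eps).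
  assert (0 < R0 ^ 3) by (apply pow_lt, HR).
  assert (HCR : 0 <= C / R0 ^ 3) by (apply Rdiv_le_0_compat; lra).
  enough (Hle : pairing x0 T R0 t - C / R0 ^ 3 * t <= lam * heat T x0).
  { unfold pairing in Hle; replace (T - t) with eps in Hle by (unfold T; ring).
    replace (C * t / R0 ^ 3) with (C / R0 ^ 3 * t) by (field; lra); lra. }
  pose (m := fun s => RInt (fun y => V s y * (heat T (y - x0) * cutoff R0 y)) (- R0) R0).
  assert (Hmass : filterlim m (at_right 0) (locally (lam * heat T x0))).
  { rewrite <- heat_even, <- Rminus_0_l.
    apply (source_cutoff_trace V lam (fun y => heat T (y - x0)) R0); auto with calc; apply HV. }
  assert (Hratio : filterlim (fun s => sqrt (T / (T - s))) (at_right 0) (locally 1)).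
  { replace 1 with (sqrt (T / (T - 0)))
      by (rewrite Rminus_0_r, Rdiv_diag by (unfold T; lra); apply sqrt_1).
    apply (at_right_continuous (fun s => sqrt (T / (T - s)))), continuous_ex_derive; auto_derive.
    repeat split; [unfold T; lra|apply Rdiv_lt_0_compat; unfold T; lra]. }
  assert (Hprod : filterlim (fun s => sqrt (T / (T - s)) * m s) (at_right 0)
                 (locally (1 * (lam * heat T x0))))
    by (eapply filterlim_comp_2; [exact Hratio|exact Hmass|];
      apply (filterlim_mult (K := R_AbsRing))).
  rewrite Rmult_1_l in Hprod.
  apply (filterlim_le (F := at_right 0) (fun _ => pairing x0 T R0 t - C / R0 ^ 3 * t)
    (fun s => sqrt (T / (T - s)) * m s) (Finite _) (Finite _));
      [|apply filterlim_const|exact Hprod].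
  apply at_right_0_Rlt; exists t; split; [exact Ht|]; intros s Hs.
  specialize (Hgrowth T R0 s t HR ltac:(lra) ltac:(unfold T; lra)).
  apply Rle_trans with (pairing x0 T R0 s); [nra|].
  pose proof (fun y => continuous_source V lam s y HV (proj1 Hs)) as cV.
  unfold m, pairing; rewrite <- RInt_Rscal by auto 20 with calc.
  apply RInt_le; auto 20 with calc; [lra|]; intros y Hy.
  replace (sqrt (T / (T - s)) * (V s y * (heat T (y - x0) * cutoff R0 y)))
    with (V s y * (sqrt (T / (T - s)) * heat T (y - x0) * cutoff R0 y)) by ring.
  apply Rmult_le_compat_l; [apply HV; lra|]; apply Rmult_le_compat_r; [apply cutoff_bounds; lra|].
  apply heat_time_le; unfold T; lra.
Qed.

Lemma source_local_lower_bound x0 t eps X d : 0 < t -> 0 < eps -> 0 < d -> 0 <= X ->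
  (forall y, x0 - d <= y <= x0 + d -> X <= V t y) ->
  X * RInt (fun y => heat eps (y - x0)) (x0 - d) (x0 + d) <= lam * heat (t + eps) x0.
Proof.
  intros Ht Heps Hd HX HV0; destruct (heat_pairing_le x0 t eps Ht Heps) as (C & HC & Hpair).
  set (I := RInt (fun y => heat eps (y - x0)) (x0 - d) (x0 + d)).
  set (L := lam * heat (t + eps) x0) in *.
  set (B := Rabs x0 + d); pose proof (Rabs_pos x0).
  assert (Hxb : - Rabs x0 <= x0 <= Rabs x0) by (apply Rabs_le_between; lra).
  pose proof (fun y => continuous_source V lam t y HV Ht) as cV.
  assert (Hr : forall R0, B <= R0 -> X * (1 - 4 * (B / R0) ^ 2) * I - C / R0 ^ 3 <= L).
  { intros R0 HR; assert (HR0 : 0 < R0) by (unfold B in *; lra); specialize (Hpair R0 HR0).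
    apply Rle_minus_l; eapply Rle_trans; [|exact Hpair].
    eapply Rle_trans; [|apply (RInt_le_subinterval _ _ (x0 - d) (x0 + d))];
      [|unfold B in *; lra|unfold B in *; lra|auto 20 with calc|].
    - unfold I; rewrite <- RInt_Rscal by auto with calc.
      apply RInt_le; auto 20 with calc; [lra|]; intros y Hy.
      pose proof (heat_pos eps (y - x0)); specialize (HV0 y ltac:(lra)).
      pose proof (cutoff_lower R0 B y HR0 ltac:(unfold B; lra) HR).
      pose proof (cutoff_bounds R0 y HR0 ltac:(unfold B in *; lra)).
      apply Rle_trans with (X * (heat eps (y - x0) * cutoff R0 y)).
      + replace (X * (1 - 4 * (B / R0) ^ 2) * heat eps (y - x0))
          with (X * (heat eps (y - x0) * (1 - 4 * (B / R0) ^ 2))) by ring.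
        apply Rmult_le_compat_l; [exact HX|]; apply Rmult_le_compat_l; lra.
      + apply Rmult_le_compat_r; [apply Rmult_le_pos; lra|exact HV0].
    - intros y Hy; apply Rmult_le_pos; [apply HV, Ht|].
      apply Rmult_le_pos; [left; apply heat_pos|apply cutoff_bounds; lra]. }
  pose (G := fun r => X * (1 - 4 * (B * r) ^ 2) * I - C * r ^ 3).
  replace (X * I) with (G 0) by (unfold G; ring).
  apply (filterlim_le (F := at_right 0) G (fun _ => L) (Finite _) (Finite _));
    [|apply at_right_continuous; unfold G; auto 20 with calc|apply filterlim_const].
  apply at_right_0_Rlt; exists (/ B); split; [apply Rinv_0_lt_compat; unfold B; lra|].
  intros r [Hr0 Hr1]; unfold G; specialize (Hr (/ r)).
  rewrite <- Rinv_inv in Hr at 1.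
  replace (C * r ^ 3) with (C / (/ r) ^ 3) by (field; lra).
  replace (B * r) with (B / / r) by (field; lra).
  apply Hr; apply Rinv_le_contravar; [exact Hr0|lra].
Qed.

Lemma source_le_heat t x : 0 <= lam -> 0 < t -> V t x <= lam * heat t x.
Proof.
  intros Hlam Ht; apply Rle_plus_epsilon; intros eta Heta; pose proof (heat_pos t x).
  destruct (Rle_dec (V t x - eta) 0) as [h|h]; [nra|set (X := V t x - eta) in *].
  destruct (continuous_Rabs_lt (V t) x eta (continuous_source V lam t x HV Ht) Heta)
    as (d & Hd & Hnear).
  enough (X * 1 <= lam * heat (t + 0) x) by (rewrite Rplus_0_r in *; unfold X in *; lra).
  apply (filterlim_le (F := at_right 0)
    (fun eps => X * (gaussian_integral (d / 2 / sqrt eps) / gaussian_mass))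
    (fun eps => lam * heat (t + eps) x) (Finite _) (Finite _)).
  - apply at_right_0_Rlt; exists 1; split; [lra|]; intros eps Heps.
    rewrite <- (RInt_heat eps x) by lra.
    apply source_local_lower_bound; try lra; intros y Hy.
    specialize (Hnear y ltac:(apply Rabs_def1; lra)); apply Rabs_def2 in Hnear; unfold X; lra.
  - eapply filterlim_comp; [apply RInt_heat_lim; lra|].
    apply (continuous_Rmult (fun _ => X) (fun v => v)); auto with calc.
  - apply (at_right_continuous (fun eps => lam * heat (t + eps) x)).
    apply continuous_Rmult; [auto with calc|].
    apply (continuous_comp_R (fun eps => t + eps) (fun s => heat s x)); [auto with calc|].
    eapply continuous_is_derive, (C12_t is_C12_heat); rewrite Rplus_0_r; exact Ht.
Qed.
End HeatBound.

(* [lam * heat - V] is nonnegative, so that its weak convergence to [0] is convergence in mean. *)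
Lemma heat_defect_vanishes V lam R0 eta t : source_solution V lam -> 0 <= lam -> 0 < R0 ->
  0 < eta -> 0 < t -> exists s, 0 < s <= t /\
    RInt (fun x => (lam * heat s x - V s x) * cutoff R0 x) (- R0) R0 <= eta.
Proof.
  intros HV Hl HR Heta Ht.
  pose proof (source_cutoff_trace V lam (fun _ => 1) R0 (proj2 (proj2 HV)) HR
    ltac:(auto with calc)) as Htrace.
  assert (Hnear : locally (lam * 1) (fun v => lam - eta < v))
    by (apply (open_gt (lam - eta)); lra).
  destruct (proj1 (at_right_0_Rlt _) (Htrace _ Hnear)) as (d & Hd & Hmass).
  set (s := Rmin t (d / 2)); exists s.
  assert (Hs : 0 < s) by (apply Rmin_glb_lt; lra).
  pose proof (Rmin_l t (d / 2) : s <= t); pose proof (Rmin_r t (d / 2) : s <= d / 2).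
  split; [lra|]; specialize (Hmass s ltac:(lra)); cbv beta in Hmass.
  pose proof (fun x => continuous_source V lam s x HV Hs) as cV.
  assert (ch : forall x, continuous (heat s) x) by apply (is_C12_slices _ _ _ _ _ s is_C12_heat Hs).
  pose proof (RInt_heat_cutoff_le s R0 Hs HR) as Hheat.
  rewrite (RInt_ext _ (fun x => lam * (heat s x * cutoff R0 x) - V s x * (1 * cutoff R0 x)))
    by (intros; in_R; ring).
  rewrite RInt_Rminus, RInt_Rscal by auto 20 with calc.
  apply (Rmult_le_compat_l lam) in Hheat; lra.
Qed.

Theorem subsolution_le_source U V lam : subsolution (Rlt 0) (half U) U ->
  source_solution V lam -> 0 <= lam -> (forall t x, 0 < t -> U t x <= lam * heat t x) ->
  forall t x, 0 < t -> U t x <= V t x.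
Proof.
  intros HU HV Hl HUheat t x Ht; apply Rminus_le.
  pose proof (subsolution_where_positive_minus _ _ _ HU (solution_super _ _ _ (proj1 HV))
    (proj1 (proj2 HV))) as HD; destruct (HD) as (Dt & Dx & Dxx & D & _).
  apply (nonpositive_of_vanishing_mass 0 (fun t x => U t x - V t x)); [exact HD|exact Ht|].
  intros R0 eta HR Heta.
  destruct (heat_defect_vanishes V lam R0 eta t HV Hl HR Heta Ht) as (s & Hs & Hmass).
  exists s; split; [exact Hs|]; eapply Rle_trans; [|exact Hmass].
  pose proof (fun x => continuous_source V lam s x HV (proj1 Hs)) as cV.
  assert (ch : forall x, continuous (heat s) x)
    by apply (is_C12_slices _ _ _ _ _ s is_C12_heat (proj1 Hs)).
  assert (cJ : forall x, continuous (fun y => smooth_pos (U s y - V s y)) x).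
  { intros y; apply (continuous_comp_R (fun y => U s y - V s y)).
    - apply (is_C12_slices _ _ _ _ _ s D (proj1 Hs)).
    - eapply continuous_is_derive, is_derive_smooth_pos. }
  apply RInt_le; auto 20 with calc; [lra|]; intros y Hy.
  apply Rmult_le_compat_r; [apply cutoff_bounds; lra|].
  specialize (HUheat s y (proj1 Hs)); pose proof (source_le_heat V lam HV s y Hl (proj1 Hs)).
  apply smooth_pos_le; lra.
Qed.

Lemma source_monotone V1 V2 l1 l2 t x : source_solution V1 l1 -> source_solution V2 l2 ->
  0 <= l1 <= l2 -> 0 < t -> V1 t x <= V2 t x.
Proof.
  intros HV1 HV2 Hl Ht.
  apply (subsolution_le_source V1 V2 l2); auto; [apply solution_sub, HV1|lra|].
  intros s y Hs; pose proof (source_le_heat V1 l1 HV1 s y (proj1 Hl) Hs).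
  pose proof (heat_pos s y); nra.
Qed.

Lemma source_unique V1 V2 lam t x : source_solution V1 lam -> source_solution V2 lam ->
  0 <= lam -> 0 < t -> V1 t x = V2 t x.
Proof.
  intros HV1 HV2 Hl Ht; apply Rle_antisym;
    [apply (source_monotone V1 V2 lam lam)|apply (source_monotone V2 V1 lam lam)]; auto; lra.
Qed.

Lemma subsolution_convex_combination I u v th : 0 <= th <= 1 ->
  subsolution I (half u) u -> subsolution I (half v) v ->
  let w t x := th * u t x + (1 - th) * v t x in subsolution I (half w) w.
Proof.
  intros Hth (ut & ux & uxx & Hu & Eu) (vt & vx & vxx & Hv & Ev) w; do 3 eexists; split;
    [apply (is_C12_plus _ _ _ _ _ _ _ _ _ (is_C12_scal th _ _ _ _ _ Hu)
       (is_C12_scal (1 - th) _ _ _ _ _ Hv))|].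
  intros t x Ht; specialize (Eu t x Ht); specialize (Ev t x Ht); unfold half, w in *.
  apply (Rmult_le_compat_l th) in Eu; [|lra].
  apply (Rmult_le_compat_l (1 - th)) in Ev; [|lra].
  assert (0 <= th * (1 - th) * (u t x - v t x) ^ 2)
    by (apply Rmult_le_pos; [nra|apply pow2_ge_0]).
  nra.
Qed.

Lemma source_concave V1 V2 V3 l1 l2 th t x : source_solution V1 l1 -> source_solution V2 l2 ->
  0 <= l1 -> 0 <= l2 -> 0 <= th <= 1 -> source_solution V3 (th * l1 + (1 - th) * l2) -> 0 < t ->
  th * V1 t x + (1 - th) * V2 t x <= V3 t x.
Proof.
  intros HV1 HV2 Hl1 Hl2 Hth HV3 Ht.
  apply (subsolution_le_source (fun t x => th * V1 t x + (1 - th) * V2 t x) V3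
    (th * l1 + (1 - th) * l2)); auto; [|nra|].
  - apply subsolution_convex_combination;
      [exact Hth|apply solution_sub, HV1|apply solution_sub, HV2].
  - intros s y Hs.
    pose proof (source_le_heat V1 l1 HV1 s y Hl1 Hs) as Hle1.
    pose proof (source_le_heat V2 l2 HV2 s y Hl2 Hs) as Hle2.
    apply (Rmult_le_compat_l th) in Hle1; [|lra].
    apply (Rmult_le_compat_l (1 - th)) in Hle2; lra.
Qed.

Lemma RInt_dilation (f : R -> R) s r : s <> 0 -> (forall x, continuous f x) ->
  Rabs s * RInt (fun x => f (s * x)) (- r) r = RInt f (- (Rabs s * r)) (Rabs s * r).
Proof.
  intros Hs cf.
  assert (cs : forall x, continuous (fun y => f (s * y)) x)
    by (intros; apply (continuous_comp_R (fun y => s * y)); auto with calc).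
  assert (E : s * RInt (fun x => f (s * x)) (- r) r = RInt f (s * - r) (s * r)).
  { pose proof (RInt_comp_lin (V := R_CompleteNormedModule) f s 0 (- r) r) as E.
    rewrite !Rplus_0_r in E; rewrite <- E, <- RInt_Rscal by auto with calc.
    apply RInt_ext; intros; rewrite Rplus_0_r; reflexivity. }
  unfold Rabs; destruct (Rcase_abs s).
  - rewrite Ropp_mult_distr_l_reverse, E.
    rewrite (RInt_Rswap f (s * r)), Ropp_involutive by exact cf; f_equal; ring.
  - rewrite E; f_equal; ring.
Qed.

Lemma at_right_0_dilation (f : R -> R) l k : 0 < k ->
  filterlim f (at_right 0) (locally l) -> filterlim (fun t => f (k * t)) (at_right 0) (locally l).
Proof.
  intros Hk Hf; eapply filterlim_comp; [|exact Hf]; intros P HP.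
  destruct (proj1 (at_right_0_Rlt P) HP) as (d & Hd & H); apply at_right_0_Rlt.
  exists (d / k); split; [apply Rdiv_lt_0_compat; assumption|]; intros s [Hs0 Hs]; apply H.
  apply Rlt_div_r in Hs; [nra|exact Hk].
Qed.

Lemma trace_dilation V lam s : s <> 0 -> (forall t x, 0 < t -> continuous (fun y => V t y) x) ->
  initial_trace_delta V lam ->
  initial_trace_delta (fun t x => s ^ 2 * V (s ^ 2 * t) (s * x)) (Rabs s * lam).
Proof.
  intros Hs cV Htr phi Rs cphi Hout.
  assert (Has : 0 < Rabs s) by (apply Rabs_pos_lt, Hs).
  assert (Hs2 : 0 < s ^ 2) by (apply pow2_gt_0, Hs).
  assert (cphi' : forall x, continuous (fun z => phi (/ s * z)) x)
    by (intros; apply (continuous_comp_R (fun z => / s * z)); auto with calc).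
  pose (m := fun t => RInt (fun x => V t x * phi (/ s * x)) (- (Rabs s * Rs)) (Rabs s * Rs)).
  assert (Hm : filterlim (fun t => Rabs s * m (s ^ 2 * t)) (at_right 0)
    (locally (Rabs s * lam * phi 0))).
  { replace (phi 0) with (phi (/ s * 0)) by (rewrite Rmult_0_r; reflexivity).
    rewrite Rmult_assoc.
    apply (filterlim_comp _ _ _ (fun t => m (s ^ 2 * t)) (fun v => Rabs s * v) (at_right 0)
      (locally (lam * phi (/ s * 0))));
      [|apply (continuous_Rmult (fun _ => Rabs s)); auto with calc].
    apply at_right_0_dilation; [exact Hs2|].
    apply (Htr (fun z => phi (/ s * z)) (Rabs s * Rs) cphi').
    intros x Hx; apply Hout; rewrite Rabs_mult, Rabs_inv.
    apply (Rmult_lt_reg_l (Rabs s)); [exact Has|].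
    rewrite <- Rmult_assoc, Rinv_r, Rmult_1_l by lra; exact Hx. }
  eapply filterlim_ext_loc; [|exact Hm].
  apply at_right_0_Rlt; exists 1; split; [lra|]; intros t Ht; unfold m; cbv beta.
  assert (Hst : 0 < s ^ 2 * t) by (apply Rmult_lt_0_compat; lra).
  pose proof (fun x => cV (s ^ 2 * t) x Hst) as cVt.
  assert (cVs : forall x, continuous (fun y => V (s ^ 2 * t) (s * y)) x)
    by (intros; apply (continuous_comp_R (fun y => s * y)); auto with calc).
  rewrite <- (RInt_dilation (fun x => V (s ^ 2 * t) x * phi (/ s * x))) by auto with calc.
  rewrite <- Rmult_assoc; replace (Rabs s * Rabs s) with (s ^ 2) by (rewrite <- pow2_abs; ring).
  rewrite (RInt_ext _ (fun x => V (s ^ 2 * t) (s * x) * phi x)).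
  - rewrite <- RInt_Rscal by auto with calc.
    apply RInt_ext; intros; in_R; ring.
  - intros x _; rewrite <- Rmult_assoc, Rinv_l, Rmult_1_l by exact Hs; reflexivity.
Qed.

Lemma source_dilation V lam s : s <> 0 -> source_solution V lam ->
  source_solution (fun t x => s ^ 2 * V (s ^ 2 * t) (s * x)) (Rabs s * lam).
Proof.
  intros Hs HV; assert (Hs2 : 0 < s ^ 2) by (apply pow2_gt_0, Hs).
  assert (Hpos : forall t, 0 < t -> 0 < s ^ 2 * t) by (intros; apply Rmult_lt_0_compat; lra).
  split; [|split].
  - destruct (proj1 HV) as (Vt & Vx & Vxx & H & E); do 3 eexists; split.
    + apply (is_C12_subset (fun t => 0 < s ^ 2 * t)); [exact Hpos|].
      apply is_C12_scal, (is_C12_affine (fun t => s ^ 2 * t) (fun x => s * x) (s ^ 2) s (Rlt 0));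
        [intros; is_derive_calc; ring..|exact H].
    + intros t x Ht; cbv beta; rewrite E by auto; unfold half; ring.
  - intros t x Ht; apply Rmult_le_pos; [lra|apply HV; auto].
  - apply trace_dilation; [exact Hs|intros; apply (continuous_source V lam); auto|apply HV].
Qed.

(** * Gaussian bounds *)

Lemma source_lower V lam t x : source_solution V lam -> 0 < lam -> 0 < t ->
  lam * exp (- (lam / gaussian_mass) * sqrt t) * heat t x <= V t x.
Proof.
  intros HV Hl Ht; pose proof gaussian_mass_pos as Hg.
  pose (w := fun t => lam * exp (- (lam / gaussian_mass) * sqrt t)).
  pose (g := fun t => lam / gaussian_mass / (2 * sqrt t)).
  assert (Hw : forall t, 0 < t -> 0 < w t <= lam).
  { intros s Hs; unfold w; split; [apply Rmult_lt_0_compat; [exact Hl|apply exp_pos]|].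
    rewrite <- (Rmult_1_r lam) at 3; apply Rmult_le_compat_l; [lra|apply exp_le_1].
    assert (0 < lam / gaussian_mass * sqrt s); [|lra].
    apply Rmult_lt_0_compat; [apply Rdiv_lt_0_compat; lra|apply sqrt_lt_R0, Hs]. }
  apply (subsolution_le_source (fun t x => w t * heat t x) V lam); try assumption; [|lra|].
  - apply (subsolution_potential_le _ (fun t _ => 0 + g t)).
    + intros s y Hs; pose proof (sqrt_lt_R0 s Hs); specialize (Hw s Hs); pose proof (heat_pos s y).
      apply Rmult_le_compat_r; [nra|]; unfold half, g.
      apply Rle_trans with (/ 2 * (lam * / (gaussian_mass * sqrt s))).
      * apply Rmult_le_compat_l; [lra|]; apply Rmult_le_compat; try lra; apply heat_le, Hs.
      * right; field; lra.
    + apply (subsolution_mult_time _ (fun _ _ => 0)).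
      * intros; apply Hw; assumption.
      * intros s Hs; pose proof (sqrt_lt_R0 s Hs); unfold g, w; auto_derive; [lra|field; lra].
      * intros s Hs; pose proof (sqrt_lt_R0 s Hs).
        apply continuous_ex_derive; unfold g; auto_derive.
        repeat split; lra.
      * apply solution_sub, heat_solution.
  - intros s y Hs; apply Rmult_le_compat_r; [left; apply heat_pos|apply Hw, Hs].
Qed.

(* [9 / 8 * exp (9 / 2)] makes the self-similar Gaussian below a supersolution. *)
Definition gaussian_amplitude : R := 9 / 8 * exp (9 / 2).

Lemma gaussian_amplitude_pos : 0 < gaussian_amplitude.
Proof. unfold gaussian_amplitude; pose proof (exp_pos (9 / 2)); lra. Qed.

Definition gaussian_barrier : R -> R -> R := selfsim 1 (gaussian gaussian_amplitude (7 / 16)).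

Lemma gaussian_barrier_supersolution :
  supersolution (Rlt 0) (half gaussian_barrier) gaussian_barrier.
Proof.
  set (q := gaussian gaussian_amplitude (7 / 16)).
  apply (selfsim_supersolution _ _ (fun y => / 2 * q y) _ (gaussian' gaussian_amplitude (7 / 16))
    (gaussian'' gaussian_amplitude (7 / 16))); auto with calc.
  - intros t x Ht; unfold half, gaussian_barrier, selfsim; rewrite Rpower_opp_1 by exact Ht.
    fold q; field; lra.
  - intros y; unfold profile_op, gaussian'', gaussian'; fold q.
    assert (Hq : 0 < q y) by apply gaussian_pos, gaussian_amplitude_pos.
    enough (9 / 16 - 7 / 128 * y ^ 2 <= / 2 * q y) by nra.
    destruct (Rle_dec (72 / 7) (y ^ 2)) as [h|h]; [lra|].
    enough (9 / 16 <= / 2 * q y) by (pose proof (pow2_ge_0 y); lra).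
    assert (He : exp (- (9 / 2)) <= exp (- (7 / 16) * y ^ 2)) by (apply exp_le_exp; lra).
    assert (E : exp (9 / 2) * exp (- (9 / 2)) = 1)
      by (rewrite <- exp_plus, Rplus_opp_r; apply exp_0).
    unfold q, gaussian, gaussian_amplitude; pose proof (exp_pos (9 / 2)); nra.
Qed.

Lemma gaussian_barrier_pos t x : 0 < gaussian_barrier t x.
Proof. apply Rmult_lt_0_compat; [apply Rpower_pos|apply gaussian_pos, gaussian_amplitude_pos]. Qed.

Lemma heat_le_gaussian_barrier lam s x : 0 < lam -> 0 < s ->
  s <= (gaussian_amplitude * gaussian_mass / lam) ^ 2 -> lam * heat s x <= gaussian_barrier s x.
Proof.
  intros Hl Hs Hsmall; pose proof gaussian_mass_pos; pose proof gaussian_amplitude_pos.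
  pose proof (sqrt_lt_R0 s Hs).
  set (k := gaussian_amplitude * gaussian_mass / lam) in *.
  assert (Hk : 0 < k) by (apply Rdiv_lt_0_compat; nra).
  assert (Hsk : sqrt s <= k) by (rewrite <- (sqrt_pow2 k) by lra; apply sqrt_le_1_alt, Hsmall).
  unfold heat, gaussian_barrier, selfsim, gaussian.
  rewrite Rpower_opp_half, Rpower_opp_1 by exact Hs.
  set (y := x / sqrt s).
  rewrite <- !Rmult_assoc; apply Rmult_le_compat.
  - apply Rmult_le_pos; [apply Rmult_le_pos|]; auto with real.
  - left; apply exp_pos.
  - apply Rmult_le_reg_l with (s * (gaussian_mass / lam));
      [apply Rmult_lt_0_compat; [|apply Rdiv_lt_0_compat]; lra|].
    replace (s * (gaussian_mass / lam) * (/ s * gaussian_amplitude)) with k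
      by (unfold k; field; lra).
    rewrite <- (sqrt_sqrt s) at 1 by lra.
    replace (_ * _) with (sqrt s) by (field; lra); exact Hsk.
  - apply exp_le_exp; pose proof (pow2_ge_0 y); lra.
Qed.

Lemma source_upper V lam t x : source_solution V lam -> 0 < lam -> 0 < t ->
  V t x <= gaussian_barrier t x.
Proof.
  intros HV Hl Ht; pose proof gaussian_mass_pos; pose proof gaussian_amplitude_pos.
  set (k := gaussian_amplitude * gaussian_mass / lam).
  assert (Hk : 0 < k) by (apply Rdiv_lt_0_compat; nra).
  pose proof (Rmin_l t (k ^ 2)); pose proof (Rmin_r t (k ^ 2)).
  assert (0 < Rmin t (k ^ 2)) by (apply Rmin_glb_lt; [exact Ht|apply pow_lt, Hk]).
  apply (absorption_comparison 0 V gaussian_barrier (Rmin t (k ^ 2)) t).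
  - apply solution_sub, HV.
  - apply gaussian_barrier_supersolution.
  - intros; left; apply gaussian_barrier_pos.
  - lra.
  - intros y; eapply Rle_trans; [apply (source_le_heat V lam HV); lra|].
    apply heat_le_gaussian_barrier; assumption.
Qed.

(** * The limit profile *)

Lemma is_lim_seq_Rabs_lt (u : nat -> R) (l eps : R) : is_lim_seq u l -> 0 < eps ->
  exists N, forall n, (N <= n)%nat -> Rabs (u n - l) < eps.
Proof. intros H Heps; exact (proj2 (is_lim_seq_spec u l) H (mkposreal eps Heps)). Qed.

Section Equilipschitz.
Variables (f : nat -> R -> R) (g : R -> R) (r : posreal) (L : R).
Hypothesis Hlip : forall n x y, Rabs x <= r -> Rabs y <= r ->
  Rabs (f n x - f n y) <= L * Rabs (x - y).
Hypothesis Hlim : forall x, Rabs x <= r -> is_lim_seq (fun n => f n x) (g x).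

Lemma equilipschitz_limit x y : Rabs x <= r -> Rabs y <= r -> Rabs (g x - g y) <= L * Rabs (x - y).
Proof.
  intros Hx Hy.
  apply (is_lim_seq_le (fun n => Rabs (f n x - f n y)) (fun _ => L * Rabs (x - y))
    (Finite _) (Finite _)); [intros; apply Hlip; assumption| |apply is_lim_seq_const].
  apply (is_lim_seq_abs _ (Finite _)), is_lim_seq_minus'; apply Hlim; assumption.
Qed.

Lemma equilipschitz_constant_nonneg : 0 <= L.
Proof.
  pose proof (cond_pos r); pose proof (Rabs_pos (g 0 - g r)).
  pose proof (equilipschitz_limit 0 r ltac:(rewrite Rabs_R0; lra)
    ltac:(rewrite Rabs_pos_eq; lra)) as Hg.
  rewrite Rminus_0_l, Rabs_Ropp, (Rabs_pos_eq r) in Hg by lra; nra.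
Qed.

Lemma equilipschitz_close eps h z : 0 < eps -> L * h <= eps / 4 -> Rabs z <= r ->
  exists N, forall n y, (N <= n)%nat -> Rabs y <= r -> z <= y <= z + h -> Rabs (g y - f n y) < eps.
Proof.
  intros Heps HLh Hz; pose proof equilipschitz_constant_nonneg.
  destruct (is_lim_seq_Rabs_lt _ _ (eps / 2) (Hlim z Hz)) as [N HN]; [lra|].
  exists N; intros n y Hn Hy Hzy; specialize (HN n Hn).
  pose proof (Hlip n y z Hy Hz) as Hf; pose proof (equilipschitz_limit y z Hy Hz) as Hg.
  rewrite (Rabs_pos_eq (y - z)) in Hf, Hg by lra.
  assert (L * (y - z) <= L * h) by (apply Rmult_le_compat_l; lra).
  apply Rabs_def2 in HN; apply Rabs_le_between in Hf; apply Rabs_le_between in Hg.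
  apply Rabs_def1; lra.
Qed.

Lemma equilipschitz_close_steps eps h k : 0 < eps -> 0 < h -> L * h <= eps / 4 ->
  exists N, forall n y, (N <= n)%nat -> Rabs y <= r -> y <= - r + INR k * h ->
    Rabs (g y - f n y) < eps.
Proof.
  intros Heps Hh HLh; pose proof (cond_pos r).
  induction k as [|k [N1 IH]].
  - destruct (equilipschitz_close eps h (- r) Heps HLh) as [N HN];
      [rewrite Rabs_Ropp, Rabs_pos_eq; lra|].
    exists N; intros n y Hn Hy Hyk; simpl in Hyk; apply HN; auto.
    apply Rabs_le_between in Hy; lra.
  - pose proof (pos_INR k); rewrite S_INR; destruct (Rle_dec (- r + INR k * h) r) as [hk|hk].
    + destruct (equilipschitz_close eps h (- r + INR k * h) Heps HLh) as [N2 HN];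
        [apply Rabs_le; nra|].
      exists (Nat.max N1 N2); intros n y Hn Hy Hyk.
      destruct (Rle_dec y (- r + INR k * h)); [apply IH|apply HN]; auto; try lia; lra.
    + exists N1; intros n y Hn Hy _; apply IH; auto; apply Rabs_le_between in Hy; lra.
Qed.

Lemma CVU_of_equilipschitz : CVU f g 0 r.
Proof.
  intros eps Heps; pose proof equilipschitz_constant_nonneg.
  set (h := eps / (4 * (L + 1))); assert (Hh : 0 < h) by (apply Rdiv_lt_0_compat; lra).
  assert (HLh : L * h <= eps / 4).
  { replace (eps / 4) with ((L + 1) * h) by (unfold h; field; lra); nra. }
  destruct (INR_unbounded (2 * r / h)) as [k Hk]; apply Rlt_div_l in Hk; [|exact Hh].
  destruct (equilipschitz_close_steps eps h k Heps Hh HLh) as [N HN]; exists N; intros n y Hn Hy.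
  unfold Boule in Hy; rewrite Rminus_0_r in Hy; apply HN; auto; [lra|].
  apply Rabs_def2 in Hy; lra.
Qed.
End Equilipschitz.

Lemma is_derive_parabolic_dilation f ft fx fxx x : is_C12 (Rlt 0) f ft fx fxx ->
  is_derive (fun s => s * f s (sqrt s * x)) 1 (f 1 x + ft 1 x + / 2 * x * fx 1 x).
Proof.
  intros HC.
  assert (Df : filterdiff (fun u : R * R => f (fst u) (snd u)) (locally (1, x))
     (fun u => plus (scal (fst u) (ft 1 x)) (scal (snd u) (fx 1 x)))).
  { apply (is_derive_filterdiff f 1 x ft (fx 1 x)).
    - exists (mkposreal 1 Rlt_0_1); intros [u v] [Hu _]; apply (C12_t HC).
      change (Rabs (u - 1) < 1) in Hu; apply Rabs_def2 in Hu; simpl; lra.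
    - apply (C12_x HC), Rlt_0_1.
    - apply (continuity_2d_pt_filterlim ft 1 x), (C12_continuity_t HC), Rlt_0_1. }
  assert (Dsqrt : is_derive (fun s => sqrt s * x) 1 (/ 2 * x))
    by (auto_derive; [lra|rewrite sqrt_1; field]).
  assert (Dcomp : is_derive (fun s => f s (sqrt s * x)) 1 (ft 1 x + / 2 * x * fx 1 x)).
  { eapply filterdiff_ext_lin.
    - apply (filterdiff_comp'_2 (fun s : R => s) (fun s => sqrt s * x) f 1 (fun y => y)
        (fun y => scal y (/ 2 * x)) (fun u v => plus (scal u (ft 1 x)) (scal v (fx 1 x)))).
      + apply filterdiff_id.
      + exact Dsqrt.
      + rewrite sqrt_1, Rmult_1_l; exact Df.
    - intros y; unfold plus, scal; simpl; unfold mult; simpl; in_R; ring. }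
  evar_last; [apply is_derive_Rmult; [apply is_derive_Rid|exact Dcomp]|].
  in_R; rewrite sqrt_1, !Rmult_1_l; ring.
Qed.

Section Limit.
Variables (V : R -> R -> R -> R) (Vinf : R -> R -> R).
Hypothesis HV : forall lam, 0 < lam -> source_solution (V lam) lam.
Hypothesis hVinf : forall t x, 0 < t -> is_lim (fun lam => V lam t x) p_infty (Vinf t x).

Lemma family_monotone l1 l2 t x : 0 < l1 <= l2 -> 0 < t -> V l1 t x <= V l2 t x.
Proof. intros Hl Ht; apply (source_monotone _ _ l1 l2); try apply HV; lra. Qed.

Lemma family_le_limit lam t x : 0 < lam -> 0 < t -> V lam t x <= Vinf t x.
Proof.
  intros Hl Ht.
  apply (is_lim_le_loc (fun _ => V lam t x) (fun l => V l t x) p_infty (Finite _) (Finite _));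
    [|apply is_lim_const|apply hVinf, Ht].
  exists lam; intros l Hll; apply family_monotone; lra.
Qed.

Lemma limit_le t x B : 0 < t -> (forall lam, 0 < lam -> V lam t x <= B) -> Vinf t x <= B.
Proof.
  intros Ht HB.
  apply (is_lim_le_loc (fun l => V l t x) (fun _ => B) p_infty (Finite _) (Finite _));
    [|apply hVinf, Ht|apply is_lim_const].
  exists 0; exact HB.
Qed.

Lemma family_lim_seq (u : nat -> R) t x : 0 < t -> (forall n, INR n <= u n) ->
  is_lim_seq (fun n => V (u n) t x) (Vinf t x).
Proof.
  intros Ht Hu; apply (is_lim_comp_seq (fun lam => V lam t x) u p_infty); auto.
  - exists O; discriminate.
  - apply (is_lim_seq_le_p_loc INR); [exists O; auto|apply is_lim_seq_INR].
Qed.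

Lemma family_dilation lam s t x : 0 < lam -> s <> 0 -> 0 < t ->
  s ^ 2 * V lam (s ^ 2 * t) (s * x) = V (Rabs s * lam) t x.
Proof.
  intros Hl Hs Ht.
  assert (0 < Rabs s * lam) by (apply Rmult_lt_0_compat; [apply Rabs_pos_lt|]; assumption).
  apply (source_unique (fun t x => s ^ 2 * V lam (s ^ 2 * t) (s * x)) _ (Rabs s * lam)); try lra;
    [apply source_dilation|]; auto.
Qed.

Lemma limit_dilation s t x : s <> 0 -> 0 < t -> s ^ 2 * Vinf (s ^ 2 * t) (s * x) = Vinf t x.
Proof.
  intros Hs Ht; pose proof (pow2_gt_0 s Hs) as Hs2; pose proof (Rabs_pos_lt s Hs) as Has.
  assert (Hst : 0 < s ^ 2 * t) by (apply Rmult_lt_0_compat; lra).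
  apply Rle_antisym.
  - apply (Rmult_le_reg_l (/ s ^ 2)); [apply Rinv_0_lt_compat, Hs2|].
    rewrite <- Rmult_assoc, Rinv_l, Rmult_1_l by lra; apply limit_le; [exact Hst|]; intros lam Hl.
    apply (Rmult_le_reg_l (s ^ 2)); [exact Hs2|].
    rewrite <- Rmult_assoc, Rinv_r, Rmult_1_l, family_dilation by (assumption || lra).
    apply family_le_limit; [nra|exact Ht].
  - apply limit_le; [exact Ht|]; intros lam Hl.
    replace lam with (Rabs s * (lam / Rabs s)) by (field; lra).
    assert (0 < lam / Rabs s) by (apply Rdiv_lt_0_compat; assumption).
    rewrite <- family_dilation by assumption.
    apply Rmult_le_compat_l; [lra|apply family_le_limit; assumption].
Qed.

Lemma limit_selfsim t x : 0 < t -> Vinf t x = selfsim 1 (Vinf 1) t x.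
Proof.
  intros Ht; pose proof (sqrt_lt_R0 t Ht) as Hs; unfold selfsim; rewrite Rpower_opp_1 by exact Ht.
  rewrite <- (limit_dilation (sqrt t) 1 (x / sqrt t)), pow2_sqrt, Rmult_1_r by lra.
  replace (sqrt t * (x / sqrt t)) with x by (field; lra); field; lra.
Qed.

Lemma family_even lam t x : 0 < lam -> 0 < t -> V lam t (- x) = V lam t x.
Proof.
  intros Hl Ht; pose proof (family_dilation lam (-1) t x Hl ltac:(lra) Ht) as E.
  replace ((-1) ^ 2) with 1 in E by ring.
  replace (Rabs (-1)) with 1 in E by (rewrite Rabs_left; lra).
  rewrite !Rmult_1_l in E.
  rewrite <- E; f_equal; ring.
Qed.

Lemma limit_even t x : 0 < t -> Vinf t (- x) = Vinf t x.
Proof.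
  intros Ht; pose proof (limit_dilation (-1) t x ltac:(lra) Ht) as E.
  replace ((-1) ^ 2) with 1 in E by ring; rewrite !Rmult_1_l in E.
  rewrite <- E; f_equal; ring.
Qed.

Lemma gaussian_barrier_1 x : gaussian_barrier 1 x = gaussian gaussian_amplitude (7 / 16) x.
Proof.
  unfold gaussian_barrier, selfsim; rewrite Rpower_opp_1, Rinv_1, sqrt_1, Rmult_1_l by lra.
  f_equal; field.
Qed.

Lemma limit_profile_upper x : Vinf 1 x <= gaussian gaussian_amplitude (7 / 16) x.
Proof.
  rewrite <- gaussian_barrier_1; apply limit_le; [lra|]; intros lam Hl.
  apply (source_upper _ lam); auto; lra.
Qed.

Lemma limit_profile_lower x : exp (- / gaussian_mass) * heat 1 x <= Vinf 1 x.
Proof.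
  eapply Rle_trans; [|apply (family_le_limit 1); lra].
  eapply Rle_trans; [|apply (source_lower _ 1); [apply HV|..]; lra].
  rewrite sqrt_1, Rmult_1_l, Rmult_1_r; unfold Rdiv; rewrite Rmult_1_l; apply Rle_refl.
Qed.

Lemma limit_profile_bounds x : 0 < Vinf 1 x <= gaussian_amplitude.
Proof.
  pose proof gaussian_amplitude_pos; split.
  - eapply Rlt_le_trans; [|apply limit_profile_lower].
    apply Rmult_lt_0_compat; [apply exp_pos|apply heat_pos].
  - eapply Rle_trans; [apply limit_profile_upper|apply gaussian_le; lra].
Qed.

Lemma family_profile_bounds lam x : 0 < lam -> 0 <= V lam 1 x <= gaussian_amplitude.
Proof.
  intros Hl; split; [apply (HV lam Hl); lra|].
  eapply Rle_trans; [apply family_le_limit; lra|apply limit_profile_bounds].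
Qed.

Lemma family_parabolic_dilation lam s x : 0 < lam -> 0 < s ->
  s * V lam s (sqrt s * x) = V (sqrt s * lam) 1 x.
Proof.
  intros Hl Hs; pose proof (sqrt_lt_R0 s Hs).
  pose proof (family_dilation lam (sqrt s) 1 x Hl ltac:(lra) ltac:(lra)) as E.
  rewrite pow2_sqrt, Rmult_1_r, Rabs_pos_eq in E by lra; exact E.
Qed.

Lemma family_increment_le lam w x : 0 < lam -> 1 <= w ->
  V (w * lam) 1 x - V lam 1 x <= 2 * (w - 1) * (V lam 1 x - V (lam / 2) 1 x).
Proof.
  intros Hl Hw; set (th := 1 - / 2 / (w - / 2)).
  assert (Hth : 0 < 1 - th <= 1).
  { replace (1 - th) with (/ 2 / (w - / 2)) by (unfold th; ring).
    split; [apply Rdiv_lt_0_compat; lra|apply Rle_div_l; lra]. }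
  assert (Hmix : lam = th * (lam / 2) + (1 - th) * (w * lam)) by (unfold th; field; lra).
  assert (Hc : th * V (lam / 2) 1 x + (1 - th) * V (w * lam) 1 x <= V lam 1 x).
  { apply (source_concave _ _ _ (lam / 2) (w * lam)); try apply HV; try nra.
    rewrite <- Hmix; apply HV, Hl. }
  apply (Rmult_le_reg_l (1 - th)); [lra|].
  replace ((1 - th) * (2 * (w - 1) * (V lam 1 x - V (lam / 2) 1 x)))
    with (th * (V lam 1 x - V (lam / 2) 1 x)) by (unfold th; field; lra).
  lra.
Qed.

Lemma dilation_rate_bounds lam Vt Vx Vxx x : 0 < lam -> is_C12 (Rlt 0) (V lam) Vt Vx Vxx ->
  0 <= V lam 1 x + Vt 1 x + / 2 * x * Vx 1 x <= V lam 1 x - V (lam / 2) 1 x.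
Proof.
  intros Hl H; pose proof (is_derive_parabolic_dilation _ _ _ _ x H) as D.
  assert (Hsqrt : forall s, 1 <= s -> 1 <= sqrt s)
    by (intros; rewrite <- sqrt_1; apply sqrt_le_1_alt; assumption).
  split.
  - apply (derive_right_nonneg _ _ _ D); intros s Hs; specialize (Hsqrt s Hs).
    rewrite !family_parabolic_dilation, sqrt_1, Rmult_1_l by lra.
    apply family_monotone; [split; nra|lra].
  - set (dV := V lam 1 x - V (lam / 2) 1 x); apply Rminus_le_0.
    apply (derive_right_nonneg (fun s => 2 * dV * sqrt s - s * V lam s (sqrt s * x)) 1).
    + apply is_derive_Rminus; [auto_derive; [lra|rewrite sqrt_1; field]|exact D].
    + intros s Hs; specialize (Hsqrt s Hs).
      rewrite !family_parabolic_dilation, sqrt_1, Rmult_1_l by lra.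
      pose proof (family_increment_le lam (sqrt s) x Hl Hsqrt) as Hinc; fold dV in Hinc; lra.
Qed.

Definition flux (u : R -> R) (x : R) : R := exp (x ^ 2 / 2) * Derive u x.

(* The remainder [r] is twice the logarithmic [lam]-derivative of [V lam 1 x]: it is nonnegative
   by monotonicity and controlled by an increment by concavity. *)
Lemma family_profile_equation lam : 0 < lam -> exists r : R -> R,
  (forall x, is_derive (V lam 1) x (exp (- (x ^ 2 / 2)) * flux (V lam 1) x)) /\
  (forall x, is_derive (flux (V lam 1)) x
     (exp (x ^ 2 / 2) * (V lam 1 x ^ 2 - 2 * V lam 1 x + r x))) /\
  flux (V lam 1) 0 = 0 /\
  (forall x, 0 <= r x <= 2 * (V lam 1 x - V (lam / 2) 1 x)).
Proof.
  intros Hl; destruct (HV lam Hl) as [(Vt & Vx & Vxx & H & E) _].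
  assert (D : forall x, is_derive (V lam 1) x (Vx 1 x)) by (intros; apply (C12_x H); lra).
  assert (ED : forall x, Derive (V lam 1) x = Vx 1 x) by (intros; apply is_derive_unique, D).
  exists (fun x => 2 * (V lam 1 x + Vt 1 x + / 2 * x * Vx 1 x)); split; [|split; [|split]].
  - intros x; unfold flux; rewrite <- Rmult_assoc, <- exp_plus, ED.
    replace (- (x ^ 2 / 2) + x ^ 2 / 2) with 0 by ring; rewrite exp_0, Rmult_1_l; apply D.
  - intros x; apply (is_derive_ext (fun y => exp (y ^ 2 / 2) * Vx 1 y)).
    + intros y; unfold flux; rewrite ED; reflexivity.
    + evar_last; [apply is_derive_Rmult; [|apply (C12_xx H); lra]|].
      * apply is_derive_Rexp, is_derive_Rmult; auto with calc.
      * rewrite (E 1 x) by lra; unfold half; simpl; in_R; field.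
  - enough (Vx 1 0 = - Vx 1 0) by (unfold flux; rewrite ED; nra).
    rewrite <- ED at 1; apply is_derive_unique.
    apply (is_derive_ext (fun y => V lam 1 (- y))); [intros; apply family_even; lra|].
    apply is_derive_reflect; rewrite Ropp_0; apply D.
  - intros x; pose proof (dilation_rate_bounds lam Vt Vx Vxx x Hl H); lra.
Qed.

Lemma exp_half_sqr_le X x : Rabs x <= X -> exp (x ^ 2 / 2) <= exp (X ^ 2 / 2).
Proof. intros Hx; apply exp_le_exp; pose proof (pow_maj_Rabs X x 2 Hx); lra. Qed.

Lemma exp_opp_half_sqr_le_1 x : 0 < exp (- (x ^ 2 / 2)) <= 1.
Proof. split; [apply exp_pos|apply exp_le_1; pose proof (pow2_ge_0 x); lra]. Qed.

Lemma is_derive_exp_opp_half_sqr x :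
  is_derive (fun x => exp (- (x ^ 2 / 2))) x (- x * exp (- (x ^ 2 / 2))).
Proof. auto_derive; [exact I|unfold Rdiv; simpl; field]. Qed.

Lemma family_lipschitz X : 0 <= X -> exists L, forall lam x y, 0 < lam ->
  Rabs x <= X -> Rabs y <= X -> Rabs (V lam 1 x - V lam 1 y) <= L * Rabs (x - y).
Proof.
  intros HX; pose proof gaussian_amplitude_pos as HA; set (A := gaussian_amplitude); fold A in HA.
  set (K := exp (X ^ 2 / 2) * (A ^ 2 + 4 * A)); exists (K * X); intros lam x y Hl Hx Hy.
  destruct (family_profile_equation lam Hl) as (r & D & D' & flux0 & Hr).
  assert (Hflux : forall x, Rabs x <= X -> Rabs (flux (V lam 1) x) <= K * X).
  { apply (derive_bounded_from_0 _ _ X K flux0 (fun x _ => D' x)); intros z Hz.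
    pose proof (family_profile_bounds lam z Hl) as Hv; specialize (Hr z); fold A in Hv.
    pose proof (family_profile_bounds (lam / 2) z ltac:(lra)).
    rewrite Rabs_mult, (Rabs_pos_eq (exp _)) by (left; apply exp_pos).
    apply Rmult_le_compat; [left; apply exp_pos|apply Rabs_pos|apply exp_half_sqr_le, Hz|].
    apply Rabs_le; nra. }
  apply Rabs_le_between in Hx; apply Rabs_le_between in Hy.
  apply (derive_bounded_lipschitz _ _ (- X) X _ (fun z _ => D z)); auto.
  intros z Hz; specialize (Hflux z ltac:(apply Rabs_le; exact Hz)).
  rewrite Rabs_mult, (Rabs_pos_eq (exp _)) by (left; apply exp_pos).
  pose proof (exp_opp_half_sqr_le_1 z); pose proof (Rabs_pos (flux (V lam 1) z)); nra.
Qed.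

Lemma family_profile_CVU (r : posreal) : CVU (fun n => V (INR n + 1) 1) (Vinf 1) 0 r.
Proof.
  destruct (family_lipschitz r (Rlt_le _ _ (cond_pos r))) as [L HL].
  apply (CVU_of_equilipschitz _ _ r L).
  - intros n x y Hx Hy; apply HL; auto; pose proof (pos_INR n); lra.
  - intros x _; apply family_lim_seq; [lra|].
    intros n; lra.
Qed.

Lemma continuous_limit_profile x : continuous (Vinf 1) x.
Proof.
  set (r := mkposreal (Rabs x + 1) ltac:(pose proof (Rabs_pos x); lra)).
  apply continuity_pt_filterlim, (CVU_continuity _ _ 0 r (family_profile_CVU r)).
  - intros n y _; pose proof (pos_INR n).
    apply continuity_pt_filterlim, (continuous_source _ (INR n + 1)); [apply HV|]; lra.
  - unfold Boule; simpl; rewrite Rminus_0_r; lra.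
Qed.

Definition limit_flux (x : R) : R :=
  RInt (fun y => exp (y ^ 2 / 2) * (Vinf 1 y ^ 2 - 2 * Vinf 1 y)) 0 x.
Definition limit_profile' (x : R) : R := exp (- (x ^ 2 / 2)) * limit_flux x.
Definition limit_profile'' (x : R) : R := - x * limit_profile' x + Vinf 1 x ^ 2 - 2 * Vinf 1 x.

Lemma is_derive_limit_flux x :
  is_derive limit_flux x (exp (x ^ 2 / 2) * (Vinf 1 x ^ 2 - 2 * Vinf 1 x)).
Proof.
  apply (is_derive_RInt_from_0 (fun y => exp (y ^ 2 / 2) * (Vinf 1 y ^ 2 - 2 * Vinf 1 y))).
  pose proof continuous_limit_profile; intros y; unfold Rdiv; auto 20 with calc.
Qed.

Lemma is_derive_limit_profile' x : is_derive limit_profile' x (limit_profile'' x).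
Proof.
  pose proof (is_derive_exp_opp_half_sqr x); pose proof (is_derive_limit_flux x).
  unfold limit_profile'', limit_profile'; is_derive_calc.
  rewrite exp_Ropp; pose proof (exp_pos (x ^ 2 / 2)); field; lra.
Qed.

Lemma continuous_limit_profile'' x : continuous limit_profile'' x.
Proof.
  pose proof continuous_limit_profile.
  pose proof (continuous_is_derive_fun _ _ is_derive_limit_profile').
  unfold limit_profile''; auto 20 with calc.
Qed.

Lemma family_flux_CVU (r : posreal) :
  CVU (fun n => flux (V (2 * (INR n + 1)) 1)) limit_flux 0 r.
Proof.
  pose proof gaussian_amplitude_pos as HA; set (A := gaussian_amplitude); fold A in HA.
  set (K := exp (r ^ 2 / 2) * (2 * A + 4)).
  assert (HK : 0 < K) by (apply Rmult_lt_0_compat; [apply exp_pos|lra]).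
  pose proof (cond_pos r) as Hr0; intros eps Heps.
  set (eta := eps / (2 * (K * r))).
  assert (Heta : 0 < eta).
  { assert (0 < K * r) by (apply Rmult_lt_0_compat; lra).
    apply Rdiv_lt_0_compat; lra. }
  set (r1 := mkposreal (r + 1) ltac:(lra)).
  destruct (family_profile_CVU r1 eta Heta) as [N HN]; exists N; intros n x Hn Hx.
  unfold Boule in Hx; rewrite Rminus_0_r in Hx.
  set (lam := 2 * (INR n + 1)); pose proof (pos_INR n) as Hn0.
  assert (Hl : 0 < lam) by (unfold lam; lra).
  destruct (family_profile_equation lam Hl) as (q & _ & D' & flux0 & Hq).
  apply Rle_lt_trans with (K * eta * r);
    [|replace (K * eta * r) with (eps / 2) by (unfold eta; field; lra); lra].
  apply (derive_bounded_from_0 (fun x => limit_flux x - flux (V lam 1) x) _ r (K * eta)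
    ltac:(unfold limit_flux; rewrite flux0, RInt_point_0; ring)
    (fun z _ => is_derive_Rminus _ _ _ _ _ (is_derive_limit_flux z) (D' z))); [|lra].
  intros z Hz; specialize (Hq z).
  assert (Hclose : Vinf 1 z - V (lam / 2) 1 z < eta).
  { specialize (HN n z Hn); replace (INR n + 1) with (lam / 2) in HN by (unfold lam; field).
    eapply Rle_lt_trans; [apply Rle_abs|apply HN].
    unfold Boule, r1; simpl; rewrite Rminus_0_r; lra. }
  pose proof (family_profile_bounds lam z Hl) as Hv; pose proof (limit_profile_bounds z) as Hw.
  fold A in Hv, Hw.
  pose proof (family_le_limit lam 1 z Hl Rlt_0_1).
  rewrite <- Rmult_minus_distr_l, Rabs_mult, (Rabs_pos_eq (exp _)) by (left; apply exp_pos).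
  unfold K; rewrite Rmult_assoc.
  apply Rmult_le_compat; [left; apply exp_pos|apply Rabs_pos|apply exp_half_sqr_le, Hz|].
  replace (Vinf 1 z ^ 2 - 2 * Vinf 1 z - (V lam 1 z ^ 2 - 2 * V lam 1 z + q z))
    with ((Vinf 1 z - V lam 1 z) * (Vinf 1 z + V lam 1 z - 2) - q z) by ring.
  assert (Hd : 0 <= Vinf 1 z - V lam 1 z <= eta) by lra.
  assert ((Vinf 1 z - V lam 1 z) * (Vinf 1 z + V lam 1 z) <= eta * (2 * A))
    by (apply Rmult_le_compat; lra).
  assert (0 <= (Vinf 1 z - V lam 1 z) * (Vinf 1 z + V lam 1 z)) by (apply Rmult_le_pos; lra).
  apply Rabs_le; lra.
Qed.

Lemma is_derive_limit_profile x : is_derive (Vinf 1) x (limit_profile' x).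
Proof.
  set (r := mkposreal (Rabs x + 1) ltac:(pose proof (Rabs_pos x); lra)); apply is_derive_Reals.
  apply (CVU_derivable (fun n => V (2 * (INR n + 1)) 1)
    (fun n y => exp (- (y ^ 2 / 2)) * flux (V (2 * (INR n + 1)) 1) y) _ _ 0 r).
  - intros eps Heps; destruct (family_flux_CVU r eps Heps) as [N HN]; exists N; intros n y Hn Hy.
    unfold limit_profile'; rewrite <- Rmult_minus_distr_l, Rabs_mult.
    specialize (HN n y Hn Hy); pose proof (exp_opp_half_sqr_le_1 y).
    rewrite (Rabs_pos_eq (exp _)) by lra.
    pose proof (Rabs_pos (limit_flux y - flux (V (2 * (INR n + 1)) 1) y)); nra.
  - intros y _; apply is_lim_seq_Reals, family_lim_seq; [lra|].
    intros m; pose proof (pos_INR m); lra.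
  - intros n y _; pose proof (pos_INR n).
    destruct (family_profile_equation (2 * (INR n + 1)) ltac:(lra)) as (q & D & _).
    apply is_derive_Reals, D.
  - unfold Boule; simpl; rewrite Rminus_0_r; lra.
Qed.

Lemma limit_solution : solution (Rlt 0) (half Vinf) Vinf.
Proof.
  apply (solution_ext _ (half (selfsim 1 (Vinf 1))) _ (selfsim 1 (Vinf 1))); [apply open_gt|..].
  - intros t x Ht; unfold half; rewrite <- limit_selfsim by exact Ht; reflexivity.
  - intros t x Ht; symmetry; apply limit_selfsim, Ht.
  - apply (selfsim_solution _ _ (fun y => / 2 * Vinf 1 y) _ limit_profile' limit_profile'').
    + intros t x Ht; unfold half, selfsim; rewrite Rpower_opp_1 by exact Ht; unfold Rdiv; ring.
    + exact is_derive_limit_profile.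
    + exact is_derive_limit_profile'.
    + exact continuous_limit_profile''.
    + intros y; unfold profile_op, limit_profile''; field.
Qed.
End Limit.

(** * Sturm-Liouville systems *)

Lemma CVN_r_of_ex_series (f : nat -> R -> R) (c : nat -> R) (r : posreal) : ex_series c ->
  (forall n x, Rabs x < r -> Rabs (f n x) <= c n) -> CVN_r f r.
Proof.
  intros Hc Hf.
  assert (Hc0 : forall n, 0 <= c n).
  { intros n; eapply Rle_trans; [apply Rabs_pos|apply (Hf n 0)]; rewrite Rabs_R0; apply cond_pos. }
  exists c, (Series c); split.
  - apply is_lim_seq_Reals; apply (is_lim_seq_ext (sum_n c)).
    + intros n; rewrite sum_n_Reals; apply sum_eq; intros i _; symmetry; apply Rabs_pos_eq, Hc0.
    + apply Series_correct, Hc.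
  - intros n y Hy; apply Hf; unfold Boule in Hy; rewrite Rminus_0_r in Hy; exact Hy.
Qed.

Lemma is_derive_Series (f f' : nat -> R -> R) (c : nat -> R) (r : posreal) : ex_series c ->
  (forall n x, Rabs x < r -> is_derive (f n) x (f' n x)) ->
  (forall n x, Rabs x < r -> Rabs (f n x) <= c n) ->
  (forall n x, Rabs x < r -> Rabs (f' n x) <= c n) ->
  forall x, Rabs x < r ->
  is_derive (fun x => Series (fun n => f n x)) x (Series (fun n => f' n x)).
Proof.
  intros Hc Hd Hf Hf' x Hx.
  destruct (CVN_CVU_r f' r (CVN_r_of_ex_series f' c r Hc Hf') x Hx) as [e He].
  assert (Hsmall : 0 < Rmin e (r - Rabs x)) by (apply Rmin_glb_lt; [apply cond_pos|lra]).
  set (d := mkposreal _ Hsmall).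
  assert (Hin : forall y, Boule x d y -> Boule x e y /\ Rabs y < r).
  { intros y Hy; unfold Boule in *; simpl in Hy.
    pose proof (Rmin_l e (r - Rabs x)); pose proof (Rmin_r e (r - Rabs x)).
    pose proof (Rabs_triang_inv y x); split; lra. }
  apply is_derive_Reals.
  apply (CVU_derivable (fun n => SP f n) (fun n => SP f' n)
    (fun x => Series (fun n => f n x)) (fun x => Series (fun n => f' n x)) x d).
  - intros eps Heps; destruct (He eps Heps) as [N HN]; exists N; intros n y Hn Hy.
    apply HN; [exact Hn|apply Hin, Hy].
  - intros y Hy; apply is_lim_seq_Reals; apply (is_lim_seq_ext (sum_n (fun n => f n y))).
    + intros n; apply sum_n_Reals.
    + apply (Series_correct (fun n => f n y)), (ex_series_le (V := R_CompleteNormedModule) _ c);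
        [intros n; apply Hf, Hin, Hy|exact Hc].
  - intros n y Hy; induction n as [|n IH]; [apply is_derive_Reals, Hd, Hin, Hy|].
    apply (derivable_pt_lim_plus (fun y => SP f n y) (f (S n))); [exact IH|].
    apply is_derive_Reals, Hd, Hin, Hy.
  - unfold Boule, d; rewrite Rminus_diag, Rabs_R0; exact Hsmall.
Qed.

Lemma RInt_exp_bound (f : R -> R) X A k : (forall y, continuous f y) -> 0 < k ->
  (forall x, Rabs x <= X -> Rabs (f x) <= A * exp (k * Rabs x)) ->
  forall x, Rabs x <= X -> Rabs (RInt f 0 x) <= A / k * exp (k * Rabs x).
Proof.
  intros cf Hk Hf.
  enough (Hpos : forall g : R -> R, (forall y, continuous g y) ->
    (forall x, Rabs x <= X -> Rabs (g x) <= A * exp (k * Rabs x)) ->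
    forall x, 0 <= x <= X -> Rabs (RInt g 0 x) <= A / k * exp (k * x)).
  { intros x Hx; pose proof (Rabs_pos x); destruct (Rle_dec 0 x) as [h|h].
    - rewrite (Rabs_pos_eq x) in * by lra; apply Hpos; auto; lra.
    - rewrite (Rabs_left x) in * by lra.
      rewrite RInt_Rswap, Rabs_Ropp by exact cf.
      replace (RInt f x 0) with (RInt (fun y => f (- y)) 0 (- x))
        by (rewrite RInt_reflect, Ropp_involutive, Ropp_0 by exact cf; reflexivity).
      apply Hpos; [| |lra].
      + intros; apply (continuous_comp_R (fun y => - y)); auto with calc.
      + intros y Hy; rewrite <- (Rabs_Ropp y); apply Hf; rewrite Rabs_Ropp; exact Hy. }
  clear f cf Hf; intros f cf Hf x Hx.
  assert (HA : 0 <= A).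
  { pose proof (Rabs_pos (f 0)); specialize (Hf 0 ltac:(rewrite Rabs_R0; lra)).
    rewrite Rabs_R0, Rmult_0_r, exp_0 in Hf; lra. }
  eapply Rle_trans; [apply abs_RInt_le; auto with calc; lra|].
  apply Rle_trans with (RInt (fun y => A * exp (k * y)) 0 x).
  - apply RInt_le;
      [lra|apply ex_RInt_Rcontinuous; intros; apply continuous_Rabs_comp, cf|auto with calc|].
    intros y Hy; specialize (Hf y); rewrite (Rabs_pos_eq y) in Hf by lra; apply Hf; lra.
  - rewrite (RInt_is_derive (fun y => A / k * exp (k * y))).
    + rewrite Rmult_0_r, exp_0; assert (0 <= A / k) by (apply Rdiv_le_0_compat; lra); lra.
    + intros y; auto_derive; [exact I|field; lra].
    + auto with calc.
Qed.

(* The Sturm-Liouville equation [(u' / a)' = b u], with [v = u' / a]. *)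
Definition sturm_liouville (a b u v : R -> R) : Prop :=
  (forall x, is_derive u x (a x * v x)) /\ (forall x, is_derive v x (b x * u x)).

(* The terms of the Picard series of [u]; those of [v] are obtained by exchanging the data. *)
Fixpoint picard_term (a b : R -> R) (c0 c1 : R) (n : nat) (x : R) : R :=
  match n with
  | O => c0
  | S n => RInt (fun y => a y * picard_term b a c1 c0 n y) 0 x
  end.

Definition picard_term' (a b : R -> R) (c0 c1 : R) (n : nat) (x : R) : R :=
  match n with O => 0 | S n => a x * picard_term b a c1 c0 n x end.

Lemma continuous_picard_term n : forall a b c0 c1, (forall x, continuous a x) ->
  (forall x, continuous b x) -> forall x, continuous (picard_term a b c0 c1 n) x.
Proof.
  induction n as [|n IH]; intros a b c0 c1 ca cb x; [apply continuous_Rconst|].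
  eapply continuous_is_derive, (is_derive_RInt_from_0 (fun y => a y * picard_term b a c1 c0 n y)).
  auto with calc.
Qed.

Lemma is_derive_picard_term a b c0 c1 n x : (forall x, continuous a x) ->
  (forall x, continuous b x) -> is_derive (picard_term a b c0 c1 n) x (picard_term' a b c0 c1 n x).
Proof.
  intros ca cb; destruct n as [|n]; [apply is_derive_Rconst|].
  apply (is_derive_RInt_from_0 (fun y => a y * picard_term b a c1 c0 n y)).
  auto using continuous_picard_term with calc.
Qed.

Lemma picard_term_bound X K n : 0 < K -> forall a b c0 c1,
  (forall x, continuous a x) -> (forall x, continuous b x) ->
  (forall x, Rabs x <= X -> Rabs (a x) <= K) -> (forall x, Rabs x <= X -> Rabs (b x) <= K) ->
  forall x, Rabs x <= X ->
  Rabs (picard_term a b c0 c1 n x) <= (Rabs c0 + Rabs c1) * (/ 2) ^ n * exp (2 * K * Rabs x).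
Proof.
  intros HK; induction n as [|n IH]; intros a b c0 c1 ca cb Ha Hb x Hx;
    pose proof (Rabs_pos c0); pose proof (Rabs_pos c1).
  - pose proof (one_le_exp (2 * K * Rabs x) ltac:(pose proof (Rabs_pos x); nra)); simpl; nra.
  - replace ((Rabs c0 + Rabs c1) * (/ 2) ^ S n)
      with (K * ((Rabs c1 + Rabs c0) * (/ 2) ^ n) / (2 * K)) by (simpl; field; lra).
    revert x Hx; apply (RInt_exp_bound (fun y => a y * picard_term b a c1 c0 n y)).
    + auto using continuous_picard_term with calc.
    + lra.
    + intros y Hy; rewrite Rabs_mult, Rmult_assoc.
      apply Rmult_le_compat; auto using Rabs_pos.
Qed.

Lemma picard_term'_bound X K n a b c0 c1 : 0 < K ->
  (forall x, continuous a x) -> (forall x, continuous b x) ->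
  (forall x, Rabs x <= X -> Rabs (a x) <= K) -> (forall x, Rabs x <= X -> Rabs (b x) <= K) ->
  forall x, Rabs x <= X ->
  Rabs (picard_term' a b c0 c1 n x)
    <= 2 * K * ((Rabs c0 + Rabs c1) * (/ 2) ^ n * exp (2 * K * Rabs x)).
Proof.
  intros HK ca cb Ha Hb x Hx; destruct n as [|n]; cbn [picard_term'].
  - rewrite Rabs_R0; pose proof (Rabs_pos c0); pose proof (Rabs_pos c1).
    assert (0 <= (/ 2) ^ 0 * exp (2 * K * Rabs x))
      by (rewrite pow_O, Rmult_1_l; left; apply exp_pos).
    rewrite Rmult_assoc; repeat apply Rmult_le_pos; lra.
  - pose proof (picard_term_bound X K n HK b a c1 c0 cb ca Hb Ha x Hx) as B.
    rewrite Rabs_mult.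
    apply Rle_trans with (K * ((Rabs c1 + Rabs c0) * (/ 2) ^ n * exp (2 * K * Rabs x))).
    + apply Rmult_le_compat; auto using Rabs_pos.
    + right; simpl; field.
Qed.

Lemma is_derive_picard_series a b c0 c1 x :
  (forall x, continuous a x) -> (forall x, continuous b x) ->
  is_derive (fun x => Series (fun n => picard_term a b c0 c1 n x)) x
    (a x * Series (fun n => picard_term b a c1 c0 n x)).
Proof.
  intros ca cb; pose proof (Rabs_pos x).
  set (r := mkposreal (Rabs x + 1) ltac:(lra)); assert (Hr : 0 < r) by apply cond_pos.
  assert (Hbound : exists K, 0 < K /\ (forall x, Rabs x <= r -> Rabs (a x) <= K) /\
    (forall x, Rabs x <= r -> Rabs (b x) <= K)).
  { destruct (continuous_bounded_on a (- r) r ltac:(lra) ca) as (Ka & HKa & Ha).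
    destruct (continuous_bounded_on b (- r) r ltac:(lra) cb) as (Kb & HKb & Hb).
    exists (Ka + Kb); split; [lra|split]; intros y Hy; apply Rabs_le_between in Hy;
      [specialize (Ha y Hy)|specialize (Hb y Hy)]; lra. }
  destruct Hbound as (K & HK & Ha & Hb).
  rewrite <- Series_scal_l.
  assert (Eshift : Series (fun n => picard_term' a b c0 c1 n x)
    = Series (fun n => a x * picard_term b a c1 c0 n x))
    by (apply (Series_incr_1_aux (fun n => picard_term' a b c0 c1 n x)); reflexivity).
  rewrite <- Eshift.
  set (C := Rabs c0 + Rabs c1).
  assert (HC : 0 <= C) by (pose proof (Rabs_pos c0); pose proof (Rabs_pos c1); unfold C; lra).
  assert (Hexp : forall n y, Rabs y < r ->
    0 <= C * (/ 2) ^ n * exp (2 * K * Rabs y) <= C * (/ 2) ^ n * exp (2 * K * r)).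
  { intros n y Hy; assert (0 <= C * (/ 2) ^ n) by (apply Rmult_le_pos; [lra|apply pow_le; lra]).
    split; [apply Rmult_le_pos; [assumption|left; apply exp_pos]|].
    apply Rmult_le_compat_l; [assumption|apply exp_le_exp, Rmult_le_compat_l; lra]. }
  apply (is_derive_Series _ _ (fun n => (1 + 2 * K) * C * exp (2 * K * r) * (/ 2) ^ n) r).
  - apply (ex_series_scal_l (V := R_NormedModule)), ex_series_geom; rewrite Rabs_pos_eq; lra.
  - intros n y _; apply is_derive_picard_term; assumption.
  - intros n y Hy; specialize (Hexp n y Hy).
    pose proof (picard_term_bound r K n HK a b c0 c1 ca cb Ha Hb y (Rlt_le _ _ Hy)) as Hterm.
    fold C in Hterm; nra.
  - intros n y Hy; specialize (Hexp n y Hy).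
    pose proof (picard_term'_bound r K n a b c0 c1 HK ca cb Ha Hb y (Rlt_le _ _ Hy)) as Hterm.
    fold C in Hterm; nra.
  - simpl; lra.
Qed.

Lemma picard_series_0 a b c0 c1 : Series (fun n => picard_term a b c0 c1 n 0) = c0.
Proof.
  apply is_series_unique, (filterlim_ext (fun _ => c0)); [|apply filterlim_const].
  induction x as [|n IH]; [rewrite sum_O; reflexivity|].
  rewrite sum_Sn, <- IH; simpl; rewrite RInt_point_0; unfold plus; simpl; in_R; ring.
Qed.

Theorem sturm_liouville_exists a b c0 c1 :
  (forall x, continuous a x) -> (forall x, continuous b x) ->
  exists u v, sturm_liouville a b u v /\ u 0 = c0 /\ v 0 = c1.
Proof.
  intros ca cb; exists (fun x => Series (fun n => picard_term a b c0 c1 n x)),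
    (fun x => Series (fun n => picard_term b a c1 c0 n x)).
  split; [split; intros x; apply is_derive_picard_series; assumption|].
  split; apply picard_series_0.
Qed.

Lemma gronwall (E E' : R -> R) l r K g : l <= r -> 0 <= K -> 0 <= g ->
  (forall x, l <= x <= r -> is_derive E x (E' x)) ->
  (forall x, l <= x <= r -> E' x <= K * E x + g) ->
  E r <= (E l + g * (r - l)) * exp (K * (r - l)).
Proof.
  intros Hlr HK Hg HE HE'.
  assert (H : E r * exp (- (K * (r - l))) <= E l * exp (- (K * (l - l))) + g * (r - l)).
  { apply (derive_le_affine (fun x => E x * exp (- (K * (x - l))))
      (fun x => E' x * exp (- (K * (x - l))) + E x * (exp (- (K * (x - l))) * - K)));
        [exact Hlr| |].
    - intros x Hx; apply (is_derive_Rmult E (fun x => exp (- (K * (x - l))))); [apply HE, Hx|].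
      is_derive_calc; ring.
    - intros x Hx; specialize (HE' x Hx).
      assert (0 < exp (- (K * (x - l))) <= 1).
      { assert (0 <= K * (x - l)) by (apply Rmult_le_pos; lra).
        split; [apply exp_pos|apply exp_le_1; lra]. }
      nra. }
  rewrite Rminus_diag, Rmult_0_r, Ropp_0, exp_0, Rmult_1_r, exp_Ropp in H.
  apply Rle_div_l in H; [exact H|apply exp_pos].
Qed.

Lemma sturm_liouville_reflect a b u v : sturm_liouville a b u v ->
  sturm_liouville (fun x => a (- x)) (fun x => b (- x)) (fun x => u (- x)) (fun x => - v (- x)).
Proof.
  intros [Hu Hv]; split; intros x.
  - replace (a (- x) * - v (- x)) with (- (a (- x) * v (- x))) by ring.
    apply is_derive_reflect, Hu.
  - rewrite <- (Ropp_involutive (b (- x) * u (- x))).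
    apply is_derive_Ropp, is_derive_reflect, Hv.
Qed.

Lemma sturm_liouville_opp a b u v : sturm_liouville a b u v ->
  sturm_liouville a b (fun x => - u x) (fun x => - v x).
Proof. intros [Hu Hv]; split; intros x; is_derive_calc; ring. Qed.

Lemma sturm_liouville_minus a b u v w z : sturm_liouville a b u v -> sturm_liouville a b w z ->
  sturm_liouville a b (fun x => u x - w x) (fun x => v x - z x).
Proof. intros [Hu Hv] [Hw Hz]; split; intros x; is_derive_calc; ring. Qed.

Lemma sturm_liouville_zero a b : sturm_liouville a b (fun _ => 0) (fun _ => 0).
Proof. split; intros x; is_derive_calc; ring. Qed.

Lemma sturm_liouville_energy_le a b b1 u v w z l r K d : l <= r -> 0 <= K ->
  sturm_liouville a b u v -> sturm_liouville a b1 w z ->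
  (forall x, l <= x <= r -> Rabs (a x + b1 x) <= K) ->
  (forall x, l <= x <= r -> Rabs ((b1 x - b x) * u x) <= d) ->
  (w r - u r) ^ 2 + (z r - v r) ^ 2
    <= ((w l - u l) ^ 2 + (z l - v l) ^ 2 + d ^ 2 * (r - l)) * exp ((K + 1) * (r - l)).
Proof.
  intros Hlr HK [Hu Hv] [Hw Hz] Hab Hd.
  apply (gronwall (fun x => (w x - u x) ^ 2 + (z x - v x) ^ 2)
    (fun x => 2 * (w x - u x) * (a x * (z x - v x))
      + 2 * (z x - v x) * (b1 x * (w x - u x) + (b1 x - b x) * u x))); try lra.
  - apply pow2_ge_0.
  - intros x _; is_derive_calc; simpl; ring.
  - intros x Hx; specialize (Hab x Hx); specialize (Hd x Hx).
    set (p := w x - u x); set (q := z x - v x); set (e := (b1 x - b x) * u x) in *.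
    replace (2 * p * (a x * q) + 2 * q * (b1 x * p + e))
      with ((a x + b1 x) * (2 * (p * q)) + 2 * q * e)
      by ring.
    assert (He : e ^ 2 <= d ^ 2) by (apply pow_maj_Rabs, Hd).
    assert (Hpq : Rabs (2 * (p * q)) <= p ^ 2 + q ^ 2).
    { apply Rabs_le; pose proof (pow2_ge_0 (p + q)); pose proof (pow2_ge_0 (p - q)); lra. }
    assert (Hmix : (a x + b1 x) * (2 * (p * q)) <= K * (p ^ 2 + q ^ 2)).
    { eapply Rle_trans; [apply Rle_abs|]; rewrite Rabs_mult.
      apply Rmult_le_compat; auto using Rabs_pos. }
    pose proof (pow2_ge_0 (q - e)); pose proof (pow2_ge_0 p); lra.
Qed.

Lemma sturm_liouville_unique a b u v w z x0 :
  (forall x, continuous a x) -> (forall x, continuous b x) ->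
  sturm_liouville a b u v -> sturm_liouville a b w z -> u x0 = w x0 -> v x0 = z x0 ->
  forall x, u x = w x /\ v x = z x.
Proof.
  assert (forward : forall a b u v x0, (forall x, continuous a x) -> (forall x, continuous b x) ->
    sturm_liouville a b u v -> u x0 = 0 -> v x0 = 0 -> forall x, x0 <= x -> u x = 0 /\ v x = 0).
  { clear; intros a b u v x0 ca cb Hs u0 v0 x Hx.
    destruct (continuous_bounded_on (fun x => a x + b x) x0 x Hx) as (K & HK & Hab);
      [auto with calc|].
    pose proof (sturm_liouville_energy_le a b b _ _ u v x0 x K 0 Hx (Rlt_le _ _ HK)
      (sturm_liouville_zero a b) Hs Hab
      ltac:(intros; rewrite Rmult_0_r, Rabs_R0; apply Rle_refl)) as H.
    rewrite u0, v0, !Rminus_0_r in H.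
    replace ((0 ^ 2 + 0 ^ 2 + 0 ^ 2 * (x - x0)) * exp ((K + 1) * (x - x0))) with 0 in H by ring.
    pose proof (pow2_ge_0 (u x)); pose proof (pow2_ge_0 (v x)); split; nra. }
  intros ca cb Hu Hw Eu Ev x.
  pose proof (sturm_liouville_minus _ _ _ _ _ _ Hu Hw) as Hd.
  enough (u x - w x = 0 /\ v x - z x = 0) by lra.
  destruct (Rle_dec x0 x) as [h|h]; [apply (forward a b _ _ x0 ca cb Hd); lra|].
  pose proof (fun x => continuous_comp_R (fun y => - y) a x ltac:(auto with calc) (ca (- x)))
    as ca'.
  pose proof (fun x => continuous_comp_R (fun y => - y) b x ltac:(auto with calc) (cb (- x)))
    as cb'.
  pose proof (forward _ _ _ _ (- x0) ca' cb' (sturm_liouville_reflect _ _ _ _ Hd)) as H.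
  cbv beta in H; rewrite !Ropp_involutive in H.
  specialize (H ltac:(lra) ltac:(lra) (- x) ltac:(lra)).
  cbv beta in H; rewrite !Ropp_involutive in H; lra.
Qed.

Lemma sturm_liouville_even a b u v :
  (forall x, continuous a x) -> (forall x, continuous b x) ->
  (forall x, a (- x) = a x) -> (forall x, b (- x) = b x) ->
  sturm_liouville a b u v -> v 0 = 0 -> forall x, u (- x) = u x.
Proof.
  intros ca cb ea eb Hs v0 x; symmetry.
  apply (sturm_liouville_unique a b u v (fun x => u (- x)) (fun x => - v (- x)) 0); auto.
  - destruct (sturm_liouville_reflect _ _ _ _ Hs) as [Hu Hv]; split; intros y;
      [rewrite <- ea; apply Hu|rewrite <- eb; apply Hv].
  - rewrite Ropp_0; reflexivity.
  - rewrite Ropp_0, v0; ring.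
Qed.

Lemma sturm_liouville_continuous_dependence a b u v X eta :
  (forall x, continuous a x) -> (forall x, continuous b x) -> sturm_liouville a b u v ->
  0 <= X -> 0 < eta -> exists d, 0 < d /\ forall b1 w z, sturm_liouville a b1 w z ->
    w 0 = u 0 -> z 0 = v 0 -> (forall x, 0 <= x <= X -> Rabs (b1 x - b x) <= d) ->
    forall x, 0 <= x <= X -> Rabs (w x - u x) <= eta /\ Rabs (z x - v x) <= eta.
Proof.
  intros ca cb Hs HX Heta.
  destruct (continuous_bounded_on (fun x => a x + b x) 0 X HX) as (K & HK & Hab); [auto with calc|].
  destruct (continuous_bounded_on u 0 X HX (continuous_is_derive_fun _ _ (proj1 Hs)))
    as (M & HM & Hu).
  set (S := X * exp ((K + 2) * X) + 1).
  assert (HS : 1 <= S).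
  { assert (0 <= X * exp ((K + 2) * X)); [|unfold S; lra].
    apply Rmult_le_pos; [exact HX|left; apply exp_pos]. }
  set (d := Rmin 1 (eta / (M * S))).
  assert (HMS : 0 < M * S) by (apply Rmult_lt_0_compat; lra).
  assert (Hd : 0 < d) by (apply Rmin_glb_lt; [lra|apply Rdiv_lt_0_compat; assumption]).
  pose proof (Rmin_l 1 (eta / (M * S)) : d <= 1).
  assert (HdMS : d * M * S <= eta).
  { pose proof (Rmin_r 1 (eta / (M * S)) : d <= _) as h; apply Rle_div_r in h; [lra|exact HMS]. }
  exists d; split; [exact Hd|]; intros b1 w z Hw w0 z0 Hb x Hx.
  pose proof (sturm_liouville_energy_le a b b1 u v w z 0 x (K + 1) (d * M)
    ltac:(lra) ltac:(lra) Hs Hw)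
    as Henergy; rewrite w0, z0, !Rminus_diag, !Rminus_0_r in Henergy.
  assert (Hsq : (w x - u x) ^ 2 + (z x - v x) ^ 2 <= eta ^ 2).
  { eapply Rle_trans; [apply Henergy|].
    - intros y Hy; specialize (Hab y ltac:(lra)); specialize (Hb y ltac:(lra)).
      replace (a y + b1 y) with (a y + b y + (b1 y - b y)) by ring.
      eapply Rle_trans; [apply Rabs_triang|]; lra.
    - intros y Hy; rewrite Rabs_mult.
      apply Rmult_le_compat; try apply Rabs_pos; [apply Hb|apply Hu]; lra.
    - replace (K + 1 + 1) with (K + 2) by ring.
      assert (x * exp ((K + 2) * x) <= S).
      { apply Rle_trans with (X * exp ((K + 2) * X)); [|unfold S; lra].
        apply Rmult_le_compat; 
          [lra|left; apply exp_pos|lra|apply exp_le_exp, Rmult_le_compat_l; lra]. }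
      pose proof (pow2_ge_0 (d * M)).
      apply Rle_trans with ((d * M) ^ 2 * S); [simpl in *; nra|].
      apply Rle_trans with ((d * M * S) ^ 2); [simpl in *; nra|].
      apply pow_incr; split; [apply Rmult_le_pos; [apply Rmult_le_pos|]; lra|exact HdMS]. }
  assert (Hroot : forall c, c ^ 2 <= eta ^ 2 -> Rabs c <= eta) by (intros; apply Rabs_le; nra).
  pose proof (pow2_ge_0 (w x - u x)); pose proof (pow2_ge_0 (z x - v x)).
  split; apply Hroot; lra.
Qed.

(** * Sturm comparison *)

Definition wronskian (u v w z : R -> R) (x : R) : R := v x * w x - u x * z x.

Section Sturm.
Variables (a b b1 u v w z : R -> R).
Hypothesis (ca : forall x, continuous a x) (apos : forall x, 0 < a x).
Hypothesis (Huv : sturm_liouville a b u v) (Hwz : sturm_liouville a b1 w z).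

Lemma is_derive_wronskian x :
  is_derive (wronskian u v w z) x ((b x - b1 x) * (u x * w x)).
Proof. destruct Huv, Hwz; unfold wronskian; is_derive_calc; ring. Qed.

Lemma is_derive_quotient x : w x <> 0 ->
  is_derive (fun y => u y / w y) x (a x * wronskian u v w z x / w x ^ 2).
Proof.
  intros Hw; evar_last;
    [exact (is_derive_div u w x _ _ (proj1 Huv x) (proj1 Hwz x) Hw)|].
  unfold wronskian; field; exact Hw.
Qed.

Variable x0 : R.
Hypothesis (wpos : forall x, x0 <= x -> 0 < w x) (b1_le_b : forall x, x0 <= x -> b1 x <= b x).
Hypothesis (u0 : 0 < u x0) (wronskian0 : 0 <= wronskian u v w z x0).

Lemma wronskian_monotone_until l r : x0 <= l <= r -> (forall x, l <= x <= r -> 0 <= u x) ->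
  wronskian u v w z l <= wronskian u v w z r.
Proof.
  intros Hl Hu; apply (derive_nonneg_le _ _ _ _ (proj2 Hl) (fun x _ => is_derive_wronskian x)).
  intros x Hx; specialize (Hu x Hx); specialize (wpos x ltac:(lra)).
  specialize (b1_le_b x ltac:(lra)).
  apply Rmult_le_pos; [lra|apply Rmult_le_pos; lra].
Qed.

Lemma sturm_positive x : x0 <= x -> 0 < u x.
Proof.
  intros Hx; apply Rnot_le_lt; intros Hux.
  destruct (first_zero u x0 x) as (c & Hc & Huc & Hbefore); auto.
  { exact (continuous_is_derive_fun _ _ (proj1 Huv)). }
  assert (Hnonneg : forall y, x0 <= y <= c -> 0 <= u y).
  { intros y Hy; destruct (Req_dec y c) as [->|n]; [lra|left; apply Hbefore; lra]. }
  assert (Hquot : u x0 / w x0 <= u c / w c).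
  { apply (derive_nonneg_le (fun y => u y / w y) (fun y => a y * wronskian u v w z y / w y ^ 2));
      [lra| |]; intros y Hy; pose proof (wpos y ltac:(lra)).
    - apply is_derive_quotient; lra.
    - pose proof (wronskian_monotone_until x0 y ltac:(lra) ltac:(intros; apply Hnonneg; lra)).
      apply Rdiv_le_0_compat; [|apply pow_lt; assumption].
      apply Rmult_le_pos; [left; apply apos|lra]. }
  rewrite Huc in Hquot; unfold Rdiv at 2 in Hquot; rewrite Rmult_0_l in Hquot.
  assert (0 < u x0 / w x0) by (apply Rdiv_lt_0_compat; [exact u0|apply wpos; lra]).
  lra.
Qed.

Lemma wronskian_monotone l r : x0 <= l <= r -> wronskian u v w z l <= wronskian u v w z r.
Proof.
  intros Hl; apply wronskian_monotone_until; [exact Hl|].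
  intros; left; apply sturm_positive; lra.
Qed.

Lemma continuous_weighted_sqr x : continuous (fun y => u y ^ 2 / a y) x.
Proof.
  pose proof (continuous_is_derive_fun _ _ (proj1 Huv)); specialize (apos x).
  apply continuous_Rdiv; auto with calc; lra.
Qed.

(* With [c] a lower bound of the wronskian, [u^2 / a >= c (2 + (w / u)')] by AM-GM. *)
Lemma sturm_weighted_sqr_growth c l r : 0 < c -> c <= wronskian u v w z l -> x0 <= l <= r ->
  2 * c * (r - l) - c * (w l / u l) <= RInt (fun x => u x ^ 2 / a x) l r.
Proof.
  intros Hc Hcl Hlr; set (f := fun x => u x ^ 2 / a x).
  assert (cf : forall x, continuous f x) by apply continuous_weighted_sqr.
  assert (Hgrowth : RInt f 0 l - c * (2 * l + w l / u l) <= RInt f 0 r - c * (2 * r + w r / u r)).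
  { apply (derive_nonneg_le (fun y => RInt f 0 y - c * (2 * y + w y / u y))
      (fun y => f y - c * (2 + (a y * z y * u y - w y * (a y * v y)) / u y ^ 2))); [lra| |];
      intros y Hy; pose proof (sturm_positive y ltac:(lra)) as uy.
    - apply is_derive_Rminus;
        [apply is_derive_RInt_from_0, cf|apply is_derive_scal, is_derive_Rplus].
      + is_derive_calc; ring.
      + apply is_derive_div; [apply Hwz|apply Huv|lra].
    - pose proof (wronskian_monotone l y ltac:(lra)) as HW; specialize (apos y).
      assert (fy : 0 < f y) by (apply Rdiv_lt_0_compat; [apply pow_lt|]; assumption).
      replace ((a y * z y * u y - w y * (a y * v y)) / u y ^ 2) with (- (wronskian u v w z y / f y))
        by (unfold wronskian, f; field; lra).
      assert (c / f y <= wronskian u v w z y / f y)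
        by (apply Rmult_le_compat_r; [left; apply Rinv_0_lt_compat, fy|lra]).
      assert (Hsq : 0 <= (f y - c) ^ 2 / f y)
        by (apply Rdiv_le_0_compat; [apply pow2_ge_0|exact fy]).
      replace ((f y - c) ^ 2 / f y) with (f y - c * (2 - c / f y)) in Hsq by (field; lra).
      nra. }
  rewrite (RInt_RChasles f 0 l r cf) in Hgrowth.
  assert (0 < w r / u r) by (apply Rdiv_lt_0_compat; [apply wpos|apply sturm_positive]; lra).
  nra.
Qed.

Lemma sturm_weighted_sqr_unbounded M : (forall x, x0 <= x -> b1 x < b x) ->
  exists l r, l <= r /\ M < RInt (fun x => u x ^ 2 / a x) l r.
Proof.
  intros Hstrict; set (l := x0 + 1); set (c := wronskian u v w z l).
  assert (Hc : 0 < c).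
  { apply Rle_lt_trans with (wronskian u v w z x0); [exact wronskian0|].
    apply (incr_function_le _ x0 l (fun x => (b x - b1 x) * (u x * w x)));
      unfold l; simpl; try lra; intros x Hx Hx'; [apply is_derive_wronskian|].
    pose proof (Hstrict x Hx); pose proof (wpos x Hx); pose proof (sturm_positive x Hx).
    apply Rmult_lt_0_compat; [lra|apply Rmult_lt_0_compat; assumption]. }
  set (q := c * (w l / u l)); pose proof (Rabs_pos M); pose proof (Rle_abs M).
  assert (Hq : 0 < q).
  { apply Rmult_lt_0_compat; [exact Hc|].
    apply Rdiv_lt_0_compat; [apply wpos|apply sturm_positive]; unfold l; lra. }
  set (h := (Rabs M + 1 + q) / (2 * c)).
  assert (Hh : 0 < h) by (apply Rdiv_lt_0_compat; lra).
  exists l, (l + h); split; [lra|].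
  pose proof (sturm_weighted_sqr_growth c l (l + h) Hc (Rle_refl c) ltac:(unfold l; lra)) as Hint.
  fold q in Hint; replace (2 * c * (l + h - l)) with (Rabs M + 1 + q) in Hint
    by (unfold h; field; lra).
  lra.
Qed.
End Sturm.

Theorem positive_solution_excludes_L2 a b b1 u v w z M x1 :
  (forall x, continuous a x) -> (forall x, 0 < a x) -> (forall x, b1 x < b x) ->
  sturm_liouville a b u v -> sturm_liouville a b1 w z -> (forall x, 0 < w x) ->
  (forall l r, l <= r -> RInt (fun x => u x ^ 2 / a x) l r <= M) -> u x1 = 0.
Proof.
  intros ca apos Hb Huv Hwz wpos HM.
  enough (Hsign : forall u v, sturm_liouville a b u v ->
    (forall l r, l <= r -> RInt (fun x => u x ^ 2 / a x) l r <= M) -> u x1 <= 0).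
  { apply Rle_antisym; [apply (Hsign u v); assumption|].
    enough (- u x1 <= 0) by lra; apply (Hsign (fun x => - u x) (fun x => - v x)).
    - apply sturm_liouville_opp, Huv.
    - intros l r Hlr; rewrite (RInt_ext _ (fun x => u x ^ 2 / a x)); [apply HM, Hlr|].
      intros; unfold Rdiv; in_R; ring. }
  clear u v Huv HM; intros u v Huv HM; apply Rnot_lt_le; intros Hu.
  destruct (Rle_dec 0 (wronskian u v w z x1)) as [h|h].
  - destruct (sturm_weighted_sqr_unbounded a b b1 u v w z ca apos Huv Hwz x1) with (M := M)
      as (l & r & Hlr & H); auto using Rlt_le; specialize (HM l r Hlr); lra.
  - pose proof (fun x => continuous_comp_R (fun y => - y) a x ltac:(auto with calc) (ca (- x)))
      as ca'.
    destruct (sturm_weighted_sqr_unbounded (fun x => a (- x)) (fun x => b (- x)) (fun x => b1 (- x))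
      (fun x => u (- x)) (fun x => - v (- x)) (fun x => w (- x)) (fun x => - z (- x)))
      with (x0 := - x1) (M := M) as (l & r & Hlr & H);
      auto using Rlt_le, sturm_liouville_reflect.
    + rewrite Ropp_involutive; exact Hu.
    + unfold wronskian in *; rewrite Ropp_involutive; lra.
    + specialize (HM (- r) (- l) ltac:(lra)).
      rewrite <- (RInt_reflect (fun x => u x ^ 2 / a x)) in HM; [lra|].
      apply (continuous_weighted_sqr a b u v); assumption.
Qed.

(** * The ground state *)

Definition eigen_weight (x : R) : R := exp (x ^ 2 / 2).
Definition eigen_potential (F : R -> R) (mu x : R) : R := 2 * exp (- (x ^ 2 / 2)) * (F x - mu).

Lemma eigen_weight_pos x : 0 < eigen_weight x.
Proof. apply exp_pos. Qed.

Lemma continuous_eigen_weight x : continuous eigen_weight x.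
Proof. unfold eigen_weight, Rdiv; auto with calc. Qed.

Lemma is_derive_eigen_weight x : is_derive eigen_weight x (x * eigen_weight x).
Proof. unfold eigen_weight; auto_derive; [exact I|unfold Rdiv; simpl; field]. Qed.

Lemma continuous_eigen_potential F mu x : (forall x, continuous F x) ->
  continuous (eigen_potential F mu) x.
Proof. intros cF; unfold eigen_potential, Rdiv; auto 10 with calc. Qed.
#[local] Hint Resolve continuous_eigen_weight continuous_eigen_potential : calc.

Lemma eigen_weight_potential F mu x : eigen_weight x * eigen_potential F mu x = 2 * (F x - mu).
Proof.
  unfold eigen_weight, eigen_potential; rewrite exp_Ropp; pose proof (exp_pos (x ^ 2 / 2)).
  field; lra.
Qed.

Lemma eigen_potential_dist F mu nu x :
  Rabs (eigen_potential F nu x - eigen_potential F mu x) <= 2 * Rabs (nu - mu).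
Proof.
  unfold eigen_potential; pose proof (exp_opp_half_sqr_le_1 x).
  replace (_ - _) with (2 * exp (- (x ^ 2 / 2)) * (mu - nu)) by ring.
  rewrite !Rabs_mult, (Rabs_pos_eq 2), (Rabs_pos_eq (exp _)), (Rabs_minus_sym mu) by lra.
  apply Rmult_le_compat_r; [apply Rabs_pos|lra].
Qed.

Lemma eigen_potential_lt F G mu nu x : F x - mu < G x - nu ->
  eigen_potential F mu x < eigen_potential G nu x.
Proof. intros H; apply Rmult_lt_compat_l; [pose proof (exp_pos (- (x ^ 2 / 2))); lra|exact H]. Qed.

Lemma eigen_potential_le F G mu nu x : F x - mu <= G x - nu ->
  eigen_potential F mu x <= eigen_potential G nu x.
Proof. intros H; apply Rmult_le_compat_l; [pose proof (exp_pos (- (x ^ 2 / 2))); lra|exact H]. Qed.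

(* [h'' = x h' + 2 (F - mu) h], written with the flux [exp (- x^2 / 2) h']. *)
Definition eigen_system (F : R -> R) (mu : R) : (R -> R) -> (R -> R) -> Prop :=
  sturm_liouville eigen_weight (eigen_potential F mu).

Lemma eigen_system_intro (F : R -> R) mu (u u' u'' : R -> R) : (forall x, is_derive u x (u' x)) ->
  (forall x, is_derive u' x (u'' x)) -> (forall x, u'' x = x * u' x + 2 * (F x - mu) * u x) ->
  eigen_system F mu u (fun x => exp (- (x ^ 2 / 2)) * u' x).
Proof.
  intros Hu Hu' E; split; intros x.
  - replace (eigen_weight x * (exp (- (x ^ 2 / 2)) * u' x)) with (u' x); [apply Hu|].
    unfold eigen_weight; rewrite exp_Ropp; pose proof (exp_pos (x ^ 2 / 2)); field; lra.
  - pose proof (is_derive_exp_opp_half_sqr x); is_derive_calc.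
    rewrite E; unfold eigen_potential; ring.
Qed.

Lemma eigen_system_derive2 F mu u v x : eigen_system F mu u v ->
  is_derive (fun x => eigen_weight x * v x) x
    (x * (eigen_weight x * v x) + 2 * (F x - mu) * u x).
Proof.
  intros [_ Hv]; rewrite <- (eigen_weight_potential F mu x).
  evar_last; [apply is_derive_Rmult; [apply is_derive_eigen_weight|apply Hv]|in_R; ring].
Qed.

Lemma eigen_system_of_LF F mu h : C2 h -> (forall x, LF F h x = - mu * h x) ->
  eigen_system F mu h (fun x => exp (- (x ^ 2 / 2)) * Derive h x).
Proof.
  intros Hh Hmu; apply (eigen_system_intro F mu h (Derive h) (Derive_n h 2)).
  - intros x; apply Derive_correct, Hh.
  - intros x; apply Derive_correct, Hh.
  - intros x; specialize (Hmu x); unfold LF in Hmu; lra.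
Qed.

Lemma LF_of_eigen_system F mu u v : (forall x, continuous F x) -> eigen_system F mu u v ->
  C2 u /\ forall x, LF F u x = - mu * u x.
Proof.
  intros cF Hs; pose proof (continuous_is_derive_fun _ _ (proj1 Hs)) as cu.
  set (u' := fun x => eigen_weight x * v x).
  set (u'' := fun x => x * u' x + 2 * (F x - mu) * u x).
  assert (D' : forall x, is_derive u' x (u'' x)) by (intros; apply eigen_system_derive2, Hs).
  pose proof (continuous_is_derive_fun _ _ D') as cu'.
  assert (Eu' : forall x, Derive u x = u' x) by (intros; apply is_derive_unique, Hs).
  assert (Eu'' : forall x, Derive_n u 2 x = u'' x).
  { intros x; simpl; rewrite (Derive_ext _ u') by exact Eu'; apply is_derive_unique, D'. }
  split; [intros x; split; [|split]|].
  - eexists; exact (proj1 Hs x).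
  - apply (ex_derive_ext u'); [intros; symmetry; apply Eu'|eexists; apply D'].
  - apply (continuous_ext u''); [intros; symmetry; apply Eu''|unfold u''; auto 20 with calc].
  - intros x; unfold LF; rewrite Eu', Eu''; unfold u''; field.
Qed.

Lemma sqrt_2PI_pos : 0 < sqrt (2 * PI).
Proof. apply sqrt_lt_R0; pose proof PI_RGT_0; lra. Qed.

Lemma continuous_gauss x : continuous gauss x.
Proof. pose proof sqrt_2PI_pos; apply continuous_ex_derive; unfold gauss; auto_derive; exact I. Qed.

Lemma gauss_pos x : 0 < gauss x.
Proof. apply Rdiv_lt_0_compat; [apply exp_pos|apply sqrt_2PI_pos]. Qed.

Lemma gauss_eigen_weight x : gauss x = / eigen_weight x / sqrt (2 * PI).
Proof. unfold gauss, eigen_weight; rewrite <- exp_Ropp; do 2 f_equal; field. Qed.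

Lemma ex_RInt_gen_bounded (f : R -> R) : (forall x, continuous f x) -> (forall x, 0 <= f x) ->
  ex_RInt_gen f (Rbar_locally m_infty) (Rbar_locally p_infty) ->
  exists M, forall l r, l <= r -> RInt f l r <= M.
Proof.
  intros cf Hf [L HL].
  assert (Hnear : locally L (fun v => v < L + 1)) by (apply (open_lt (L + 1)); simpl; lra).
  destruct (HL _ Hnear) as [Ql Qr [ml Hl] [mr Hr] HQ].
  exists (L + 1); intros l r Hlr; set (l' := Rmin l (ml - 1)); set (r' := Rmax r (mr + 1)).
  pose proof (Rmin_l l (ml - 1) : l' <= l); pose proof (Rmin_r l (ml - 1) : l' <= ml - 1).
  pose proof (Rmax_l r (mr + 1) : r <= r'); pose proof (Rmax_r r (mr + 1) : mr + 1 <= r').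
  destruct (HQ l' r' (Hl l' ltac:(lra)) (Hr r' ltac:(lra))) as [y [Hy HyL]]; simpl in Hy.
  apply (is_RInt_unique (V := R_CompleteNormedModule)) in Hy; rewrite <- Hy in HyL.
  eapply Rle_trans; [|left; exact HyL].
  apply RInt_le_subinterval; auto; lra.
Qed.

Lemma ex_RInt_gen_of_le (f : R -> R) (K : R) : (forall x, continuous f x) -> (forall x, 0 <= f x) ->
  (forall x, f x <= K * / (1 + x ^ 2)) ->
  ex_RInt_gen f (Rbar_locally m_infty) (Rbar_locally p_infty).
Proof.
  enough (half_line : forall f : R -> R, (forall x, continuous f x) -> (forall x, 0 <= f x) ->
    (forall x, f x <= K * / (1 + x ^ 2)) -> exists L : R, is_lim (RInt f 0) p_infty L).
  { intros cf Hf HK; destruct (half_line f cf Hf HK) as [L1 Hright].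
    destruct (half_line (fun x => f (- x))) as [L2 Hleft]; auto.
    { intros x; apply (continuous_comp_R (fun y => - y)); auto with calc. }
    { intros x; replace (x ^ 2) with ((- x) ^ 2) by ring; apply HK. }
    exists (L2 + L1); intros P [e HP].
    apply is_lim_spec in Hright; apply is_lim_spec in Hleft.
    assert (He2 : 0 < e / 2) by (pose proof (cond_pos e); lra).
    destruct (Hright (mkposreal _ He2)) as [M1 HM1]; destruct (Hleft (mkposreal _ He2)) as [M2 HM2].
    apply (Filter_prod _ _ _ (fun l => l < - M2) (fun r => M1 < r));
      [eexists; eauto|eexists; eauto|].
    intros l r Hl Hr; exists (RInt f l r); split.
    - apply (RInt_correct (V := R_CompleteNormedModule)); auto with calc.
    - apply HP; specialize (HM1 r Hr); specialize (HM2 (- l) ltac:(lra)).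
      rewrite (RInt_RChasles f l 0 r cf); simpl in HM1, HM2.
      rewrite RInt_reflect, Ropp_involutive, Ropp_0 in HM2 by exact cf.
      apply Rabs_def2 in HM1; apply Rabs_def2 in HM2.
      change (Rabs (RInt f l 0 + RInt f 0 r - (L2 + L1)) < e); apply Rabs_def1; lra. }
  intros g cg Hg HK.
  destruct (nondecreasing_bounded_lim (RInt g 0) (Rabs K * (PI / 2))) as (L & HL & _); [| |eauto].
  - intros x y Hxy; apply RInt_le_subinterval; auto; lra.
  - intros x Hx; apply Rle_trans with (RInt (fun y => Rabs K * / (1 + y ^ 2)) 0 x).
    + apply RInt_le; auto with calc; [apply ex_RInt_Rcontinuous; intros y|intros y _].
      * apply continuous_Rmult, continuous_Rinv_comp; auto with calc; pose proof (pow2_ge_0 y); lra.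
      * eapply Rle_trans; [apply HK|]; apply Rmult_le_compat_r; [|apply Rle_abs].
        left; apply Rinv_0_lt_compat; pose proof (pow2_ge_0 y); lra.
    + rewrite (RInt_is_derive (fun y => Rabs K * atan y)).
      * rewrite atan_0; pose proof (atan_bound x); pose proof (Rabs_pos K); simpl; nra.
      * intros y; auto_derive; [exact I|field; pose proof (pow2_ge_0 y); lra].
      * intros y; apply continuous_Rmult, continuous_Rinv_comp; auto with calc;
          pose proof (pow2_ge_0 y); lra.
Qed.

Lemma in_L2m_bounded h : (forall x, continuous h x) -> in_L2m h ->
  exists M, forall l r, l <= r -> RInt (fun x => h x ^ 2 / eigen_weight x) l r <= M.
Proof.
  intros ch Hh; pose proof sqrt_2PI_pos; pose proof continuous_gauss.
  destruct (ex_RInt_gen_bounded (fun x => h x ^ 2 * gauss x)) as [M HM];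
    [auto with calc| |exact Hh|].
  - intros x; apply Rmult_le_pos; [apply pow2_ge_0|left; apply gauss_pos].
  - exists (sqrt (2 * PI) * M); intros l r Hlr.
    rewrite (RInt_ext _ (fun x => sqrt (2 * PI) * (h x ^ 2 * gauss x))).
    + rewrite RInt_Rscal by auto with calc; apply Rmult_le_compat_l; [lra|apply HM, Hlr].
    + intros x _; rewrite gauss_eigen_weight; pose proof (eigen_weight_pos x); in_R; field; lra.
Qed.

Lemma exp_opp_sqr_le d x : 0 < d -> exp (- (d * x ^ 2)) <= (1 + / d) * / (1 + x ^ 2).
Proof.
  intros Hd; pose proof (Rinv_0_lt_compat d Hd); pose proof (pow2_ge_0 x).
  rewrite exp_Ropp; apply Rle_trans with (/ (1 + d * x ^ 2)).
  - apply Rinv_le_contravar; [nra|apply exp_ineq1_le].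
  - apply Rle_div_r; [lra|].
    replace (/ (1 + d * x ^ 2) * (1 + x ^ 2)) with ((1 + x ^ 2) / (1 + d * x ^ 2)) by (field; nra).
    apply Rle_div_l; [nra|].
    replace ((1 + / d) * (1 + d * x ^ 2)) with (1 + x ^ 2 + (/ d + d * x ^ 2)) by (field; lra).
    nra.
Qed.

Lemma in_L2m_of_growth h C c : (forall x, continuous h x) -> c < / 4 ->
  (forall x, Rabs (h x) <= C * exp (c * x ^ 2)) -> in_L2m h.
Proof.
  intros ch Hc Hh; pose proof sqrt_2PI_pos; pose proof continuous_gauss.
  set (d := / 2 - 2 * c); assert (Hd : 0 < d) by (unfold d; lra).
  assert (HK : 0 <= C ^ 2 / sqrt (2 * PI))
    by (apply Rdiv_le_0_compat; [apply pow2_ge_0|assumption]).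
  apply (ex_RInt_gen_of_le _ (C ^ 2 / sqrt (2 * PI) * (1 + / d))).
  - auto with calc.
  - intros x; apply Rmult_le_pos; [apply pow2_ge_0|left; apply gauss_pos].
  - intros x; apply Rle_trans with ((C * exp (c * x ^ 2)) ^ 2 * gauss x).
    + apply Rmult_le_compat_r; [left; apply gauss_pos|apply pow_maj_Rabs, Hh].
    + replace ((C * exp (c * x ^ 2)) ^ 2 * gauss x)
        with (C ^ 2 / sqrt (2 * PI) * exp (- (d * x ^ 2))).
      * rewrite Rmult_assoc; apply Rmult_le_compat_l; [exact HK|apply exp_opp_sqr_le, Hd].
      * unfold gauss; replace (- (d * x ^ 2)) with (c * x ^ 2 + c * x ^ 2 + - x ^ 2 / 2)
          by (unfold d; field).
        rewrite !exp_plus; field; lra.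
Qed.

Lemma is_eigenvalue_of_eigen_system F mu u v x0 : (forall x, continuous F x) ->
  eigen_system F mu u v -> in_L2m u -> u x0 <> 0 -> is_eigenvalue_LF F mu.
Proof.
  intros cF Hs HL2 Hx0; destruct (LF_of_eigen_system F mu u v cF Hs) as [HC2 HLF].
  exists u; repeat split; eauto; apply HC2.
Qed.

Definition growth_barrier (x : R) : R := exp (x ^ 2 / 16).
Definition growth_flux (x : R) : R := exp (- (x ^ 2 / 2)) * (x / 8 * growth_barrier x).

Lemma growth_barrier_pos x : 0 < growth_barrier x.
Proof. apply exp_pos. Qed.

Lemma growth_barrier_ge_1 x : 1 <= growth_barrier x.
Proof. apply one_le_exp; pose proof (pow2_ge_0 x); lra. Qed.

Lemma growth_flux_nonneg x : 0 <= x -> 0 <= growth_flux x.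
Proof.
  intros Hx; pose proof (exp_pos (- (x ^ 2 / 2))); pose proof (growth_barrier_pos x).
  repeat apply Rmult_le_pos; lra.
Qed.

Lemma eigen_system_growth_barrier :
  eigen_system (fun x => / 16 - 7 / 128 * x ^ 2) 0 growth_barrier growth_flux.
Proof.
  apply (eigen_system_intro _ _ _ _
    (fun x => (/ 8 + x ^ 2 / 64) * growth_barrier x)); unfold growth_barrier; intros x.
  - auto_derive; [exact I|unfold Rdiv; simpl; field].
  - auto_derive; [exact I|unfold Rdiv; simpl; field].
  - field.
Qed.

Lemma positive_solution_excludes_eigenvalue F G mu nu w z : (forall x, continuous F x) ->
  eigen_system G nu w z -> (forall x, 0 < w x) -> (forall x, G x - nu < F x - mu) ->
  ~ is_eigenvalue_LF F mu.
Proof.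
  intros cF Hw wpos Hlt (h & HC2 & HL2 & [x1 Hx1] & HLF).
  pose proof (eigen_system_of_LF F mu h HC2 HLF) as Hh; apply Hx1.
  destruct (in_L2m_bounded h (continuous_is_derive_fun _ _ (proj1 Hh)) HL2) as [M HM].
  apply (positive_solution_excludes_L2 eigen_weight (eigen_potential F mu)
    (eigen_potential G nu) h (fun x => exp (- (x ^ 2 / 2)) * Derive h x) w z M);
    auto using eigen_weight_pos, eigen_potential_lt with calc.
Qed.

Record is_ground_state (F : R -> R) (lam0 : R) (h v : R -> R) (C : R) : Prop := {
  ground_eq : eigen_system F lam0 h v;
  ground_pos : forall x, 0 < h x;
  ground_growth_pos : 0 < C;
  ground_growth : forall x, h x <= C * growth_barrier x }.
Arguments ground_eq {F lam0 h v C} _.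
Arguments ground_pos {F lam0 h v C} _ x.
Arguments ground_growth_pos {F lam0 h v C} _.
Arguments ground_growth {F lam0 h v C} _ x.

Section Ground.
Variables (F : R -> R) (B lam0 : R).
Hypothesis (cF : forall x, continuous F x) (F_bounds : forall x, 0 <= F x <= B)
  (F_even : forall x, F (- x) = F x) (Hlow : lowest_eigenvalue_LF F lam0).

Definition even_solution (mu : R) (u v : R -> R) : Prop :=
  eigen_system F mu u v /\ u 0 = 1 /\ v 0 = 0.

Definition positive_parameter (mu : R) : Prop :=
  exists u v, even_solution mu u v /\ forall x, 0 <= x -> 0 < u x.

Lemma continuous_even_solution mu u v : even_solution mu u v -> forall x, continuous u x.
Proof. intros [[Hu _] _]; exact (continuous_is_derive_fun _ _ Hu). Qed.

Lemma even_solution_exists mu : exists u v, even_solution mu u v.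
Proof. apply sturm_liouville_exists; auto with calc. Qed.

Lemma even_solution_even mu u v : even_solution mu u v -> forall x, u (- x) = u x.
Proof.
  intros (Hs & _ & Hv).
  apply (sturm_liouville_even eigen_weight (eigen_potential F mu) u v); auto with calc; intros x.
  - unfold eigen_weight; f_equal; field.
  - unfold eigen_potential; rewrite F_even; do 4 f_equal; field.
Qed.

Lemma even_solution_of_half_line mu u v (P : R -> Prop) : even_solution mu u v ->
  (forall x, 0 <= x -> P (u x)) -> forall x, P (u x).
Proof.
  intros Hs HP x; destruct (Rle_dec 0 x); [auto|].
  rewrite <- (even_solution_even mu u v Hs); apply HP; lra.
Qed.

Lemma even_solution_continuous_dependence mu u v X eta : even_solution mu u v ->
  0 <= X -> 0 < eta -> exists d, 0 < d /\ forall nu w z, even_solution nu w z ->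
    Rabs (nu - mu) < d ->
    forall x, 0 <= x <= X -> Rabs (w x - u x) <= eta /\ Rabs (z x - v x) <= eta.
Proof.
  intros (Hs & u0 & v0) HX Heta.
  destruct (sturm_liouville_continuous_dependence eigen_weight (eigen_potential F mu) u v X eta)
    as (d & Hd & Hclose); auto with calc.
  exists (d / 2); split; [lra|]; intros nu w z (Hw & w0 & z0) Hnu.
  apply (Hclose (eigen_potential F nu)); [exact Hw|congruence|congruence|].
  intros x _; pose proof (eigen_potential_dist F mu nu x); lra.
Qed.

Lemma nonneg_solution_pos mu u v : even_solution mu u v -> (forall x, 0 <= u x) ->
  forall x, 0 < u x.
Proof.
  intros (Hs & u0 & v0) Hu x; destruct (Hu x) as [h|Hux]; [exact h|exfalso].
  assert (Hvx : eigen_weight x * v x = 0).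
  { apply (derive_at_minimum u x); [apply Hs|intros y; rewrite <- Hux; apply Hu]. }
  apply Rmult_integral in Hvx; destruct Hvx as [Hvx|Hvx]; [pose proof (eigen_weight_pos x); lra|].
  destruct (sturm_liouville_unique eigen_weight (eigen_potential F mu) u v
    (fun _ => 0) (fun _ => 0) x) with (x := 0) as [Hu0 _];
      auto using sturm_liouville_zero with calc.
  lra.
Qed.

Lemma positive_solution_le mu u v : eigen_system F mu u v -> (forall x, 0 < u x) -> mu <= lam0.
Proof.
  intros Hs Hu; apply Rnot_lt_le; intros Hmu.
  apply (positive_solution_excludes_eigenvalue F F lam0 mu u v cF Hs Hu); [intros; lra|apply Hlow].
Qed.

Lemma positive_parameter_le mu : positive_parameter mu -> mu <= lam0.
Proof.
  intros (u & v & Hs & Hu); apply (positive_solution_le mu u v (proj1 Hs)).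
  apply (even_solution_of_half_line mu u v (Rlt 0) Hs Hu).
Qed.

Lemma positive_parameter_0 : positive_parameter 0.
Proof.
  destruct (even_solution_exists 0) as (u & v & Hs & u0 & v0).
  exists u, v; split; [split; auto|].
  apply (sturm_positive eigen_weight (eigen_potential F 0) (fun _ => 0) u v (fun _ => 1)
    (fun _ => 0));
    auto using eigen_weight_pos; intros.
  - split; intros y; is_derive_calc; ring.
  - lra.
  - unfold eigen_potential; pose proof (exp_opp_half_sqr_le_1 x); pose proof (F_bounds x).
    apply Rmult_le_pos; lra.
  - lra.
  - unfold wronskian; lra.
Qed.

(* Shooting: the supremum of the parameters with a positive even solution is the eigenvalue. *)
Section Shooting.
Variables (mu : R) (u v : R -> R).
Hypothesis (Hmu : is_lub positive_parameter mu) (Hs : even_solution mu u v).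

Lemma shooting_parameter_nonneg : 0 <= mu.
Proof. apply Hmu, positive_parameter_0. Qed.

Lemma shooting_solution_nonneg x : 0 <= u x.
Proof.
  revert x; apply (even_solution_of_half_line mu u v (Rle 0) Hs).
  intros x Hx; apply Rnot_lt_le; intros Hux.
  destruct (even_solution_continuous_dependence mu u v x (- u x / 2) Hs Hx ltac:(lra))
    as (d & Hd & Hclose).
  enough (mu <= mu - d) by lra; apply Hmu; intros nu (w & z & Hw & Hpos).
  apply Rnot_lt_le; intros Hnu; assert (nu <= mu) by (apply Hmu; exists w, z; auto).
  destruct (Hclose nu w z Hw) with (x := x) as [Hwx _]; [apply Rabs_def1; lra|lra|].
  specialize (Hpos x Hx); apply Rabs_le_between in Hwx; lra.
Qed.

Lemma shooting_solution_pos x : 0 < u x.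
Proof. exact (nonneg_solution_pos mu u v Hs shooting_solution_nonneg x). Qed.

Lemma growth_barrier_potential_le nu x : nu <= mu + 1 -> 20 * (mu + 2) <= x ->
  eigen_potential (fun x => / 16 - 7 / 128 * x ^ 2) 0 x <= eigen_potential F nu x.
Proof.
  intros Hnu Hx; pose proof shooting_parameter_nonneg; pose proof (F_bounds x).
  apply eigen_potential_le; assert (20 * x <= x ^ 2) by nra; lra.
Qed.

(* Otherwise the solution for a slightly larger parameter would also be positive. *)
Lemma shooting_wronskian_nonpos y : 20 * (mu + 2) <= y ->
  wronskian u v growth_barrier growth_flux y <= 0.
Proof.
  intros Hy; pose proof shooting_parameter_nonneg; apply Rnot_lt_le; intros Hpos.
  set (p := wronskian u v growth_barrier growth_flux y) in *.
  destruct (continuous_positive_on u 0 y) as (c & Hc & Huc);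
    [lra|apply (continuous_even_solution mu u v Hs)|intros; apply shooting_solution_pos|].
  pose proof (growth_barrier_pos y) as Hk; pose proof (growth_flux_nonneg y ltac:(lra)) as Hz.
  set (eta := Rmin (c / 2) (p / (growth_barrier y + growth_flux y))).
  assert (Heta : 0 < eta) by (apply Rmin_glb_lt; [lra|apply Rdiv_lt_0_compat; lra]).
  pose proof (Rmin_l _ _ : eta <= c / 2).
  assert (Hetap : eta * (growth_barrier y + growth_flux y) <= p)
    by (apply Rle_div_r; [lra|apply Rmin_r]).
  destruct (even_solution_continuous_dependence mu u v y eta Hs ltac:(lra) Heta)
    as (d & Hd & Hclose).
  set (nu := mu + Rmin (d / 2) 1); pose proof (Rmin_l (d / 2) 1); pose proof (Rmin_r (d / 2) 1).
  assert (Hnu : 0 < Rmin (d / 2) 1) by (apply Rmin_glb_lt; lra).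
  destruct (even_solution_exists nu) as (w & z & Hw).
  specialize (Hclose nu w z Hw ltac:(unfold nu; apply Rabs_def1; lra)).
  assert (Hwpos : forall x, 0 <= x <= y -> 0 < w x).
  { intros x Hx; specialize (Huc x Hx); destruct (Hclose x Hx) as [Hwx _].
    apply Rabs_le_between in Hwx; lra. }
  enough (positive_parameter nu)
    by (assert (nu <= mu) by (apply Hmu; assumption); unfold nu in *; lra).
  exists w, z; split; [exact Hw|]; intros x Hx; destruct (Rle_dec x y); [apply Hwpos; lra|].
  apply (sturm_positive eigen_weight (eigen_potential F nu) _ w z growth_barrier growth_flux
    eigen_weight_pos (proj1 Hw) eigen_system_growth_barrier y); [| | | |lra].
  - intros; apply growth_barrier_pos.
  - intros; apply growth_barrier_potential_le; unfold nu; lra.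
  - apply Hwpos; lra.
  - destruct (Hclose y ltac:(lra)) as [Hwy Hzy].
    apply Rabs_le_between in Hwy; apply Rabs_le_between in Hzy.
    unfold p, wronskian in *; nra.
Qed.

Lemma shooting_solution_growth : exists M, 0 < M /\ forall x, u x <= M * growth_barrier x.
Proof.
  pose proof shooting_parameter_nonneg; pose proof (proj1 Hs) as Hsys.
  set (y0 := 20 * (mu + 2)).
  destruct (continuous_bounded_on u 0 y0) as (M & HM & Hu);
    [unfold y0; lra|apply (continuous_even_solution mu u v Hs)|].
  assert (Hinner : forall x, 0 <= x <= y0 -> u x <= M * growth_barrier x).
  { intros x Hx; specialize (Hu x Hx); apply Rabs_le_between in Hu.
    pose proof (growth_barrier_ge_1 x); nra. }
  exists M; split; [exact HM|].
  enough (Hhalf : forall x, 0 <= x -> u x <= M * growth_barrier x).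
  { intros x; destruct (Rle_dec 0 x); [auto|].
    rewrite <- (even_solution_even mu u v Hs).
    replace (growth_barrier x) with (growth_barrier (- x))
      by (unfold growth_barrier; do 2 f_equal; ring).
    apply Hhalf; lra. }
  intros x Hx; destruct (Rle_dec x y0) as [h|h]; [auto|].
  assert (Hquot : - (u y0 / growth_barrier y0) <= - (u x / growth_barrier x)).
  { apply (derive_nonneg_le (fun y => - (u y / growth_barrier y)) (fun y =>
      - (eigen_weight y * wronskian u v growth_barrier growth_flux y / growth_barrier y ^ 2)));
      [lra| |]; intros y Hy; pose proof (growth_barrier_pos y).
    - apply is_derive_Ropp, (is_derive_quotient _ _ _ _ _ _ _ Hsys eigen_system_growth_barrier);
        lra.
    - pose proof (shooting_wronskian_nonpos y (proj1 Hy)); pose proof (eigen_weight_pos y).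
      rewrite <- Rdiv_opp_l; apply Rdiv_le_0_compat; [nra|apply pow_lt; assumption]. }
  pose proof (growth_barrier_pos x); pose proof (growth_barrier_pos y0).
  specialize (Hinner y0 ltac:(unfold y0 in *; lra)); apply Rle_div_l in Hinner; [|assumption].
  apply Rle_div_l; [assumption|lra].
Qed.

Lemma shooting_parameter_eq : mu = lam0.
Proof.
  destruct shooting_solution_growth as (M & _ & HM); apply Rle_antisym.
  - apply (positive_solution_le mu u v (proj1 Hs) shooting_solution_pos).
  - apply (proj2 Hlow), (is_eigenvalue_of_eigen_system F mu u v 0 cF (proj1 Hs));
      [|rewrite (proj1 (proj2 Hs)); lra].
    apply (in_L2m_of_growth u M (/ 16)); [apply (continuous_even_solution mu u v Hs)|lra|].
    intros x; rewrite Rabs_pos_eq by (left; apply shooting_solution_pos).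
    eapply Rle_trans; [apply HM|right; unfold growth_barrier; do 2 f_equal; field].
Qed.
End Shooting.

Theorem ground_state_exists : exists h v C, is_ground_state F lam0 h v C.
Proof.
  destruct (completeness positive_parameter) as [mu Hmu].
  { exists lam0; exact positive_parameter_le. }
  { exists 0; exact positive_parameter_0. }
  destruct (even_solution_exists mu) as (h & v & Hs).
  destruct (shooting_solution_growth mu h v Hmu Hs) as (C & HC & Hgrowth).
  exists h, v, C; rewrite <- (shooting_parameter_eq mu h v Hmu Hs).
  split; [apply Hs|apply (shooting_solution_pos mu h v Hmu Hs)|exact HC|exact Hgrowth].
Qed.
End Ground.

(** * Barriers *)

Section Barriers.
Variables (F h v : R -> R) (lam0 C0 : R) (c : R -> R -> R).
Hypothesis Hc : forall t x, 0 < t -> c t x = F (x / sqrt t) / t.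
Hypothesis (cF : forall x, continuous F x) (F_nonneg : forall x, 0 <= F x).
Hypothesis (Hground : is_ground_state F lam0 h v C0) (Hlam0 : / 2 <= lam0).

Definition ground_profile (y : R) : R := exp (- (y ^ 2 / 2)) * h y.
Definition ground_profile' (y : R) : R := v y - y * ground_profile y.
Definition ground_profile'' (y : R) : R :=
  2 * (F y - lam0) * ground_profile y - ground_profile y - y * ground_profile' y.

Lemma is_derive_ground_profile y : is_derive ground_profile y (ground_profile' y).
Proof.
  pose proof (proj1 (ground_eq Hground)); pose proof (is_derive_exp_opp_half_sqr y).
  unfold ground_profile', ground_profile; is_derive_calc.
  unfold eigen_weight; rewrite exp_Ropp; pose proof (exp_pos (y ^ 2 / 2)); field; lra.
Qed.

Lemma is_derive_ground_profile' y : is_derive ground_profile' y (ground_profile'' y).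
Proof.
  pose proof (proj2 (ground_eq Hground)); pose proof is_derive_ground_profile.
  unfold ground_profile'', ground_profile' at 1; is_derive_calc.
  unfold eigen_potential, ground_profile; ring.
Qed.

Lemma continuous_ground_profile'' y : continuous ground_profile'' y.
Proof.
  pose proof (continuous_is_derive_fun _ _ is_derive_ground_profile).
  pose proof (continuous_is_derive_fun _ _ is_derive_ground_profile').
  unfold ground_profile''; auto 20 with calc.
Qed.

Lemma ground_profile_pos y : 0 < ground_profile y.
Proof. apply Rmult_lt_0_compat; [apply exp_pos|apply (ground_pos Hground)]. Qed.

Lemma ground_profile_le y : ground_profile y <= C0 * exp (- (y ^ 2 / 2)) * growth_barrier y.
Proof.
  unfold ground_profile; pose proof (ground_growth Hground y).
  pose proof (exp_pos (- (y ^ 2 / 2))); nra.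
Qed.

Lemma ground_profile_bounded y : ground_profile y <= C0.
Proof.
  pose proof (ground_growth_pos Hground).
  eapply Rle_trans; [apply ground_profile_le|]; unfold growth_barrier.
  rewrite Rmult_assoc, <- exp_plus; rewrite <- (Rmult_1_r C0) at 2.
  apply Rmult_le_compat_l; [lra|]; apply exp_le_1; pose proof (pow2_ge_0 y); lra.
Qed.

Definition ground_wave : R -> R -> R := selfsim (/ 2 + lam0) ground_profile.

Lemma ground_wave_solution : solution (Rlt 0) c ground_wave.
Proof.
  apply (selfsim_solution (/ 2 + lam0) c F ground_profile ground_profile' ground_profile'' Hc
    is_derive_ground_profile is_derive_ground_profile' continuous_ground_profile'').
  intros y; unfold profile_op, ground_profile''; field.
Qed.

Definition corrector_constant (M : R) : Prop :=
  0 < M /\ forall y, 0 <= (3 / 32 * y ^ 2 + 3 / 8 - (lam0 + 3 / 2)) * gaussian 1 (3 / 8) y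
    + M * ground_profile y.

Lemma corrector_constant_exists : exists M, corrector_constant M.
Proof.
  set (Y := 11 * (lam0 + 2)).
  destruct (continuous_positive_on ground_profile (- Y) Y) as (m & Hm & Hmin);
    [unfold Y; lra|exact (continuous_is_derive_fun _ _ is_derive_ground_profile)
    |intros; apply ground_profile_pos|].
  assert (HM : 0 < (lam0 + 2) / m) by (apply Rdiv_lt_0_compat; lra).
  exists ((lam0 + 2) / m); split; [exact HM|]; intros y.
  pose proof (gaussian_pos 1 (3 / 8) y Rlt_0_1).
  pose proof (gaussian_le 1 (3 / 8) y ltac:(lra) ltac:(lra)).
  destruct (Rle_dec (Rabs y) Y) as [Hy|Hy].
  - apply Rabs_le_between in Hy; specialize (Hmin y Hy).
    assert (lam0 + 2 <= (lam0 + 2) / m * ground_profile y).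
    { replace (lam0 + 2) with ((lam0 + 2) / m * m) at 1 by (field; lra).
      apply Rmult_le_compat_l; lra. }
    pose proof (pow2_ge_0 y); nra.
  - pose proof (ground_profile_pos y).
    assert (Y ^ 2 <= y ^ 2) by (rewrite <- (pow2_abs y); apply pow_incr; unfold Y in *; lra).
    apply Rplus_le_le_0_compat; apply Rmult_le_pos; unfold Y in *; nra.
Qed.

Variables (M : R).
Hypothesis HM : corrector_constant M.

Definition corrector (y : R) : R := gaussian 1 (3 / 8) y - M * ground_profile y.
Definition correction_wave : R -> R -> R := selfsim (/ 2 + lam0 + 1) corrector.

Lemma correction_wave_supersolution : supersolution (Rlt 0) c correction_wave.
Proof.
  pose proof is_derive_ground_profile; pose proof is_derive_ground_profile'.
  pose proof continuous_ground_profile''.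
  apply (selfsim_supersolution (/ 2 + lam0 + 1) c F corrector
    (fun y => gaussian' 1 (3 / 8) y - M * ground_profile' y)
    (fun y => gaussian'' 1 (3 / 8) y - M * ground_profile'' y) Hc); intros y.
  - unfold corrector; is_derive_calc; ring.
  - is_derive_calc; ring.
  - auto 20 with calc.
  - pose proof (proj2 HM y); pose proof (F_nonneg y).
    pose proof (gaussian_pos 1 (3 / 8) y Rlt_0_1).
    apply Rle_trans with (- ((3 / 32 * y ^ 2 + 3 / 8 - (lam0 + 3 / 2)) * gaussian 1 (3 / 8) y
      + M * ground_profile y) - F y * gaussian 1 (3 / 8) y); [right|nra].
    unfold profile_op, corrector, gaussian'', gaussian', ground_profile''; field.
Qed.

Definition upper_barrier (t x : R) : R := (M + 1) * ground_wave t x + correction_wave t x.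

Lemma upper_barrier_supersolution : supersolution (Rlt 0) c upper_barrier.
Proof.
  pose proof (proj1 HM); apply supersolution_plus; [|exact correction_wave_supersolution].
  apply supersolution_scal; [lra|apply solution_super, ground_wave_solution].
Qed.

Lemma upper_barrier_eq t x : 0 < t -> upper_barrier t x = Rpower t (- (/ 2 + lam0)) *
  ((M + 1 - M / t) * ground_profile (x / sqrt t) + / t * gaussian 1 (3 / 8) (x / sqrt t)).
Proof.
  intros Ht; unfold upper_barrier, ground_wave, correction_wave, selfsim, corrector.
  rewrite Rpower_opp_succ by exact Ht; set (y := x / sqrt t); field; lra.
Qed.

Lemma upper_barrier_pos t x : M / (M + 1) < t -> 0 < upper_barrier t x.
Proof.
  intros Ht; pose proof (proj1 HM) as HM0.
  assert (0 < t) by (eapply Rlt_trans; [|exact Ht]; apply Rdiv_lt_0_compat; lra).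
  rewrite upper_barrier_eq by assumption; apply Rmult_lt_0_compat; [apply Rpower_pos|].
  pose proof (ground_profile_pos (x / sqrt t)).
  pose proof (gaussian_pos 1 (3 / 8) (x / sqrt t) Rlt_0_1).
  apply Rlt_div_l in Ht; [|lra].
  assert (M / t < M + 1) by (apply Rlt_div_l; lra).
  assert (0 < / t) by (apply Rinv_0_lt_compat; assumption).
  apply Rplus_lt_0_compat; apply Rmult_lt_0_compat; lra.
Qed.

Lemma upper_barrier_1_ge x : gaussian 1 (3 / 8) x <= upper_barrier 1 x.
Proof.
  rewrite upper_barrier_eq, sqrt_1, Rdiv_1_r by lra; pose proof (ground_profile_pos x).
  replace (Rpower 1 (- (/ 2 + lam0))) with 1
    by (unfold Rpower; rewrite ln_1, Rmult_0_r, exp_0; reflexivity).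
  rewrite Rdiv_1_r, Rinv_1; lra.
Qed.

Lemma upper_barrier_le t x : 1 <= t ->
  upper_barrier t x <= ((M + 1) * C0 + 1) * Rpower t (- (/ 2 + lam0)).
Proof.
  intros Ht; pose proof (proj1 HM); rewrite upper_barrier_eq, Rmult_comm by lra.
  apply Rmult_le_compat_r; [left; apply Rpower_pos|].
  pose proof (ground_profile_pos (x / sqrt t)); pose proof (ground_profile_bounded (x / sqrt t)).
  pose proof (gaussian_pos 1 (3 / 8) (x / sqrt t) Rlt_0_1).
  pose proof (gaussian_le 1 (3 / 8) (x / sqrt t) ltac:(lra) ltac:(lra)).
  assert (0 < / t <= 1)
    by (split; [apply Rinv_0_lt_compat|rewrite <- Rinv_1; apply Rinv_le_contravar]; lra).
  assert (0 < M / t) by (apply Rdiv_lt_0_compat; lra).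
  apply Rplus_le_compat; nra.
Qed.

Variable th : R.
Hypothesis Hth : 0 < th.

Definition lower_barrier (t x : R) : R := ground_wave t x - th * correction_wave t x.

Lemma lower_barrier_subsolution : subsolution (Rlt 0) c lower_barrier.
Proof.
  apply subsolution_minus; [apply solution_sub, ground_wave_solution|].
  apply supersolution_scal; [lra|exact correction_wave_supersolution].
Qed.

Lemma lower_barrier_eq t x : 0 < t -> lower_barrier t x = Rpower t (- (/ 2 + lam0)) *
  ((1 + th * M / t) * ground_profile (x / sqrt t) - th / t * gaussian 1 (3 / 8) (x / sqrt t)).
Proof.
  intros Ht; unfold lower_barrier, ground_wave, correction_wave, selfsim, corrector.
  rewrite Rpower_opp_succ by exact Ht; set (y := x / sqrt t); field; lra.
Qed.

Lemma lower_barrier_bounded s : 0 < s ->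
  exists B, 0 <= B /\ forall t x, s <= t -> lower_barrier t x <= B.
Proof.
  intros Hs; pose proof (proj1 HM); pose proof (ground_growth_pos Hground).
  assert (HthM : 0 < th * M) by (apply Rmult_lt_0_compat; assumption).
  assert (0 < th * M / s) by (apply Rdiv_lt_0_compat; assumption).
  pose proof (Rpower_pos s (- (/ 2 + lam0))).
  exists (Rpower s (- (/ 2 + lam0)) * ((1 + th * M / s) * C0)); split.
  { repeat apply Rmult_le_pos; lra. }
  intros t x Ht; rewrite lower_barrier_eq by lra.
  pose proof (ground_profile_pos (x / sqrt t)); pose proof (ground_profile_bounded (x / sqrt t)).
  pose proof (gaussian_pos 1 (3 / 8) (x / sqrt t) Rlt_0_1).
  assert (0 < th * M / t) by (apply Rdiv_lt_0_compat; lra).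
  assert (th * M / t <= th * M / s)
    by (apply Rmult_le_compat_l; [lra|apply Rinv_le_contravar; lra]).
  assert (0 < th / t) by (apply Rdiv_lt_0_compat; lra).
  apply Rle_trans with (Rpower t (- (/ 2 + lam0)) * ((1 + th * M / s) * C0)).
  - apply Rmult_le_compat_l; [left; apply Rpower_pos|]; nra.
  - apply Rmult_le_compat_r; [nra|]; apply Rpower_opp_le; lra.
Qed.

(* With [w = exp (y^2 / 16)], both [ground_profile y <= C0 w exp (- y^2 / 2)] and
   [gaussian 1 (3 / 8) y = w^2 exp (- y^2 / 2)], and a quadratic [a w - d w^2] is bounded. *)
Lemma lower_barrier_le_heat t : 0 < t ->
  exists Q, 0 < Q /\ forall x, lower_barrier t x <= Q * heat t x.
Proof.
  intros Ht; pose proof (proj1 HM); pose proof gaussian_mass_pos; pose proof (sqrt_lt_R0 t Ht).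
  set (a := (1 + th * M / t) * C0); set (d := th / t).
  assert (Hd : 0 < d) by (apply Rdiv_lt_0_compat; assumption).
  assert (Hthm : 0 < th * M / t)
    by (apply Rdiv_lt_0_compat; [apply Rmult_lt_0_compat|]; assumption).
  pose proof (Rpower_pos t (- (/ 2 + lam0))) as HR.
  set (q := a ^ 2 / (4 * d) + 1).
  assert (Hq : 0 < q)
    by (apply Rplus_le_lt_0_compat; [apply Rdiv_le_0_compat; [apply pow2_ge_0|]|]; lra).
  exists (Rpower t (- (/ 2 + lam0)) * q * gaussian_mass * sqrt t); split.
  { repeat apply Rmult_lt_0_compat; assumption. }
  intros x; rewrite lower_barrier_eq by exact Ht; set (y := x / sqrt t).
  set (w := growth_barrier y); set (g := exp (- (y ^ 2 / 2))).
  assert (Hg : 0 < g) by apply exp_pos.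
  assert (Egw : gaussian 1 (3 / 8) y = g * w ^ 2).
  { unfold gaussian, g, w, growth_barrier.
    replace (exp (y ^ 2 / 16) ^ 2) with (exp (y ^ 2 / 16) * exp (y ^ 2 / 16)) by ring.
    rewrite <- !exp_plus, Rmult_1_l; f_equal; field. }
  assert (Eheat : gaussian_mass * sqrt t * heat t x = g).
  { unfold heat, selfsim, gaussian; rewrite Rpower_opp_half by exact Ht; fold y.
    replace (- / 2 * y ^ 2) with (- (y ^ 2 / 2)) by field; fold g; field; lra. }
  replace (_ * sqrt t * heat t x) with (Rpower t (- (/ 2 + lam0)) * (q * g))
    by (rewrite <- Eheat; ring).
  apply Rmult_le_compat_l; [lra|]; rewrite Egw; fold d.
  assert (Hpsi : (1 + th * M / t) * ground_profile y <= a * g * w).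
  { pose proof (ground_profile_le y) as Hle; fold g w in Hle; unfold a.
    apply (Rmult_le_compat_l (1 + th * M / t)) in Hle; lra. }
  assert (Hquad : 0 <= (a - 2 * d * w) ^ 2 / (4 * d))
    by (apply Rdiv_le_0_compat; [apply pow2_ge_0|lra]).
  replace ((a - 2 * d * w) ^ 2 / (4 * d)) with (q - 1 - (a * w - d * w ^ 2)) in Hquad
    by (unfold q; field; lra).
  nra.
Qed.

Lemma lower_barrier_ge K t x : 1 <= t -> Rabs x <= K * sqrt t ->
  (forall y, - K <= y <= K -> 2 * th <= ground_profile y) ->
  th * Rpower t (- (/ 2 + lam0)) <= lower_barrier t x.
Proof.
  intros Ht Hx Hmin; pose proof (proj1 HM); rewrite lower_barrier_eq, Rmult_comm by lra.
  apply Rmult_le_compat_l; [left; apply Rpower_pos|].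
  pose proof (sqrt_lt_R0 t ltac:(lra)) as Hs.
  assert (Hy : - K <= x / sqrt t <= K).
  { apply Rabs_le_between; rewrite Rabs_div, (Rabs_pos_eq (sqrt t)) by lra.
    apply Rle_div_l; assumption. }
  specialize (Hmin _ Hy); pose proof (gaussian_pos 1 (3 / 8) (x / sqrt t) Rlt_0_1).
  pose proof (gaussian_le 1 (3 / 8) (x / sqrt t) ltac:(lra) ltac:(lra)).
  assert (0 < th / t <= th).
  { split; [apply Rdiv_lt_0_compat; lra|apply Rle_div_l; nra]. }
  assert (0 < th * M / t) by (apply Rdiv_lt_0_compat; [apply Rmult_lt_0_compat|]; lra).
  nra.
Qed.
End Barriers.

Lemma sub_sqr_div_plus_le a b : 0 < a -> 0 < b -> a - a ^ 2 / (a + b) <= b.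
Proof.
  intros Ha Hb; apply Rminus_le_0.
  replace (b - (a - a ^ 2 / (a + b))) with (b ^ 2 / (a + b)) by (field; lra).
  apply Rdiv_le_0_compat; [apply pow2_ge_0|lra].
Qed.

Lemma Rpower_dilation lam t a : 0 < lam -> 0 < t ->
  lam ^ 2 * Rpower (lam ^ 2 * t) (- (/ 2 + a)) = Rpower t (- / 2 - a) * Rpower lam (- (2 * a - 1)).
Proof.
  intros Hl Ht; assert (E : lam ^ 2 = Rpower lam 2)
    by (rewrite <- Rpower_pow by exact Hl; reflexivity).
  rewrite <- Rpower_mult_distr by (try apply pow_lt; assumption); rewrite E, Rpower_mult.
  replace (- (2 * a - 1)) with (2 + 2 * - (/ 2 + a)) by field; rewrite Rpower_plus.
  replace (- / 2 - a) with (- (/ 2 + a)) by ring; ring.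
Qed.

(** * The gap between [Vinf] and the solutions of finite mass *)

Section Gap.
Variables (V : R -> R -> R -> R) (Vinf : R -> R -> R).
Hypothesis HV : forall lam, 0 < lam -> source_solution (V lam) lam.
Hypothesis hVinf : forall t x, 0 < t -> is_lim (fun lam => V lam t x) p_infty (Vinf t x).

(* [exp (x^2 / 2) F] is a positive solution for the potential [F / 2] and the parameter [1 / 2]. *)
Lemma half_le_eigenvalue mu : is_eigenvalue_LF (Vinf 1) mu -> / 2 <= mu.
Proof.
  intros Hmu; apply Rnot_lt_le; intros Hlt; set (F := Vinf 1) in *.
  pose proof (is_derive_limit_profile V Vinf HV hVinf : forall x, is_derive F x _).
  pose proof (is_derive_limit_profile' V Vinf HV hVinf); pose proof is_derive_eigen_weight.
  assert (Fpos : forall x, 0 < F x) by (intros x; apply (limit_profile_bounds V Vinf HV hVinf)).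
  set (k' x := eigen_weight x * (limit_profile' Vinf x + x * F x)).
  assert (Hk : eigen_system (fun x => F x / 2) (/ 2) (fun x => eigen_weight x * F x)
    (fun x => exp (- (x ^ 2 / 2)) * k' x)).
  { apply (eigen_system_intro _ _ _ _
      (fun x => x * k' x + (F x - 1) * (eigen_weight x * F x))); intros x; unfold k'.
    - is_derive_calc; ring.
    - is_derive_calc; unfold limit_profile''; fold F; ring.
    - field. }
  refine (positive_solution_excludes_eigenvalue F (fun x => F x / 2) mu (/ 2) _ _ _ Hk _ _ Hmu).
  - apply (continuous_limit_profile V Vinf HV hVinf).
  - intros x; apply Rmult_lt_0_compat; [apply eigen_weight_pos|apply Fpos].
  - intros x; specialize (Fpos x); lra.
Qed.

Lemma gap_dilation lam t x : 0 < lam -> 0 < t -> Vinf t x - V lam t x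
  = lam ^ 2 * (Vinf (lam ^ 2 * t) (lam * x) - V 1 (lam ^ 2 * t) (lam * x)).
Proof.
  intros Hl Ht; pose proof (limit_dilation V Vinf HV hVinf lam t x ltac:(lra) Ht).
  pose proof (family_dilation V HV 1 lam t x Rlt_0_1 ltac:(lra) Ht) as Hdil.
  rewrite Rabs_pos_eq, Rmult_1_r in Hdil by lra; lra.
Qed.

Lemma gap_nonneg t x : 0 < t -> 0 <= Vinf t x - V 1 t x.
Proof. intros Ht; pose proof (family_le_limit V Vinf HV hVinf 1 t x Rlt_0_1 Ht); lra. Qed.

Lemma gap_supersolution : supersolution (Rlt 0) Vinf (fun t x => Vinf t x - V 1 t x).
Proof.
  apply supersolution_half_minus; [apply (limit_solution V Vinf HV hVinf)|].
  apply (HV 1 Rlt_0_1).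
Qed.

Lemma limit_pos t x : 0 < t -> 0 < Vinf t x.
Proof.
  intros Ht; rewrite (limit_selfsim V Vinf HV hVinf) by exact Ht.
  apply Rmult_lt_0_compat; [apply Rpower_pos|apply (limit_profile_bounds V Vinf HV hVinf)].
Qed.

Lemma limit_le_inv_time t x : 0 < t -> Vinf t x <= gaussian_amplitude * / t.
Proof.
  intros Ht; rewrite (limit_selfsim V Vinf HV hVinf) by exact Ht.
  unfold selfsim; rewrite Rpower_opp_1, Rmult_comm by exact Ht.
  apply Rmult_le_compat_r; [left; apply Rinv_0_lt_compat, Ht|].
  apply (limit_profile_bounds V Vinf HV hVinf).
Qed.

Lemma limit_potential t x : 0 < t -> Vinf t x = Vinf 1 (x / sqrt t) / t.
Proof.
  intros Ht; rewrite (limit_selfsim V Vinf HV hVinf) at 1 by exact Ht.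
  unfold selfsim; rewrite Rpower_opp_1 by exact Ht; apply Rmult_comm.
Qed.

Lemma heat_le_gap r x : r = exp (- / gaussian_mass) / 2 ->
  heat (r ^ 2) x <= Vinf (r ^ 2) x - V 1 (r ^ 2) x.
Proof.
  intros Hr; pose proof (exp_pos (- / gaussian_mass)); assert (Hr0 : 0 < r) by lra.
  assert (Hr2 : 0 < r ^ 2) by (apply pow_lt, Hr0).
  assert (Eheat : heat (r ^ 2) x = / r * heat 1 (x / r)).
  { unfold heat, selfsim; rewrite !Rpower_opp_half, sqrt_pow2, sqrt_1, Rdiv_1_r by lra.
    field; lra. }
  pose proof (source_le_heat (V 1) 1 (HV 1 Rlt_0_1) (r ^ 2) x ltac:(lra) Hr2).
  pose proof (limit_profile_lower V Vinf HV hVinf (x / r)) as Hlow.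
  replace (exp (- / gaussian_mass)) with (2 * r) in Hlow by lra.
  assert (Hlim : 2 * heat (r ^ 2) x <= Vinf (r ^ 2) x).
  { rewrite limit_potential, sqrt_pow2, Eheat by lra.
    apply (Rle_div_r _ _ (r ^ 2) Hr2).
    replace (2 * (/ r * heat 1 (x / r)) * r ^ 2) with (2 * r * heat 1 (x / r)) by (field; lra).
    exact Hlow. }
  lra.
Qed.

Variables (h v : R -> R) (lam0 C0 M : R).
Hypothesis (Hground : is_ground_state (Vinf 1) lam0 h v C0) (Hlam0 : / 2 <= lam0).
Hypothesis HM : corrector_constant h lam0 M.

Lemma limit_profile_nonneg x : 0 <= Vinf 1 x.
Proof. left; apply (limit_profile_bounds V Vinf HV hVinf). Qed.

Definition barrier_scale : R := gaussian_amplitude ^ 2 * gaussian_mass * exp (/ gaussian_mass).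

Lemma barrier_scale_pos : 0 < barrier_scale.
Proof.
  pose proof gaussian_amplitude_pos; pose proof gaussian_mass_pos.
  apply Rmult_lt_0_compat; [apply Rmult_lt_0_compat; [apply pow_lt|]|apply exp_pos]; assumption.
Qed.

Lemma scaled_upper_barrier_supersolution :
  supersolution (Rlt 0) Vinf (fun t x => barrier_scale * upper_barrier h lam0 M t x).
Proof.
  apply supersolution_scal; [left; apply barrier_scale_pos|].
  apply (upper_barrier_supersolution (Vinf 1) h v lam0 C0 Vinf limit_potential
    (continuous_limit_profile V Vinf HV hVinf) limit_profile_nonneg Hground M HM).
Qed.

Lemma initial_upper_barrier x :
  Vinf 1 x ^ 2 / (Vinf 1 x + barrier_scale * upper_barrier h lam0 M 1 x) <= V 1 1 x.
Proof.
  pose proof gaussian_amplitude_pos; pose proof gaussian_mass_pos; pose proof barrier_scale_pos.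
  pose proof (limit_pos 1 x Rlt_0_1); pose proof (limit_profile_upper V Vinf HV hVinf x).
  pose proof (gaussian_pos 1 (3 / 8) x Rlt_0_1).
  pose proof (upper_barrier_1_ge (Vinf 1) h v lam0 C0 Hground M x).
  assert (0 < barrier_scale * gaussian 1 (3 / 8) x) by (apply Rmult_lt_0_compat; assumption).
  eapply Rle_trans; [|apply (source_lower (V 1) 1 1 x (HV 1 Rlt_0_1)); lra].
  apply Rle_trans with (gaussian gaussian_amplitude (7 / 16) x ^ 2
    / (barrier_scale * gaussian 1 (3 / 8) x)).
  - apply Rmult_le_compat; [apply pow2_ge_0| |apply pow_incr; lra|].
    + left; apply Rinv_0_lt_compat; nra.
    + apply Rinv_le_contravar; nra.
  - right; unfold barrier_scale, heat, selfsim, gaussian.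
    rewrite Rpower_opp_half, sqrt_1, Rinv_1, Rdiv_1_r by lra.
    replace ((gaussian_amplitude * exp (- (7 / 16) * x ^ 2)) ^ 2) with
      (gaussian_amplitude ^ 2 * (exp (- (7 / 16) * x ^ 2) * exp (- (7 / 16) * x ^ 2))) by ring.
    replace (- (1 / gaussian_mass) * 1) with (- / gaussian_mass) by (field; lra).
    rewrite exp_Ropp, <- exp_plus.
    replace (- (7 / 16) * x ^ 2 + - (7 / 16) * x ^ 2) with (- / 2 * x ^ 2 + - (3 / 8) * x ^ 2)
      by field.
    rewrite exp_plus; pose proof (exp_pos (- (3 / 8) * x ^ 2)).
    pose proof (exp_pos (/ gaussian_mass)).
    field; lra.
Qed.

Lemma gap_le_upper_barrier t x : 1 <= t ->
  Vinf t x - V 1 t x <= barrier_scale * upper_barrier h lam0 M t x.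
Proof.
  intros Ht; pose proof (proj1 HM); pose proof barrier_scale_pos; set (t0 := M / (M + 1)).
  assert (Ht0 : 0 < t0 < 1)
    by (split; [apply Rdiv_lt_0_compat|apply Rlt_div_l]; lra).
  set (U := fun t x => barrier_scale * upper_barrier h lam0 M t x).
  assert (HU : forall t x, t0 < t -> 0 < U t x).
  { intros; apply Rmult_lt_0_compat; [assumption|].
    apply (upper_barrier_pos (Vinf 1) h v lam0 C0 Hground M HM); assumption. }
  assert (Hinf : forall t x, t0 < t -> 0 < Vinf t x) by (intros; apply limit_pos; lra).
  assert (Hle : Vinf t x ^ 2 / (Vinf t x + U t x) <= V 1 t x).
  { revert x.
    apply (absorption_comparison t0 (fun t x => Vinf t x ^ 2 / (Vinf t x + U t x)) (V 1) 1 t);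
      [| | |lra|exact initial_upper_barrier].
    - apply subsolution_sqr_div_plus; auto.
      + apply (subsolution_subset (Rlt 0)); [intros; lra|].
        apply solution_sub, (limit_solution V Vinf HV hVinf).
      + apply (supersolution_subset (Rlt 0));
          [intros; lra|exact scaled_upper_barrier_supersolution].
    - apply (supersolution_subset (Rlt 0)); [intros; lra|apply solution_super, (HV 1 Rlt_0_1)].
    - intros; apply (HV 1 Rlt_0_1); lra. }
  pose proof (sub_sqr_div_plus_le (Vinf t x) (U t x) (Hinf t x ltac:(lra)) (HU t x ltac:(lra))).
  unfold U in *; lra.
Qed.

Lemma gap_le_Rpower : exists C, 0 < C /\ forall t x, 0 < t ->
  Vinf t x - V 1 t x <= C * Rpower t (- (/ 2 + lam0)).
Proof.
  pose proof (proj1 HM); pose proof (ground_growth_pos Hground).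
  pose proof barrier_scale_pos; pose proof gaussian_amplitude_pos.
  set (C := barrier_scale * ((M + 1) * C0 + 1)).
  assert (HC : 0 < C).
  { apply Rmult_lt_0_compat; [assumption|].
    assert (0 < (M + 1) * C0) by (apply Rmult_lt_0_compat; lra); lra. }
  exists (C + gaussian_amplitude); split; [lra|].
  intros t x Ht; pose proof (Rpower_pos t (- (/ 2 + lam0))).
  destruct (Rle_dec 1 t) as [Ht1|Ht1].
  - pose proof (gap_le_upper_barrier t x Ht1).
    pose proof (upper_barrier_le (Vinf 1) h v lam0 C0 Hground M HM t x Ht1) as Hle.
    apply (Rmult_le_compat_l barrier_scale) in Hle; [|lra]; unfold C; nra.
  - pose proof (limit_le_inv_time t x Ht); pose proof (proj1 (proj2 (HV 1 Rlt_0_1)) t x Ht).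
    assert (/ t <= Rpower t (- (/ 2 + lam0))).
    { rewrite <- Rpower_opp_1 by exact Ht; apply exp_le_exp.
      assert (ln t < 0) by (rewrite <- ln_1; apply ln_increasing; lra); nra. }
    nra.
Qed.

Lemma lower_barrier_le_gap th : 0 < th -> exists e, 0 < e /\ forall t x, 1 <= t ->
  e * lower_barrier h lam0 M th t x <= Vinf t x - V 1 t x.
Proof.
  intros Hth; set (r := exp (- / gaussian_mass) / 2).
  assert (Hr : 0 < r < 1).
  { unfold r; pose proof (exp_pos (- / gaussian_mass)); pose proof inv_gaussian_mass_pos.
    pose proof (exp_le_1 (- / gaussian_mass) ltac:(lra)); lra. }
  assert (Hr2 : 0 < r ^ 2 < 1) by (split; [apply pow_lt|]; nra).
  destruct (lower_barrier_le_heat (Vinf 1) h v lam0 C0 Hground M HM th Hth (r ^ 2) (proj1 Hr2))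
    as (Q & HQ & Hheat).
  destruct (lower_barrier_bounded (Vinf 1) h v lam0 C0 Hground Hlam0 M HM th Hth (r ^ 2 / 2)
    ltac:(lra)) as (B & HB & Hbound).
  exists (/ Q); split; [apply Rinv_0_lt_compat, HQ|]; intros t x Ht; revert x.
  pose proof (Rinv_0_lt_compat Q HQ) as HQ'.
  apply (linear_comparison (r ^ 2 / 2) Vinf (fun t x => / Q * lower_barrier h lam0 M th t x)
    (fun t x => Vinf t x - V 1 t x) (/ Q * B) (r ^ 2) t); try lra.
  - apply Rmult_le_pos; lra.
  - apply subsolution_scal; [lra|]; apply (subsolution_subset (Rlt 0)); [intros; lra|].
    apply (lower_barrier_subsolution (Vinf 1) h v lam0 C0 Vinf limit_potential
      (continuous_limit_profile V Vinf HV hVinf) limit_profile_nonneg Hground M HM th Hth).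
  - apply (supersolution_subset (Rlt 0)); [intros; lra|exact gap_supersolution].
  - intros; left; apply limit_pos; lra.
  - intros s x Hs; pose proof (gap_nonneg s x ltac:(lra)).
    pose proof (Rmult_le_compat_l (/ Q) _ _ ltac:(lra) (Hbound s x ltac:(lra))); lra.
  - intros x; eapply Rle_trans; [|apply heat_le_gap; reflexivity].
    apply (Rmult_le_reg_l Q); [exact HQ|].
    rewrite <- Rmult_assoc, Rinv_r, Rmult_1_l by lra; apply Hheat.
Qed.

Lemma Rpower_le_gap K : 1 <= K -> exists c, 0 < c /\ forall t x, 1 <= t -> Rabs x <= K * sqrt t ->
  c * Rpower t (- (/ 2 + lam0)) <= Vinf t x - V 1 t x.
Proof.
  intros HK; destruct (continuous_positive_on (ground_profile h) (- K) K) as (m & Hm & Hmin).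
  { lra. }
  { exact (continuous_is_derive_fun _ _ (is_derive_ground_profile (Vinf 1) h v lam0 C0 Hground)). }
  { intros; apply (ground_profile_pos (Vinf 1) h v lam0 C0 Hground). }
  destruct (lower_barrier_le_gap (m / 2) ltac:(lra)) as (e & He & Hgap).
  exists (e * (m / 2)); split; [apply Rmult_lt_0_compat; lra|]; intros t x Ht Hx.
  eapply Rle_trans; [|apply Hgap, Ht]; rewrite Rmult_assoc; apply Rmult_le_compat_l; [lra|].
  apply (lower_barrier_ge h lam0 M HM (m / 2) ltac:(lra) K t x Ht Hx).
  intros y Hy; specialize (Hmin y Hy); lra.
Qed.

Lemma gap_upper_bound : exists C, 0 < C /\ forall t lam x, 0 < t -> 0 < lam ->
  Vinf t x - V lam t x <= C * Rpower t (- / 2 - lam0) * Rpower lam (- (2 * lam0 - 1)).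
Proof.
  destruct gap_le_Rpower as (C & HC & Hgap); exists C; split; [exact HC|].
  intros t lam x Ht Hl; assert (0 < lam ^ 2) by (apply pow_lt, Hl).
  rewrite Rmult_assoc, <- (Rpower_dilation lam t lam0 Hl Ht), gap_dilation by assumption.
  rewrite <- Rmult_assoc, (Rmult_comm C), Rmult_assoc; apply Rmult_le_compat_l; [lra|].
  apply Hgap, Rmult_lt_0_compat; assumption.
Qed.

Lemma gap_lower_bound K : 1 <= K -> exists c, 0 < c /\ forall t lam x, 0 < t ->
  Rpower t (- / 2) <= lam -> Rabs x <= K * sqrt t ->
  c * Rpower t (- / 2 - lam0) * Rpower lam (- (2 * lam0 - 1)) <= Vinf t x - V lam t x.
Proof.
  intros HK; destruct (Rpower_le_gap K HK) as (c & Hc & Hgap); exists c; split; [exact Hc|].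
  intros t lam x Ht Hlt Hx; rewrite Rpower_opp_half in Hlt by exact Ht.
  pose proof (sqrt_lt_R0 t Ht) as Hs; pose proof (Rinv_0_lt_compat _ Hs).
  assert (Hl : 0 < lam) by lra; assert (0 < lam ^ 2) by (apply pow_lt, Hl).
  assert (Esqrt : sqrt (lam ^ 2 * t) = lam * sqrt t) by (rewrite sqrt_mult, sqrt_pow2; lra).
  assert (Hlarge : 1 <= lam * sqrt t).
  { replace 1 with (/ sqrt t * sqrt t) by (field; lra); apply Rmult_le_compat_r; lra. }
  rewrite Rmult_assoc, <- (Rpower_dilation lam t lam0 Hl Ht), gap_dilation by assumption.
  rewrite <- Rmult_assoc, (Rmult_comm c), Rmult_assoc; apply Rmult_le_compat_l; [lra|].
  apply Hgap.
  - rewrite <- (sqrt_sqrt t) by lra; nra.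
  - rewrite Esqrt, Rabs_mult, (Rabs_pos_eq lam) by lra; nra.
Qed.
End Gap.

Theorem theorem1p4
  (V : R -> R -> R -> R) (Vinf : R -> R -> R) (lam0 : R)
  (hV : forall lam, 0 < lam -> is_V_lambda (V lam) lam)
  (hVinf : forall t x, 0 < t ->
     is_lim (fun lam => V lam t x) p_infty (Vinf t x))
  (hlam0 : lowest_eigenvalue_LF (fun x => Vinf 1 x) lam0) :
  exists (Cbar : R) (Cund : R -> R),
    0 < Cbar /\ (forall K, 1 <= K -> 0 < Cund K) /\
    (forall t lam x, 0 < t -> 0 < lam ->
       Vinf t x - V lam t x
         <= Cbar * Rpower t (- / 2 - lam0) * Rpower lam (- (2 * lam0 - 1))) /\
    (forall K t lam x, 1 <= K -> 0 < t -> Rpower t (- / 2) <= lam ->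
       Rabs x <= K * sqrt t ->
       Cund K * Rpower t (- / 2 - lam0) * Rpower lam (- (2 * lam0 - 1))
         <= Vinf t x - V lam t x).
Proof.
  assert (HV : forall lam, 0 < lam -> source_solution (V lam) lam)
    by (intros lam Hl; apply source_solution_of_is_V_lambda, hV, Hl).
  destruct (ground_state_exists (Vinf 1) gaussian_amplitude lam0) as (h & v & C0 & Hground).
  { apply (continuous_limit_profile V Vinf HV hVinf). }
  { intros x; pose proof (limit_profile_bounds V Vinf HV hVinf x); lra. }
  { intros x; apply (limit_even V Vinf HV hVinf), Rlt_0_1. }
  { exact hlam0. }
  pose proof (half_le_eigenvalue V Vinf HV hVinf lam0 (proj1 hlam0)) as Hlam0.
  destruct (corrector_constant_exists (Vinf 1) h v lam0 C0 Hground Hlam0) as [M HM].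
  destruct (gap_upper_bound V Vinf HV hVinf h v lam0 C0 M Hground Hlam0 HM)
    as (Cbar & HCbar & Hupper).
  assert (Hlower := gap_lower_bound V Vinf HV hVinf h v lam0 C0 M Hground Hlam0 HM).
  destruct (functional_choice (fun K c => 1 <= K -> 0 < c /\ forall t lam x, 0 < t ->
    Rpower t (- / 2) <= lam -> Rabs x <= K * sqrt t ->
    c * Rpower t (- / 2 - lam0) * Rpower lam (- (2 * lam0 - 1)) <= Vinf t x - V lam t x))
    as [Cund HCund].
  { intros K; destruct (Rle_dec 1 K) as [HK|HK]; [|exists 0; contradiction].
    destruct (Hlower K HK) as [c Hc]; eauto. }
  exists Cbar, Cund; repeat split; [exact HCbar|intros K HK; apply (HCund K HK)|exact Hupper|].
  intros K t lam x HK; apply (HCund K HK).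
Qed.
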